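(* Let $\alpha\ge 0$ and let $\beta\in\mathbb{C}$ with $\operatorname{Re}\beta>0$. Then: (i) the operator $\mathcal{C}_\beta$ is a bounded operator on $\tau_p^\alpha$ for $1<p\le\infty$; (ii) the operator $\mathcal{C}_\beta^*$ is a bounded operator on $\tau_p^\alpha$ for $1\le p<\infty$. In addition, for $f\in\tau_p^\alpha$ the following identities hold: $$\mathcal{C}_\beta f(n)=\beta\int_0^\infty(1-e^{-t})^{\beta-1}e^{-t(1-\frac1p)}\,T_p(t)f(n)\,dt,\qquad n\in\mathbb{N}_0,\ 1<p\le\infty,$$ $$\mathcal{C}_\beta^* f(n)=\beta\int_0^\infty(1-e^{-t})^{\beta-1}e^{-\frac tp}\,S_p(t)f(n)\,dt,\qquad n\in\mathbb{N}_0,\ 1\le p<\infty.$$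
   Context: $\mathbb{N}_0=\{0,1,2,\ldots\}$; $1/p=0$ for $p=\infty$. For $\gamma\in\mathbb{C}$ put $k^\gamma(0)=1$ and $k^\gamma(n)=\frac{\gamma(\gamma+1)\cdots(\gamma+n-1)}{n!}$ for $n\ge1$. Fractional differences: for $f:\mathbb{N}_0\to\mathbb{C}$ and $\alpha>0$, $W^{-\alpha}f(n)=\sum_{j=n}^\infty k^\alpha(j-n)f(j)$ whenever this makes sense; $W^1f(n)=f(n)-f(n+1)$, $W^m$ is the $m$-fold iterate of $W^1$ for integers $m\ge1$; and for $\alpha>0$, $W^\alpha f=W^mW^{-(m-\alpha)}f$ with $m=[\alpha]+1$, whenever this makes sense (for integer $\alpha$ this is the iterated difference). $W^0$ is the identity. Spaces: for $\alpha>0$ and $1\le p<\infty$, $\tau_p^\alpha$ is the space of complex sequences $f=(f(n))_{n\in\mathbb{N}_0}$ vanishing at infinity such that $\|f\|_{\alpha,p}=\big(\sum_{n=0}^\infty|W^\alpha f(n)|^p(k^{\alpha+1}(n))^p\big)^{1/p}<\infty$; $\tau_\infty^\alpha$ is the space of complex sequences vanishing at infinity such that $\|f\|_{\alpha,\infty}=\sup_{n\in\mathbb{N}_0}|W^\alpha f(n)|k^{\alpha+1}(n)<\infty$. For $\alpha=0$, $\tau_p^0=\ell^p$ ($1\le p\le\infty$) with its usual norm. Operators: for $\operatorname{Re}\beta>0$ and $n\in\mathbb{N}_0$, $$\mathcal{C}_\beta f(n)=\frac1{k^{\beta+1}(n)}\sum_{j=0}^nk^\beta(n-j)f(j),\qquad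 \mathcal{C}_\beta^*f(n)=\sum_{j=n}^\infty\frac1{k^{\beta+1}(j)}k^\beta(j-n)f(j),$$ and for $t\ge0$ (with $0^0=1$) $$T_p(t)f(n)=e^{-\frac tp}\sum_{j=0}^n\binom nj e^{-tj}(1-e^{-t})^{n-j}f(j),\qquad S_p(t)f(n)=e^{-t(1-\frac1p+n)}\sum_{j=n}^\infty\binom jn(1-e^{-t})^{j-n}f(j).$$ *)

(* Defs.v *)
(* Built on MathComp and MathComp-Analysis: complex numbers are R[i] over an
   arbitrary R : realType, and R[i]^o carries their usual topology. *)
From HB Require Import structures.
From mathcomp Require Import all_boot all_order all_algebra.
From mathcomp Require Import complex.
From mathcomp Require Import all_classical all_reals all_analysis.
Set Implicit Arguments.
Unset Strict Implicit.
Unset Printing Implicit Defensive.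
Import Order.TTheory GRing.Theory Num.Theory.
Import numFieldNormedType.Exports.
Local Open Scope classical_set_scope.
Local Open Scope complex_scope.
Local Open Scope ring_scope.

(* k^g(n) = g (g + 1) ... (g + n - 1) / n!, used both over R and over R[i]. *)
Definition cesaro_num (F : fieldType) (g : F) (n : nat) : F :=
  (\prod_(i < n) (g + i%:R)) / n`!%:R.

Section SeriesFrom.
Variable R : realType.
Implicit Types (u : nat -> R[i]^o) (n : nat).

(* Infinite sums are limits of partial sums (ordinary, not necessarily
   absolute, convergence). limn is total, so the convergence of each series
   used below is recorded separately by sum_from_cvg. *)
Definition sum_from_cvg n u : Prop := cvgn (fun N => \sum_(n <= j < N) u j).

Definition sum_from n u : R[i]^o := limn (fun N => \sum_(n <= j < N) u j).

End SeriesFrom.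

Section FractionalDifferences.
Variable R : realType.
Implicit Types (f : nat -> R[i]^o) (g alpha : R) (n : nat).

Definition frac_sum_term g f n (j : nat) : R[i]^o :=
  (cesaro_num g (j - n))%:C * f j.

Definition frac_sum_cvg g f n : Prop :=
  sum_from_cvg n (frac_sum_term g f n).

(* W^(-g) *)
Definition frac_sum g f n : R[i]^o := sum_from n (frac_sum_term g f n).

Definition difference f n : R[i]^o := f n - f n.+1.

(* W^alpha for alpha >= 0. When alpha is an integer it is the iterated
   difference (the identity for alpha = 0): no infinite sum is involved. *)
Definition frac_diff alpha f : nat -> R[i]^o :=
  if alpha \is a Num.nat then iter (Num.truncn alpha) difference f
  else let m := (Num.truncn alpha).+1 in
       iter m difference (frac_sum (m%:R - alpha) f).

Definition frac_diff_defined alpha f : Prop :=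
  alpha \isn't a Num.nat ->
  forall n, frac_sum_cvg ((Num.truncn alpha).+1%:R - alpha) f n.

Definition modulus (z : R[i]) : R := ComplexField.Normc.normc z.

(* For alpha = 0 the weight k^1(n) is 1 and this is the usual l^p norm.
   Only 1 <= p <= +oo is meaningful. *)
Definition tau_norm alpha (p : \bar R) f : \bar R :=
  let w n := cesaro_num (alpha + 1) n in
  match p with
  | r%:E => ((\sum_(0 <= n <oo)
      (powR (modulus (frac_diff alpha f n)) r * powR (w n) r)%:E) `^ r^-1)%E
  | +oo%E => ereal_sup (range (fun n => (modulus (frac_diff alpha f n) * w n)%:E))
  | -oo%E => +oo%E
  end.

(* Vanishing at infinity is required only for alpha > 0: the space with
   alpha = 0, p = +oo is l^oo and not c_0. *)
Definition tau alpha (p : \bar R) : set (nat -> R[i]^o) :=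
  [set f | [/\ 0 < alpha -> f @ \oo --> (0 : R[i]^o),
               frac_diff_defined alpha f
             & (tau_norm alpha p f < +oo)%E]].

Definition bounded_on_tau alpha (p : \bar R)
    (A : (nat -> R[i]^o) -> nat -> R[i]^o) : Prop :=
  [/\ forall f, tau alpha p f -> tau alpha p (A f),
      forall (c : R[i]) f h, tau alpha p f -> tau alpha p h ->
        forall n, A (fun j => c * f j + h j) n = c * A f n + A h n
    & exists M : R, forall f, tau alpha p f ->
        (tau_norm alpha p (A f) <= M%:E * tau_norm alpha p f)%E].

End FractionalDifferences.

Section Operators.
Variable R : realType.
Implicit Types (f : nat -> R[i]^o) (beta : R[i]) (p : \bar R) (t : R) (n : nat).

Definition cesaro_op beta f n : R[i]^o :=
  (cesaro_num (beta + 1) n)^-1 *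
    \sum_(0 <= j < n.+1) cesaro_num beta (n - j) * f j.

Definition cesaro_adj_term beta f n (j : nat) : R[i]^o :=
  (cesaro_num (beta + 1) j)^-1 * cesaro_num beta (j - n) * f j.

Definition cesaro_adj_cvg beta f n : Prop :=
  sum_from_cvg n (cesaro_adj_term beta f n).

Definition cesaro_adj beta f n : R[i]^o :=
  sum_from n (cesaro_adj_term beta f n).

(* 1/p, with 1/(+oo) = 0. *)
Definition inv_exponent p : R := fine (p^-1)%E.

Definition semigroup_T p t f n : R[i]^o :=
  (expR (- (t * inv_exponent p)))%:C *
    \sum_(0 <= j < n.+1)
      ('C(n, j)%:R * expR (- (t * j%:R)) * (1 - expR (- t)) ^+ (n - j))%:C * f j.

Definition semigroup_S_term t f n (j : nat) : R[i]^o :=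
  ('C(j, n)%:R * (1 - expR (- t)) ^+ (j - n))%:C * f j.

Definition semigroup_S_cvg t f n : Prop :=
  sum_from_cvg n (semigroup_S_term t f n).

Definition semigroup_S p t f n : R[i]^o :=
  (expR (- (t * (1 - inv_exponent p + n%:R))))%:C *
    sum_from n (semigroup_S_term t f n).

(* x^z = exp (z ln x) for x > 0. *)
Definition cpower (x : R) (z : R[i]) : R[i] :=
  (expR (complex.Re z * ln x))%:C *
    (cos (complex.Im z * ln x) +i* sin (complex.Im z * ln x)).

(* Lebesgue integral over (0, +oo) of a complex-valued function. *)
Definition cintegrable (g : R -> R[i]) : Prop :=
  (@lebesgue_measure R).-integrable `]0, +oo[
    (fun t => (complex.Re (g t))%:E) /\
  (@lebesgue_measure R).-integrable `]0, +oo[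
    (fun t => (complex.Im (g t))%:E).

Definition cintegral (g : R -> R[i]) : R[i] :=
  (\int[@lebesgue_measure R]_(t in `]0, +oo[) complex.Re (g t)) +i*
  (\int[@lebesgue_measure R]_(t in `]0, +oo[) complex.Im (g t)).

Definition cesaro_integrand beta p f n t : R[i] :=
  cpower (1 - expR (- t)) (beta - 1) *
    (expR (- (t * (1 - inv_exponent p))))%:C * semigroup_T p t f n.

Definition cesaro_adj_integrand beta p f n t : R[i] :=
  cpower (1 - expR (- t)) (beta - 1) *
    (expR (- (t * inv_exponent p)))%:C * semigroup_S p t f n.

End Operators.

(* Main.v *)
(* For f in c_0, W^alpha (C_beta f) = kappa E (W^alpha f), where E averages with the kernel
   k^(alpha+1)(l) k^beta(n-l) / k^(alpha+beta+1)(n): both sides are continuous for the sup norm,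
   and on the unit sequences they satisfy the same recursions, because these kernels commute with
   u |-> (n + a) u(n) - n u(n-1) for a = 1 (C_beta) and a = alpha + 1 (E), and W^alpha carries the
   former operation to the latter. Conjugating E with the weight k^(alpha+1) gives an operator
   dominated by C_(Re beta), so Hardy's inequality (a Schur test with power weights) proves (i).

   For (ii), every f in tau_p^alpha is C_alpha^* h with h = k^(alpha+1) W^alpha f in l^p. Triangular
   kernels commuting with u |-> (n + 1) (u(n) - u(n+1)) are determined by their diagonal, so
   C_alpha^* and C_beta^* commute; hence k^(alpha+1) W^alpha (C_beta^* f) = C_beta^* h, and the
   boundedness of C_beta^* on l^p is enough.

   Expanding the semigroups reduces the integral identities to the integrals of
   (1 - e^-t)^(beta - 1 + m) e^(-(j+1) t), which are computed for j = 0 by the fundamental theorem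
   of calculus and then by recursion on j; for C_beta^* sum and integral are exchanged by dominated
   convergence. *)
Require Import Defs.
From HB Require Import structures.
From mathcomp Require Import all_boot all_order all_algebra.
From mathcomp Require Import complex.
From mathcomp Require Import all_classical all_reals all_analysis.
From mathcomp Require Import measurable_realfun.
From mathcomp Require Import ring lra zify.
Set Implicit Arguments.
Unset Strict Implicit.
Unset Printing Implicit Defensive.
Import Order.TTheory GRing.Theory Num.Theory.
Import numFieldNormedType.Exports.
Local Open Scope classical_set_scope.
Local Open Scope complex_scope.
Local Open Scope ring_scope.
#[local] Arguments modulus : simpl never.

(** * Cesaro numbers and Beta kernels *)

(** For non-integer alpha, W^alpha is a difference of the inner sum W^(-(m - alpha)) f, which is
    only required to converge in the ordinary sense. This obstacle shapes the proof. All algebra is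
    done on the one-series form [fdiff], with coefficients k^(-alpha), absolutely convergent for
    every bounded sequence; the convergence of the inner sum must then be carried over to C_beta f
    and C_beta^* f by separate arguments about conditionally convergent series. It suffices to do so
    at index 0.

    The size of k^gamma is obtained without Gamma functions. Two-sided bounds of k^(1-s) by powers
    come from Bernoulli's inequality with explicit constants, and comparisons between different
    orders, or between complex and real orders, come from convergent infinite products. Complex
    kernels are dominated by the positive kernels of order Re beta, so only these enter Hardy's
    inequality.

    Membership in l^r is handled as a bound on all finite partial sums, which keeps Hardy's
    inequality and the Schur test finite. *)

Section CesaroNumbers.
Variable F : numFieldType.
Implicit Types (a b c : F) (n i j l N : nat) (u f g : nat -> F).
Local Notation k := (@cesaro_num F).

Lemma cesaro_num0 a : k a 0 = 1.
Proof. by rewrite /cesaro_num big_ord0 fact0 divr1. Qed.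

Lemma cesaro_numS a n : k a n.+1 = k a n * ((a + n%:R) / n.+1%:R).
Proof.
rewrite /cesaro_num big_ord_recr/= factS natrM.
have h1 : (n`!%:R : F) != 0 by rewrite pnatr_eq0 -lt0n fact_gt0.
by field; rewrite h1 nat1r pnatr_eq0.
Qed.

Lemma cesaro_numS_mul a n : n.+1%:R * k a n.+1 = (a + n%:R) * k a n.
Proof. by rewrite cesaro_numS; field; rewrite nat1r pnatr_eq0. Qed.

Lemma cesaro_num1 a : k a 1 = a.
Proof. by rewrite cesaro_numS cesaro_num0 addr0 mul1r divr1. Qed.

Lemma cesaro_num_zero n : k 0 n.+1 = 0.
Proof. by elim: n => [|n IH]; rewrite cesaro_numS ?IH ?mul0r// cesaro_num0 add0r mul1r mul0r. Qed.

Lemma cesaro_num_one n : k 1 n = 1.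
Proof.
elim: n => [|n IH]; rewrite ?cesaro_num0// cesaro_numS IH mul1r nat1r divff//.
Qed.

Lemma cesaro_num_add1 a n : a * k (a + 1) n = (a + n%:R) * k a n.
Proof.
elim: n => [|n IH]; first by rewrite !cesaro_num0 addr0.
rewrite !cesaro_numS mulrA IH; field.
by rewrite nat1r pnatr_eq0.
Qed.

Lemma cesaro_num_add1S a n : a * k (a + 1) n = n.+1%:R * k a n.+1.
Proof. by rewrite cesaro_numS_mul cesaro_num_add1. Qed.

Lemma cesaro_num_diff a n : k (a + 1) n.+1 - k (a + 1) n = k a n.+1.
Proof.
elim: n => [|n IH]; first by rewrite !cesaro_num1 cesaro_num0 addrK.
have h1 : (n.+1%:R : F) != 0 by rewrite pnatr_eq0.
have h2 : (n.+2%:R : F) != 0 by rewrite pnatr_eq0.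
have E : k (a+1) n = k (a+1) n.+1 - k a n.+1 by rewrite -IH subKr.
have := cesaro_numS_mul (a+1) n; rewrite E => H.
apply: (mulfI h2); rewrite mulrBr !cesaro_numS_mul.
move: H; rewrite -!natr1; move: (k (a + 1) _) (k a _) => x y /eqP.
rewrite -subr_eq0 => /eqP H; apply/eqP; rewrite -subr_eq0 -[0]oppr0 -[in X in _ == X]H.
by apply/eqP; ring.
Qed.

Lemma cesaro_num_sum a n : \sum_(j < n.+1) k a j = k (a + 1) n.
Proof.
elim: n => [|n IH]; first by rewrite big_ord1 !cesaro_num0.
by rewrite big_ord_recr/= IH -cesaro_num_diff addrC subrK.
Qed.

(** After multiplication by n + 1 = i + (n + 1 - i), each half lowers the index of one factor
    through [cesaro_numS_mul], and the coefficients recombine to a + b + n. *)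
Lemma cesaro_num_vandermonde a b n :
  \sum_(j < n.+1) k a j * k b (n - j) = k (a + b) n.
Proof.
elim: n => [|n IH]; first by rewrite big_ord1 !cesaro_num0 mulr1.
have h1 : (n.+1%:R : F) != 0 by rewrite pnatr_eq0.
apply: (mulfI h1); rewrite cesaro_numS_mul -IH mulr_sumr.
have -> : \sum_(i < n.+2) n.+1%:R * (k a i * k b (n.+1 - i)) =
  \sum_(i < n.+2) (i%:R * k a i * k b (n.+1 - i)) +
  \sum_(i < n.+2) (k a i * ((n.+1 - i)%:R * k b (n.+1 - i))).
  rewrite -big_split/=; apply: eq_bigr => i _.
  have hi : (i <= n.+1)%N by rewrite -ltnS.
  by rewrite (natrB _ hi); ring.
rewrite big_ord_recl/= !mul0r add0r.
under eq_bigr => i _ do rewrite subSS /bump/= add1n cesaro_numS_mul.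
rewrite [X in _ + X]big_ord_recr/= subnn mul0r mulr0 addr0 -big_split/= mulr_sumr.
apply: eq_bigr => i _; have hi : (i <= n)%N by rewrite -ltnS.
by rewrite subSn// cesaro_numS_mul (natrB _ hi); ring.
Qed.

Lemma cesaro_num_neq0 a n : (forall i, a + i%:R != 0) -> k a n != 0.
Proof.
move=> ha; elim: n => [|n IH]; first by rewrite cesaro_num0 oner_neq0.
by rewrite cesaro_numS mulf_neq0// mulf_neq0// invr_eq0 pnatr_eq0.
Qed.

End CesaroNumbers.

Section BetaKernel.
Variable F : numFieldType.
Implicit Types (a b c : F) (n i j l N : nat) (u f g : nat -> F).
Local Notation k := (@cesaro_num F).

(* For a, b > 0 row n is the Beta-binomial distribution on {0, ..., n}; a = 1 is the
   kernel of the Cesaro operator of order b. *)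
Definition beta_kernel a b n l : F :=
  if (l <= n)%N then k a l * k b (n - l) / k (a + b) n else 0.

Definition beta_mean a b f n : F := \sum_(l < n.+1) beta_kernel a b n l * f l.

(** For a > 0 this is a times the inverse of the mean [beta_mean a 1]. At n = 0 the value [u 0] read
    through [n.-1] is multiplied by 0. *)
Definition delta a u n : F := (n%:R + a) * u n - n%:R * u n.-1.

Lemma beta_kernel_gt a b n l : (n < l)%N -> beta_kernel a b n l = 0.
Proof. by move=> nl; rewrite /beta_kernel leqNgt nl. Qed.

(** The left side is the transpose of [delta a] in the column index, so this is the commutation of
    [beta_mean a b] with [delta a], entry by entry. *)
Lemma beta_kernel_delta a b n l : (forall i, a + b + i%:R != 0) ->
  (l%:R + a) * beta_kernel a b n l - l.+1%:R * beta_kernel a b n l.+1 =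
  delta a (fun n => beta_kernel a b n l) n.
Proof.
move=> hab; rewrite /delta; case: (ltngtP l n) => [ln|nl|->]; last first.
- rewrite [beta_kernel _ _ _ n.+1]beta_kernel_gt// mulr0.
  case: n => [|n]; first by rewrite !mul0r.
  by rewrite [beta_kernel _ _ _.-1 _]beta_kernel_gt// mulr0.
- rewrite !beta_kernel_gt ?mulr0 ?subrr//; first lia.
  by rewrite ltnS ltnW.
- case: n ln => // n; rewrite ltnS => ln; rewrite /beta_kernel/= ln ltnS ln (leqW ln).
  rewrite subSS subSn//; have := subnKC ln; move: (n - l)%N => q <-.
  have k0 := cesaro_num_neq0 (l + q) hab.
  have n0 : ((l + q).+1%:R : F) != 0 by rewrite pnatr_eq0.
  have l0 : (l.+1%:R : F) != 0 by rewrite pnatr_eq0.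
  have q0 : (q.+1%:R : F) != 0 by rewrite pnatr_eq0.
  rewrite !cesaro_numS; have := hab (l + q)%N; move: n0 l0 q0; rewrite -!natr1 !natrD.
  by move=> *; field; do ?(apply/andP; split).
Qed.

Lemma eq_beta_mean a b f g n : (forall l, (l <= n)%N -> f l = g l) ->
  beta_mean a b f n = beta_mean a b g n.
Proof. by move=> h; apply: eq_bigr => l _; rewrite h// -ltnS. Qed.

Lemma beta_mean_lin a b c f g n :
  beta_mean a b (fun j => c * f j + g j) n = c * beta_mean a b f n + beta_mean a b g n.
Proof.
rewrite /beta_mean mulr_sumr -big_split/=; apply: eq_bigr => i _.
by rewrite mulrDr mulrCA.
Qed.

Lemma beta_mean_delta a b f n : (forall i, a + b + i%:R != 0) ->
  beta_mean a b (delta a f) n = delta a (beta_mean a b f) n.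
Proof.
move=> hab.
have -> : beta_mean a b (delta a f) n = \sum_(l < n.+1)
    ((l%:R + a) * beta_kernel a b n l - l.+1%:R * beta_kernel a b n l.+1) * f l.
  transitivity (\sum_(l < n.+1) (l%:R + a) * beta_kernel a b n l * f l -
    \sum_(l < n.+1) l%:R * beta_kernel a b n l * f l.-1).
    by rewrite -sumrB; apply: eq_bigr => l _; rewrite /delta; ring.
  have -> : \sum_(l < n.+1) l%:R * beta_kernel a b n l * f l.-1 =
    \sum_(l < n.+1) l.+1%:R * beta_kernel a b n l.+1 * f l.
    rewrite big_ord_recl/= !mul0r add0r big_ord_recr/= beta_kernel_gt// mulr0 mul0r addr0.
    by apply: eq_bigr.
  by rewrite -sumrB; apply: eq_bigr => l _; ring.
under eq_bigr => l _ do rewrite beta_kernel_delta//.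
rewrite /delta /beta_mean; case: n => [|n].
  by rewrite !mul0r !subr0 !big_ord1 mul0r subr0 mulrA.
have -> : \sum_(l < n.+1) beta_kernel a b n l * f l =
          \sum_(l < n.+2) beta_kernel a b n l * f l.
  by rewrite [RHS]big_ord_recr/= beta_kernel_gt// mul0r addr0.
by rewrite !mulr_sumr -sumrB; apply: eq_bigr => l _ /=; ring.
Qed.

Lemma beta_kernel_col a b n : (forall i, a + b + i%:R != 0) ->
  beta_mean a b (fun i => (i == 0%N)%:R) n = beta_kernel a b n 0.
Proof.
move=> hab; rewrite /beta_mean big_ord_recl/= mulr1 big1 ?addr0// => i _.
by rewrite mulr0.
Qed.

(** At n = l + d + 1 the relation reads (d + 1) X l n = n X l (n - 1) - (l + 1) X (l + 1) n: entries
    at distance d + 1 from the diagonal come from those at distance d. *)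
Lemma delta_kernel_uniq (X Y : nat -> nat -> F) :
  (forall n, X n n = Y n n) ->
  (forall l n, l.+1%:R * (X l n - X l.+1 n) = delta 1 (X l) n) ->
  (forall l n, l.+1%:R * (Y l n - Y l.+1 n) = delta 1 (Y l) n) ->
  forall l n, (l <= n)%N -> X l n = Y l n.
Proof.
move=> hd hX hY; suff H d l : X l (l + d)%N = Y l (l + d)%N.
  by move=> l n /subnKC <-.
elim: d l => [|d IH] l; first by rewrite addn0.
have d0 : (d.+1%:R : F) != 0 by rewrite pnatr_eq0.
have R (Z : nat -> nat -> F) : (forall l n, l.+1%:R * (Z l n - Z l.+1 n) = delta 1 (Z l) n) ->
    d.+1%:R * Z l (l + d.+1)%N = (l + d.+1)%:R * Z l (l + d)%N - l.+1%:R * Z l.+1 (l.+1 + d)%N.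
  move=> /(_ l (l + d.+1)%N); rewrite /delta addnS/= -addSn => /eqP.
  rewrite -subr_eq0 => /eqP h; apply/eqP; rewrite -subr_eq0 -[0]oppr0 -[in X in _ == X]h.
  by apply/eqP; rewrite -!natr1 natrD; ring.
by apply: (mulfI d0); rewrite !R// !IH.
Qed.

(** Meant for fractional differences of kernel columns, which are not triangular: the diagonal is
    replaced by column 0, and the relation produces column i + 1 from column i. *)
Lemma delta_col_uniq (a : F) (X Y : nat -> nat -> F) :
  X 0 =1 Y 0 ->
  (forall i n, i.+1%:R * (X i n - X i.+1 n) = delta a (X i) n) ->
  (forall i n, i.+1%:R * (Y i n - Y i.+1 n) = delta a (Y i) n) ->
  forall i, X i =1 Y i.
Proof.
move=> h0 hX hY; elim=> [//|i IH] n.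
have i0 : (i.+1%:R : F) != 0 by rewrite pnatr_eq0.
apply: oppr_inj; apply: (addrI (X i n)); apply: (mulfI i0); rewrite hX IH hY /delta !IH//.
Qed.

Lemma beta_kernel1E' b n l : (l <= n)%N -> beta_kernel 1 b n l = k b (n - l) / k (1 + b) n.
Proof. by move=> ln; rewrite /beta_kernel ln cesaro_num_one mul1r. Qed.

Lemma beta_kernel1_delta b n l : (forall i, 1 + b + i%:R != 0) ->
  l.+1%:R * (beta_kernel 1 b n l - beta_kernel 1 b n l.+1) =
  delta 1 (fun n => beta_kernel 1 b n l) n.
Proof. by move=> hb; rewrite -beta_kernel_delta// -natr1; ring. Qed.

(** These are the entries of the product of the two kernels in either order. On the diagonal only
    the product of the diagonal entries survives, so [delta_kernel_uniq] applies. *)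
Lemma beta_mean_kernelC b c l n : (forall i, 1 + b + i%:R != 0) ->
  (forall i, 1 + c + i%:R != 0) ->
  beta_mean 1 b (beta_kernel 1 c ^~ l) n = beta_mean 1 c (beta_kernel 1 b ^~ l) n.
Proof.
move=> hb hc; case: (leqP l n) => [ln|nl]; last first.
  by rewrite /beta_mean !big1// => i _; rewrite [beta_kernel _ _ i l]beta_kernel_gt ?mulr0// (leq_ltn_trans _ nl)// -ltnS.
have rec b' c' : (forall i, 1 + b' + i%:R != 0) -> (forall i, 1 + c' + i%:R != 0) ->
   forall l n, l.+1%:R * (beta_mean 1 b' (beta_kernel 1 c' ^~ l) n -
     beta_mean 1 b' (beta_kernel 1 c' ^~ l.+1) n) = delta 1 (beta_mean 1 b' (beta_kernel 1 c' ^~ l)) n.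
  move=> hb' hc' l' n'; rewrite -beta_mean_delta//.
  rewrite -sumrB mulr_sumr; apply: eq_bigr => j _.
  by rewrite -mulrBr mulrCA beta_kernel1_delta.
apply: (@delta_kernel_uniq (fun l n => beta_mean 1 b (beta_kernel 1 c ^~ l) n) (fun l n => beta_mean 1 c (beta_kernel 1 b ^~ l) n)) ln; [|exact: rec|exact: rec] => {l}m.
rewrite /beta_mean !big_ord_recr/= !big1 ?add0r; last 2 first.
- by move=> i _; rewrite [beta_kernel _ _ i m]beta_kernel_gt ?mulr0.
- by move=> i _; rewrite [beta_kernel _ _ i m]beta_kernel_gt ?mulr0.
by rewrite mulrC.
Qed.

End BetaKernel.

Lemma big_ord_trunc (V : zmodType) (f : nat -> V) n m : (n <= m)%N ->
  (forall j, (n <= j)%N -> f j = 0) -> \sum_(j < m) f j = \sum_(j < n) f j.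
Proof.
move=> nm f0; rewrite -(subnKC nm) big_split_ord/= [X in _ + X]big1 ?addr0// => j _.
by rewrite f0// leq_addr.
Qed.

(** * Complex limits and series *)

Section ComplexLimits.
Variable R : realType.
Implicit Types (u v : nat -> R[i]^o) (x y z l : R[i]^o).

Lemma modulusE z : `|z| = (modulus z)%:C.
Proof. by []. Qed.

Lemma modulus_ge0 z : 0 <= modulus z.
Proof. by case: z => a b; rewrite /modulus/= sqrtr_ge0. Qed.

Lemma modulusM x y : modulus (x * y) = modulus x * modulus y.
Proof. exact: ComplexField.Normc.normcM. Qed.

Lemma modulusD x y : modulus (x + y) <= modulus x + modulus y.
Proof. exact: le_normcD. Qed.

Lemma modulusN x : modulus (- x) = modulus x.
Proof. exact: normcN. Qed.

Lemma modulusV x : modulus (x^-1) = (modulus x)^-1.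
Proof. exact: ComplexField.Normc.normcV. Qed.

Lemma modulus0 : modulus (0 : R[i]) = 0.
Proof. exact: ComplexField.Normc.normc0. Qed.

Lemma modulus1 : modulus (1 : R[i]) = 1.
Proof. exact: ComplexField.Normc.normc1. Qed.

Lemma modulusR (a : R) : modulus a%:C = `|a|.
Proof. by rewrite /modulus/= expr0n/= addr0 sqrtr_sqr. Qed.

Lemma modulus_eq0 z : modulus z = 0 -> z = 0.
Proof. exact: ComplexField.Normc.eq0_normc. Qed.

Lemma modulusB x y : modulus (x - y) = modulus (y - x).
Proof. by rewrite -modulusN opprB. Qed.

Lemma modulus_sum I (r : seq I) (P : pred I) (f : I -> R[i]) :
  modulus (\sum_(i <- r | P i) f i) <= \sum_(i <- r | P i) modulus (f i).
Proof.
elim/big_rec2: _ => [|i a b _ h]; first by rewrite modulus0.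
by rewrite (le_trans (modulusD _ _))// lerD2l.
Qed.

Lemma Re_le_modulus z : `|complex.Re z| <= modulus z.
Proof.
case: z => a b; rewrite /modulus/= -sqrtr_sqr ler_wsqrtr// lerDl sqr_ge0//.
Qed.

Lemma Im_le_modulus z : `|complex.Im z| <= modulus z.
Proof.
case: z => a b; rewrite /modulus/= -sqrtr_sqr ler_wsqrtr// lerDr sqr_ge0//.
Qed.

Lemma modulus_le_ReIm z : modulus z <= `|complex.Re z| + `|complex.Im z|.
Proof.
case: z => a b; rewrite /modulus/= -[leRHS]ger0_norm ?addr_ge0// -sqrtr_sqr.
rewrite ler_wsqrtr// sqrrD -!normrX !(ger0_norm (sqr_ge0 _)).
by rewrite addrAC lerDl mulrn_wge0// mulr_ge0.
Qed.

(** The bridge to real sequences, where squeezing and monotone convergence are available. *)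
Lemma ccvgP u l : u @ \oo --> l <-> (fun n => modulus (u n - l)) @ \oo --> (0 : R).
Proof.
split.
  move/cvgrPdist_lt => h; apply/cvgrPdist_lt => e e0.
  have e0' : (0 : R[i]) < e%:C by rewrite ltcE/= eqxx e0.
  have := h _ e0'; apply: filterS => n.
  rewrite sub0r normrN (ger0_norm (modulus_ge0 _)).
  by rewrite modulusE ltcE/= eqxx/= modulusB.
move/cvgrPdist_lt => h; apply/cvgrPdist_lt => e.
case: e => e1 e2; rewrite ltcE/= => /andP[/eqP -> e0].
have := h _ e0; apply: filterS => n.
rewrite sub0r normrN (ger0_norm (modulus_ge0 _)).
by rewrite modulusE ltcE/= eqxx/= modulusB.
Qed.

Lemma ccvg_le u l (v : nat -> R) : (forall n, modulus (u n - l) <= v n) ->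
  v @ \oo --> (0 : R) -> u @ \oo --> l.
Proof.
move=> h hv; apply/ccvgP; apply: (squeeze_cvgr _ (cvg_cst 0) hv).
by near=> n; rewrite modulus_ge0 h.
Unshelve. all: by end_near. Qed.

Lemma ccvg_modulus u l : u @ \oo --> l -> (modulus (u n)) @[n --> \oo] --> modulus l.
Proof.
move=> /ccvgP h; apply/cvgrPdist_le => e e0.
move/cvgrPdist_le : h => /(_ _ e0); apply: filterS => n.
rewrite sub0r normrN (ger0_norm (modulus_ge0 _)) => h; apply: le_trans h.
rewrite ler_norml; apply/andP; split.
  by rewrite lerNl opprB lerBlDr -[in leLHS](subrK l (u n)) modulusD.
by rewrite lerBlDr -[in leLHS](subrK (u n) l) modulusB modulusD.
Qed.

Lemma ccvgP_ReIm u l : u @ \oo --> l <->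
  (complex.Re (u n)) @[n --> \oo] --> complex.Re l /\
  (complex.Im (u n)) @[n --> \oo] --> complex.Im l.
Proof.
split=> [/ccvgP h|[h1 h2]].
  split; apply/cvgrPdist_le => e e0; move/cvgrPdist_le : h => /(_ _ e0);
  apply: filterS => n; rewrite sub0r normrN (ger0_norm (modulus_ge0 _)) => h;
  apply: le_trans h; rewrite distrC; [rewrite -raddfB|rewrite -raddfB].
    exact: Re_le_modulus.
  exact: Im_le_modulus.
apply: (@ccvg_le _ _ (fun n => `|complex.Re (u n) - complex.Re l| + `|complex.Im (u n) - complex.Im l|)).
  by move=> n; rewrite -!raddfB modulus_le_ReIm.
rewrite -[0]addr0; apply: cvgD.
  by rewrite -(normr0 R); apply: cvg_norm; apply/subr_cvg0.
by rewrite -(normr0 R); apply: cvg_norm; apply/subr_cvg0.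
Qed.

Lemma ccvgD u v l l' : u @ \oo --> l -> v @ \oo --> l' ->
  (u n + v n) @[n --> \oo] --> (l + l' : R[i]^o).
Proof.
move=> /ccvgP h /ccvgP h'.
apply: (@ccvg_le _ _ (fun n => modulus (u n - l) + modulus (v n - l'))).
  by move=> n; rewrite opprD addrACA; exact: modulusD.
by rewrite -[X in _ --> X]addr0; apply: cvgD.
Qed.

Lemma ccvgB u v l l' : u @ \oo --> l -> v @ \oo --> l' ->
  (u n - v n) @[n --> \oo] --> (l - l' : R[i]^o).
Proof.
move=> h /ccvgP h'; apply: ccvgD h _; apply/ccvgP; apply: cvg_trans h'.
apply: near_eq_cvg; apply: nearW => n /=.
by rewrite -opprD modulusN.
Qed.

Lemma ccvgMl (c : R[i]^o) u l : u @ \oo --> l ->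
  (c * u n) @[n --> \oo] --> (c * l : R[i]^o).
Proof.
move=> /ccvgP h.
apply: (@ccvg_le _ _ (fun n => modulus c * modulus (u n - l))).
  by move=> n; rewrite -mulrBr modulusM.
by rewrite -(mulr0 (modulus c)); apply: cvgM => //; exact: cvg_cst.
Qed.

Lemma ccvg_cst l : (fun=> l) @ \oo --> l.
Proof. exact: cvg_cst. Qed.

Lemma ccvg_shiftS u l : u @ \oo --> l -> (u n.+1) @[n --> \oo] --> l.
Proof. by move=> h; rewrite (cvg_shiftS u). Qed.

Definition csum u : R[i]^o := limn (fun N => \sum_(j < N) u j).
Definition csum_cvg u : Prop := cvgn (fun N => \sum_(j < N) u j).
(** Absolute summability in quantitative form: the constant M survives in the bound on the sum
    ([csum_le]). *)
Definition abs_bound (M : R) u : Prop := forall N, \sum_(j < N) modulus (u j) <= M.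

Lemma abs_bound_cvg M u : abs_bound M u -> csum_cvg u.
Proof.
move=> h.
have aux (f : R[i] -> R) : (forall z, `|f z| <= modulus z) -> cvgn (fun N => \sum_(j < N) f (u j)).
  move=> hf.
  have : cvgn [normed series (fun j => f (u j))].
    rewrite /normed_series_of seriesEord; apply: nondecreasing_is_cvgn.
      apply/nondecreasing_seqP => n; rewrite /= big_ord_recr/= lerDl//.
    exists M => _ [n _ <-]; rewrite /= (le_trans _ (h n))// ler_sum//.
  by move/normed_cvg; rewrite seriesEord.
have [h1 h2] := (aux _ Re_le_modulus, aux _ Im_le_modulus).
apply/cvg_ex; exists (limn (fun N => \sum_(j < N) complex.Re (u j)) +i*
  limn (fun N => \sum_(j < N) complex.Im (u j))).
apply/ccvgP_ReIm => /=; split.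
  by under eq_fun do rewrite raddf_sum.
by under eq_fun do rewrite raddf_sum.
Qed.

Lemma csum_le M u : abs_bound M u -> modulus (csum u) <= M.
Proof.
move=> h; have /ccvg_modulus c := abs_bound_cvg h.
rewrite /csum -(cvg_lim (@Rhausdorff R) c); apply: limr_le; first exact: cvgP c.
by near=> n; rewrite (le_trans (modulus_sum _ _ _))// h.
Unshelve. all: by end_near. Qed.

Lemma ccvg_unique u l l' : u @ \oo --> l -> u @ \oo --> l' -> l = l'.
Proof. by move=> h h'; apply: (cvg_unique _ h h'); exact: norm_hausdorff. Qed.

Lemma csumP u l : (\sum_(j < N) u j) @[N --> \oo] --> l -> csum u = l.
Proof. by move=> h; apply: cvg_lim => //; exact: norm_hausdorff. Qed.

Lemma csum_is_cvg u : csum_cvg u -> (\sum_(j < N) u j) @[N --> \oo] --> csum u.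
Proof. by []. Qed.

Lemma csum_lin (c : R[i]^o) u v : csum_cvg u -> csum_cvg v ->
  (\sum_(j < N) (c * u j + v j)) @[N --> \oo] --> (c * csum u + csum v : R[i]^o).
Proof.
move=> hu hv.
have -> : (fun N => \sum_(j < N) (c * u j + v j)) =
  (fun N => c * (\sum_(j < N) u j) + \sum_(j < N) v j) :> (nat -> R[i]^o).
  by apply/funext => N; rewrite big_split/= -mulr_sumr.
exact: (@ccvgD (fun N => c * (\sum_(j < N) u j)) (fun N => \sum_(j < N) v j) _ _ (@ccvgMl c _ _ hu) hv).
Qed.

Lemma eq_csum u v : u =1 v -> csum u = csum v.
Proof. by move=> h; congr (csum _); apply/funext. Qed.

Lemma csum_cvg_to0 u : csum_cvg u -> u @ \oo --> (0 : R[i]^o).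
Proof.
move=> hu; have -> : u = (fun N => \sum_(j < N.+1) u j - \sum_(j < N) u j).
  by apply/funext => N; rewrite big_ord_recr/= addrAC subrr add0r.
have := @ccvgB (fun N => \sum_(j < N.+1) u j) (fun N => \sum_(j < N) u j) _ _ (@ccvg_shiftS (fun N => \sum_(j < N) u j) _ hu) hu.
by rewrite subrr.
Qed.

(* With A_j = sum_i |x j i|, the two partial sums differ by at most the amount by which
   sum_(j < N) A_j exceeds the N x N square sum of |x|. *)
Lemma csum_exchange (x : nat -> nat -> R[i]^o) M :
  (forall j i, (i < j)%N -> x j i = 0) ->
  (forall N N', \sum_(j < N) \sum_(i < N') modulus (x j i) <= M) ->
  [/\ forall j, csum_cvg (x j), abs_bound M (fun j => csum (x j)),
   abs_bound M (fun i => \sum_(j < i.+1) x j i) &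
   csum (fun j => csum (x j)) = csum (fun i => \sum_(j < i.+1) x j i)].
Proof.
move=> tri hM.
pose S j N := \sum_(i < N) modulus (x j i).
have Snd j : nondecreasing_seq (S j).
  apply/nondecreasing_seqP => n; rewrite /S big_ord_recr/= lerDl modulus_ge0//.
have S0 j N : 0 <= S j N by rewrite sumr_ge0// => i _; exact: modulus_ge0.
have Sb j : abs_bound M (x j).
  move=> N; apply: le_trans (hM j.+1 N); rewrite [leRHS]big_ord_recr/= lerDr.
  by rewrite sumr_ge0// => i _; exact: S0.
have xc j : csum_cvg (x j) := abs_bound_cvg (Sb j).
have Sc j : cvgn (S j).
  by apply: nondecreasing_is_cvgn => //; exists M => _ [n _ <-]; exact: Sb.
have tail j N : modulus (csum (x j) - \sum_(i < N) x j i) <= limn (S j) - S j N.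
  have c : (modulus (\sum_(i < N') x j i - \sum_(i < N) x j i)) @[N' --> \oo] -->
      modulus (csum (x j) - \sum_(i < N) x j i).
    exact: (ccvg_modulus (@ccvgB (fun N' => \sum_(i < N') x j i) (fun=> \sum_(i < N) x j i) _ _ (xc j) (@ccvg_cst _))).
  rewrite -(cvg_lim (@Rhausdorff R) c); apply: limr_le; first exact: cvgP c.
  near=> N'.
  have NN' : (N <= N')%N by near: N'; exists N.
  rewrite -(subnKC NN') big_split_ord/= [X in modulus X](_ : _ = \sum_(i < N' - N) x j (N + i)%N); last by rewrite addrAC subrr add0r.
  rewrite (le_trans (modulus_sum _ _ _))//.
  apply: (@le_trans _ _ (S j N' - S j N)).
    have -> : S j N' = S j N + \sum_(i < N' - N) modulus (x j (N + i)%N).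
      by rewrite /S -[in LHS](subnKC NN') big_split_ord.
    by rewrite addrAC subrr add0r.
  by rewrite lerD2r; exact: nondecreasing_cvgn_le.
have A_le j : modulus (csum (x j)) <= limn (S j).
  by have := tail j 0%N; rewrite big_ord0 subr0 /S big_ord0 subr0.
pose V N := \sum_(j < N) S j N.
have Vnd : nondecreasing_seq V.
  apply/nondecreasing_seqP => n; rewrite /V [leRHS]big_ord_recr/=.
  by rewrite ler_wpDr// ler_sum// => j _; exact: Snd.
have Vc : cvgn V.
  by apply: nondecreasing_is_cvgn => //; exists M => _ [n _ <-]; exact: hM.
have AV N : \sum_(j < N) limn (S j) <= limn V.
  have c : (\sum_(j < N) S j N') @[N' --> \oo] --> \sum_(j < N) limn (S j).
    by apply: cvg_big => [|j _]; [exact: add_continuous|exact: Sc].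
  rewrite -(cvg_lim (@Rhausdorff R) c); apply: limr_le; first exact: cvgP c.
  near=> N'.
  have NN' : (N <= N')%N by near: N'; exists N.
  apply: (@le_trans _ _ (V N')); last exact: nondecreasing_cvgn_le.
  rewrite /V -(subnKC NN') big_split_ord/= subnKC// lerDl sumr_ge0// => i _; exact: S0.
have VM : limn V <= M.
  by apply: limr_le => //; near=> n; exact: hM.
have B1 : abs_bound M (fun j => csum (x j)).
  move=> N; apply: (le_trans _ VM); apply: le_trans (AV N).
  by apply: ler_sum => j _; exact: A_le.
(* By [tri], the first N column sums fill exactly the N x N square. *)
have sq N : \sum_(i < N) \sum_(j < i.+1) x j i = \sum_(j < N) \sum_(i < N) x j i.
  rewrite [RHS]exchange_big/=; apply: eq_bigr => i _.
  by rewrite (@big_ord_trunc _ (x ^~ i) i.+1 N)// => j; exact: tri.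
have B2 : abs_bound M (fun i => \sum_(j < i.+1) x j i).
  move=> N; apply: le_trans (hM N N).
  rewrite [leRHS]exchange_big/=; apply: ler_sum => i _.
  rewrite (le_trans (modulus_sum _ _ _))//.
  rewrite (@big_ord_trunc _ (fun j => modulus (x j i)) i.+1 N)// => j ij.
  by rewrite tri// modulus0.
split=> //.
apply/esym/csumP.
have -> : (fun N => \sum_(i < N) \sum_(j < i.+1) x j i) =
  (fun N => \sum_(j < N) csum (x j) - \sum_(j < N) (csum (x j) - \sum_(i < N) x j i)).
  apply/funext => N; rewrite sq sumrB opprB addrC subrK//.
rewrite -[csum _]subr0; apply: ccvgB; first exact: (abs_bound_cvg B1).
apply: (@ccvg_le _ _ (fun N => limn V - V N)).
  move=> N; rewrite subr0 (le_trans (modulus_sum _ _ _))//.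
  apply: le_trans (_ : \sum_(j < N) (limn (S j) - S j N) <= _).
    by apply: ler_sum => j _; exact: tail.
  by rewrite sumrB lerD2r AV.
by rewrite -(subrr (limn V)); apply: cvgB => //; exact: cvg_cst.
Unshelve. all: by end_near. Qed.

End ComplexLimits.

(** * Hardy inequalities *)

Section RealBounds.
Variable R : realType.
Implicit Types (a b s x y C : R) (n i j l N : nat).
Local Notation k := (@cesaro_num R).

Lemma cesaro_num_ge0 a n : 0 <= a -> 0 <= k a n.
Proof.
move=> a0; elim: n => [|n IH]; rewrite ?cesaro_num0// cesaro_numS.
by rewrite mulr_ge0// divr_ge0// addr_ge0.
Qed.

Lemma cesaro_num_gt0 a n : 0 < a -> 0 < k a n.
Proof.
move=> a0; elim: n => [|n IH]; rewrite ?cesaro_num0// cesaro_numS.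
by rewrite mulr_gt0// divr_gt0// ltr_wpDr.
Qed.

(** The tangent line at y of the concave function x^s, multiplied by y to avoid y^(s - 1). It is
    Young's inequality for (x / y)^s and 1 with exponents 1 / s and 1 / (1 - s). *)
Lemma powR_bernoulli s x y : 0 <= s <= 1 -> 0 <= x -> 0 < y ->
  x `^ s * y <= y `^ s * (y + s * (x - y)).
Proof.
move=> /andP[s0 s1] x0 y0.
have [->|sn0] := eqVneq s 0.
  by rewrite !powRr0 !mul1r mul0r addr0.
have [->|sn1] := eqVneq s 1.
  by rewrite !powRr1 ?(ltW y0)// mul1r (addrC y) subrK mulrC.
have s0' : 0 < s by rewrite lt_def sn0.
have s1' : 0 < 1 - s by rewrite subr_gt0 lt_def eq_sym sn1.
have h : s^-1^-1 + (1 - s)^-1^-1 = 1 by rewrite !invrK addrC subrK.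
have := @conjugate_powR _ ((x / y) `^ s) 1 s^-1 (1 - s)^-1 (powR_ge0 _ _) ler01.
rewrite !invr_gt0 => /(_ s0' s1' h).
rewrite mulr1 powR1 !invrK -powRrM divff// powRr1 ?divr_ge0 ?(ltW y0)// => H.
have -> : x `^ s = (x / y) `^ s * y `^ s by rewrite -powRM ?divr_ge0 ?(ltW y0)// divfK ?gt_eqF.
have -> : y + s * (x - y) = (x / y * s + 1 * (1 - s)) * y by field; rewrite gt_eqF.
by rewrite [leRHS]mulrA ler_pM2r// [leRHS]mulrC ler_pM2r ?powR_gt0.
Qed.

(** Convexity of x^r, from Young's inequality for x and y^(r - 1) with the exponents r and r / (r -
    1). *)
Lemma powR_tangent r x y : 1 <= r -> 0 <= x -> 0 <= y ->
  y `^ r + r * y `^ (r - 1) * (x - y) <= x `^ r.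
Proof.
move=> r1 x0 y0; have r0 : 0 < r by lra.
have [->|rn1] := eqVneq r 1.
  by rewrite subrr powRr0 !powRr1// !mul1r (addrC y) subrK.
have r1' : 0 < r - 1 by rewrite subr_gt0 lt_def rn1.
have h : r^-1 + (r / (r - 1))^-1 = 1 by field; rewrite ?gt_eqF//.
have := @conjugate_powR _ x (y `^ (r - 1)) r (r / (r - 1)) x0 (powR_ge0 _ _) r0 (divr_gt0 r0 r1') h.
have -> : (y `^ (r - 1)) `^ (r / (r - 1)) = y `^ r.
  by rewrite -powRrM mulrCA divff ?mulr1// gt_eqF.
have yr : y `^ (r - 1) * y = y `^ r.
  have [->|yn0] := eqVneq y 0; first by rewrite mulr0 powR0// gt_eqF.
  rewrite -[X in _ * X](@powRr1 _ y)// -powRD ?subrK//; apply/implyP => /eqP h1.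
  by move: r0; rewrite h1 ltxx.
have -> : r * y `^ (r - 1) * (x - y) = r * (x * y `^ (r - 1)) - r * y `^ r.
  by rewrite -yr; ring.
move=> H.
have : r * (x * y `^ (r - 1)) <= r * (x `^ r / r + y `^ r / (r / (r - 1))).
  by rewrite ler_pM2l.
have -> : r * (x `^ r / r + y `^ r / (r / (r - 1))) = x `^ r + (r - 1) * y `^ r.
  by field; rewrite ?gt_eqF.
by lra.
Qed.

(** With y = B + n + 1 the induction step is (y - s)(y + 1)^s <= y^(s + 1): Bernoulli gives (y +
    1)^s y <= y^s (y + s), and (y - s)(y + s) <= y^2. *)
Lemma cesaro_num_powR_le B s n : 0 <= B -> 0 <= s <= 1 ->
  k (B + 1 - s) n * (B + n.+1%:R) `^ s <= (B + 1) `^ s * k (B + 1) n.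
Proof.
move=> B0 s01; have /andP[s0 s1] := s01.
elim: n => [|n IH]; first by rewrite !cesaro_num0 mul1r mulr1.
rewrite !cesaro_numS; set y := B + n.+1%:R.
have n0 : (0 : R) < n.+1%:R by rewrite ltr0n.
have y0 : 0 < y by rewrite /y ltr_wpDl.
have y1 : 1 <= y by rewrite /y -natr1; have : (0 : R) <= n%:R by []; lra.
have -> : B + 1 - s + n%:R = y - s by rewrite /y -natr1; ring.
have -> : B + 1 + n%:R = y by rewrite /y -natr1; ring.
have -> : B + n.+2%:R = y + 1 by rewrite /y -(natr1 n.+1) addrA.
have H : (y - s) * (y + 1) `^ s <= y * y `^ s.
  have := @powR_bernoulli s (y + 1) y s01 (addr_ge0 (ltW y0) ler01) y0.
  rewrite [y + 1 - y]addrC addKr mulr1 => h.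
  rewrite -(ler_pM2r y0) -mulrA; apply: (@le_trans _ _ ((y - s) * (y `^ s * (y + s)))).
    by rewrite ler_wpM2l// subr_ge0 (le_trans s1).
  have := powR_ge0 y s; set p := y `^ s => p0.
  rewrite -subr_ge0 (_ : _ - _ = p * (s * s)); first by rewrite !mulr_ge0.
  by ring.
have c0 : 0 <= k (B + 1 - s) n by apply: cesaro_num_ge0; lra.
have -> : k (B + 1 - s) n * ((y - s) / n.+1%:R) * (y + 1) `^ s =
   (k (B + 1 - s) n / n.+1%:R) * ((y - s) * (y + 1) `^ s) by ring.
have -> : (B + 1) `^ s * (k (B + 1) n * (y / n.+1%:R)) = ((B + 1) `^ s * k (B + 1) n) * (y / n.+1%:R) by ring.
apply: (@le_trans _ _ (k (B + 1 - s) n / n.+1%:R * (y * y `^ s))).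
  by rewrite ler_wpM2l// divr_ge0.
rewrite [leLHS](_ : _ = (k (B + 1 - s) n * y `^ s) * (y / n.+1%:R)); last by ring.
by rewrite ler_wpM2r// divr_ge0// ltW.
Qed.

Lemma cesaro_num_powR_ge s n : 0 <= s <= 1 -> 1 - s <= k (1 - s) n * n.+1%:R `^ s.
Proof.
move=> s01; have /andP[s0 s1] := s01.
(* With the power taken at m + 1 instead of m + 2, the product is nondecreasing in m and starts
   exactly at 1 - s. *)
have P m : 1 - s <= k (1 - s) m.+1 * m.+1%:R `^ s.
  elim: m => [|m IH]; first by rewrite cesaro_num1 powR1 mulr1.
  apply: (le_trans IH); rewrite (cesaro_numS _ m.+1) -[leRHS]mulrA.
  apply: ler_wpM2l; first by apply: cesaro_num_ge0; lra.
  have m2 : (0 : R) < m.+2%:R by rewrite ltr0n.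
  have := @powR_bernoulli s m.+1%:R m.+2%:R s01 (ler0n _ _) m2.
  have -> : m.+2%:R = m.+1%:R + 1 :> R by rewrite natr1.
  move: m2; rewrite -(natr1 m.+1); move: (m.+1%:R) => y m2 h.
  rewrite mulrAC ler_pdivlMr//; apply: (le_trans h).
  by rewrite le_eqVlt; apply/orP; left; apply/eqP; ring.
case: n => [|n]; first by rewrite cesaro_num0 powR1 mulr1; lra.
apply: (le_trans (P n)); apply: ler_wpM2l; first by apply: cesaro_num_ge0; lra.
by apply: ge0_ler_powR; rewrite ?nnegrE// ler_nat.
Qed.

Lemma cesaro_num_le_powR s n : 0 <= s <= 1 -> k (1 - s) n <= n.+1%:R `^ (- s).
Proof.
move=> s01; have := @cesaro_num_powR_le 0 s n (lexx _) s01.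
rewrite !add0r powR1 mul1r cesaro_num_one powRN => h.
by rewrite -[_^-1]mul1r ler_pdivlMr ?powR_gt0.
Qed.

Lemma cesaro_num_ge_powR s n : 0 <= s <= 1 -> (1 - s) * n.+1%:R `^ (- s) <= k (1 - s) n.
Proof.
move=> s01; have := @cesaro_num_powR_ge s n s01.
by rewrite powRN => h; rewrite ler_pdivrMr ?powR_gt0.
Qed.

Lemma sum_inv_sqr_le n : \sum_(i < n) (i.+1%:R ^- 2 : R) <= 2.
Proof.
suff H : \sum_(i < n.+1) (i.+1%:R ^- 2 : R) <= 2 - n.+1%:R^-1.
  case: n H => [_|n H]; first by rewrite big_ord0.
  rewrite big_ord_recr/= in H.
  apply: le_trans (_ : 2 - n.+2%:R^-1 <= _); last by rewrite gerBl invr_ge0.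
  by apply: (le_trans _ H); rewrite lerDl invr_ge0 exprn_ge0.
elim: n => [|n IH]; first by rewrite big_ord1 expr1n invr1; lra.
rewrite big_ord_recr/=.
have y0 : (0 : R) < n.+1%:R by rewrite ltr0n.
move: IH y0; rewrite -(natr1 n.+1); move: (n.+1%:R) => y IH y0.
apply: le_trans (lerD IH (lexx _)) _.
rewrite -subr_ge0 (_ : _ - _ = (y * (y + 1) ^+ 2)^-1).
  by rewrite invr_ge0 mulr_ge0 ?exprn_ge0; lra.
by field; apply/andP; split; rewrite gt_eqF//; lra.
Qed.

(** Stands in for Gamma asymptotics: quotients of Cesaro numbers of matching growth have consecutive
    ratios 1 + O(n^-2), whose product converges. The factor 2 bounds the sum of inverse squares. *)
Lemma growth_bound (u : nat -> R) C : 0 <= C -> (forall n, 0 <= u n) ->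
  (forall n, u n.+1 <= u n * (1 + C / n.+1%:R ^+ 2)) ->
  forall n, u n <= u 0%N * expR (2 * C).
Proof.
move=> C0 u0 h n.
suff H : u n <= u 0%N * expR (C * \sum_(i < n) (i.+1%:R ^- 2)).
  apply: (le_trans H); apply: ler_wpM2l => //; rewrite ler_expR mulrC.
  by apply: ler_wpM2r => //; exact: sum_inv_sqr_le.
elim: n => [|n IH]; first by rewrite big_ord0 mulr0 expR0 mulr1.
apply: (le_trans (h n)); rewrite big_ord_recr/= [X in expR X]mulrDr expRD mulrA.
apply: ler_pM => //; last exact: expR_ge1Dx.
by rewrite addr_ge0// divr_ge0.
Qed.

(** Both sides grow like n^(a + b). With y = m + 1, the consecutive ratio of their quotient is 1 +
    ab / (y (a + b + y)), at most 1 + ab / y^2. *)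
Lemma cesaro_numM_le a b n : 0 <= a -> 0 <= b ->
  k (a + 1) n * k (b + 1) n <= expR (2 * (a * b)) * k (a + b + 1) n.
Proof.
move=> a0 b0.
have kp m : 0 < k (a + b + 1) m by apply: cesaro_num_gt0; lra.
rewrite -ler_pdivrMr//.
have := @growth_bound (fun n => k (a + 1) n * k (b + 1) n / k (a + b + 1) n) (a * b).
rewrite !cesaro_num0 mul1r divr1 mul1r; apply.
- exact: mulr_ge0.
- by move=> m; rewrite divr_ge0 ?(ltW (kp m))// mulr_ge0// cesaro_num_ge0//; lra.
move=> m; rewrite !cesaro_numS.
have m0 : (0 : R) < m.+1%:R by rewrite ltr0n.
have E : a + b + 1 + m%:R = a + b + m.+1%:R by rewrite -natr1; ring.
have E1 : a + 1 + m%:R = a + m.+1%:R by rewrite -natr1; ring.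
have E2 : b + 1 + m%:R = b + m.+1%:R by rewrite -natr1; ring.
rewrite E E1 E2; have := kp m.
have : 0 <= k (a + 1) m by apply: cesaro_num_ge0; lra.
have : 0 <= k (b + 1) m by apply: cesaro_num_ge0; lra.
move: (k (b + 1) m) (k (a + 1) m) (k (a + b + 1) m) m0.
have [y ->] : exists y : R, m.+1%:R = y by exists m.+1%:R.
move=> x1 x2 x3 y0 p2 p1 p3.
have -> : x2 * ((a + y) / y) * (x1 * ((b + y) / y)) / (x3 * ((a + b + y) / y)) =
  x2 * x1 / x3 * (1 + a * b / (y * (a + b + y))).
  by field; rewrite !gt_eqF//; lra.
apply: ler_wpM2l; first by rewrite divr_ge0 ?(ltW p3)// mulr_ge0.
rewrite lerD2l ler_wpM2l ?mulr_ge0// lef_pV2 ?posrE ?exprn_gt0 ?mulr_gt0//; last lra.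
by rewrite expr2 ler_pM2l//; lra.
Qed.

End RealBounds.

(** * Row and column estimates for the Beta kernels, and the Schur test *)

Section Kernel.
Variable R : realType.
Implicit Types (a b s x y C r : R) (n i j l N : nat).
Local Notation k := (@cesaro_num R).

Lemma beta_kernel_ge0 a b n l : 0 < a -> 0 < b -> 0 <= beta_kernel a b n l.
Proof.
move=> a0 b0; rewrite /beta_kernel; case: ifP => // _.
by apply: divr_ge0; first apply: mulr_ge0; apply: cesaro_num_ge0; lra.
Qed.

Lemma beta_kernel_row_sum a b n : 0 < a -> 0 < b ->
  \sum_(l < n.+1) beta_kernel a b n l = 1.
Proof.
move=> a0 b0; have k0 : k (a + b) n != 0 by rewrite gt_eqF// cesaro_num_gt0; lra.
transitivity (\sum_(l < n.+1) k a l * k b (n - l) / k (a + b) n).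
  by apply: eq_bigr => l _; rewrite /beta_kernel -ltnS ltn_ord.
by rewrite -mulr_suml cesaro_num_vandermonde divff.
Qed.

Lemma ge0_ler_sum_trunc (f : nat -> R) n N : (forall j, 0 <= f j) ->
  (forall j, (n <= j)%N -> f j = 0) -> \sum_(j < N) f j <= \sum_(j < n) f j.
Proof.
move=> f0 fn; case: (leqP n N) => [nN|Nn]; first by rewrite (big_ord_trunc nN).
by rewrite -(subnKC (ltnW Nn)) big_split_ord/= lerDl sumr_ge0.
Qed.

Lemma beta_kernel1E b n l : (l <= n)%N -> beta_kernel 1 b n l = k b (n - l) / k (1 + b) n.
Proof. by move=> ln; rewrite /beta_kernel ln cesaro_num_one mul1r. Qed.

(** Up to the factor 1 / (1 - s), the power (l + 1)^-s is dominated by k^(1-s)(l), whose convolution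
    with k^b is k^(b+1-s)(n) by Vandermonde. *)
Lemma beta_kernel1_row_powR b s n N : 0 < b -> 0 <= s < 1 ->
  \sum_(l < N) beta_kernel 1 b n l * l.+1%:R `^ (- s) <=
  (b + 1) `^ s / (1 - s) * n.+1%:R `^ (- s).
Proof.
move=> b0 /andP[s0 s1].
have s01 : 0 <= s <= 1 by rewrite s0 ltW.
have s1' : 0 < 1 - s by lra.
apply: le_trans (@ge0_ler_sum_trunc (fun l => beta_kernel 1 b n l * l.+1%:R `^ (- s)) n.+1 N _ _) _.
- by move=> j; rewrite mulr_ge0 ?powR_ge0 ?beta_kernel_ge0.
- by move=> j nj; rewrite beta_kernel_gt ?mul0r.
have k0 : 0 < k (1 + b) n by apply: cesaro_num_gt0; lra.
apply: (@le_trans _ _ (k (b + 1 - s) n / k (b + 1) n / (1 - s))).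
  have -> : k (b + 1 - s) n = \sum_(l < n.+1) k (1 - s) l * k b (n - l).
    by rewrite cesaro_num_vandermonde; congr cesaro_num; ring.
  rewrite !mulr_suml; apply: ler_sum => l _.
  rewrite beta_kernel1E -1?ltnS// (addrC b).
  rewrite [leRHS](_ : _ = k b (n - l) / k (1 + b) n * (k (1 - s) l / (1 - s))); last by ring.
  apply: ler_wpM2l; first by rewrite divr_ge0 ?(ltW k0)// cesaro_num_ge0// ltW.
  by rewrite ler_pdivlMr// mulrC; exact: cesaro_num_ge_powR.
rewrite [leRHS]mulrAC; apply: ler_wpM2r; first by rewrite invr_ge0 ltW.
rewrite powRN ler_pdivrMr; last by rewrite addrC.
rewrite mulrAC ler_pdivlMr ?powR_gt0//.
apply: le_trans (@cesaro_num_powR_le _ b s n (ltW b0) s01).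
apply: ler_wpM2l; first by apply: cesaro_num_ge0; lra.
by apply: ge0_ler_powR; rewrite ?nnegrE ?lerDr ?addr_ge0// ltW.
Qed.

(** Summation by parts: k^(1-s) is an eigenvector of the transpose of [delta 1], with eigenvalue
    s. *)
Lemma delta_sum (c : nat -> R) s N :
  \sum_(n < N) k (1 - s) n * delta 1 c n =
  s * (\sum_(n < N) k (1 - s) n * c n) + N%:R * k (1 - s) N * c N.-1.
Proof.
elim: N => [|N IH]; first by rewrite !big_ord0 !mul0r mulr0 addr0.
rewrite !big_ord_recr/= IH (cesaro_numS_mul _ N) /delta; ring.
Qed.

Lemma add_nat_neq0 a i : 0 < a -> a + i%:R != 0.
Proof. by move=> a0; rewrite gt_eqF// ltr_wpDr. Qed.

(** Let X i be the sum on the left. The boundary term of [delta_sum] is nonnegative, whence (i + 1)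
    X (i + 1) <= (i + 1 - s) X i. This is the recursion of k^(1-s), so only X 0 remains to be
    bounded. *)
Lemma beta_kernel1_col_cesaro b s i N : 0 < b -> 0 < s < 1 ->
  \sum_(n < N) k (1 - s) n * beta_kernel 1 b n i <= (b + 1) / s * k (1 - s) i.
Proof.
move=> b0 /andP[s0 s1].
have v0 n : 0 <= k (1 - s) n by apply: cesaro_num_ge0; lra.
pose X i := \sum_(n < N) k (1 - s) n * beta_kernel 1 b n i.
have X0 : X 0%N <= (b + 1) / s.
  (* Column 0 of the kernel is b / (b + n), at most (b + 1) / (n + 1), and k^(1-s)(n) - k^(1-s)(n +
     1) = s k^(1-s)(n) / (n + 1). *)
  have tel M : \sum_(n < M) k (1 - s) n / n.+1%:R = (1 - k (1 - s) M) / s.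
    elim: M => [|M IH]; first by rewrite big_ord0 cesaro_num0 subrr mul0r.
    rewrite big_ord_recr/= IH cesaro_numS -natr1; field.
    by do ?(apply/andP; split); rewrite ?natr1 ?nat1r ?pnatr_eq0 ?gt_eqF.
  apply: (@le_trans _ _ ((b + 1) * \sum_(n < N) k (1 - s) n / n.+1%:R)); last first.
    rewrite tel mulrA; apply: ler_wpM2r; first by rewrite invr_ge0 ltW.
    by rewrite mulrBr mulr1 gerBl mulr_ge0//; lra.
  rewrite mulr_sumr; apply: ler_sum => n _.
  rewrite [leRHS]mulrCA; apply: ler_wpM2l => //.
  rewrite beta_kernel1E// subn0 addrC.
  have bn : 0 < b + n%:R by rewrite ltr_wpDr.
  have -> : k b n / k (b + 1) n = b / (b + n%:R).
    have kn0 : 0 < k (b + 1) n by apply: cesaro_num_gt0; lra.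
    apply/eqP; rewrite eqr_div ?(gt_eqF bn) ?(gt_eqF kn0)//.
    by rewrite cesaro_num_add1 mulrC.
  rewrite ler_pdivrMr// mulrAC ler_pdivlMr ?ltr0n// -natr1.
  have : 0 <= n%:R :> R by [].
  by move: (n%:R) => y y0; rewrite -subr_ge0 (_ : _ - _ = b * b + y); [nra|ring].
have step j : X j.+1 * j.+1%:R <= X j * (1 - s + j%:R).
  have h := delta_sum (fun n => beta_kernel 1 b n j) s N.
  have E : \sum_(n < N) k (1 - s) n * delta 1 (fun n => beta_kernel 1 b n j) n =
     j.+1%:R * (X j - X j.+1).
    rewrite /X -sumrB mulr_sumr; apply: eq_bigr => n _.
    rewrite -beta_kernel1_delta//; first by ring.
    by move=> m; apply: add_nat_neq0; lra.
  rewrite E -/(X j) in h.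
  have p : 0 <= N%:R * k (1 - s) N * beta_kernel 1 b N.-1 j.
    by rewrite mulr_ge0 ?beta_kernel_ge0// mulr_ge0.
  move: h; rewrite -natr1; move: (X j) (X j.+1) (j%:R : R) p; move: (_ * _) => q x y z p h.
  by lra.
suff H : X i <= X 0%N * k (1 - s) i.
  by apply: (le_trans H); apply: ler_wpM2r.
elim: i => [|i IH]; first by rewrite cesaro_num0 mulr1.
have i0 : (0 : R) < i.+1%:R by rewrite ltr0n.
rewrite cesaro_numS mulrA mulrA ler_pdivlMr//.
apply: (le_trans (step i)); apply: ler_wpM2r => //.
by rewrite addr_ge0//; lra.
Qed.

Lemma beta_kernel1_col_powR b s i N : 0 < b -> 0 < s < 1 ->
  \sum_(n < N) beta_kernel 1 b n i * n.+1%:R `^ (- s) <=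
  (b + 1) / (s * (1 - s)) * i.+1%:R `^ (- s).
Proof.
move=> b0 s01'; have /andP[s0 s1] := s01'.
have s01 : 0 <= s <= 1 by rewrite !ltW.
have s1' : 0 < 1 - s by lra.
rewrite invfM mulrA mulrAC ler_pdivlMr//.
apply: le_trans (_ : (b + 1) / s * k (1 - s) i <= _); last first.
  apply: ler_wpM2l; first by rewrite divr_ge0//; lra.
  exact: cesaro_num_le_powR.
apply: le_trans (beta_kernel1_col_cesaro i N b0 s01').
rewrite mulr_suml; apply: ler_sum => n _.
rewrite -mulrA mulrC; apply: ler_wpM2r; first by apply: beta_kernel_ge0.
by rewrite mulrC; exact: cesaro_num_ge_powR.
Qed.

(* Jensen's inequality for the weights K n j w_j, in the form of a tangent line. *)
Lemma schur_test (K : nat -> nat -> R) (w h : nat -> R) r C1 C2 N N' :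
  1 <= r -> 0 <= C1 -> 0 <= C2 ->
  (forall n j, 0 <= K n j) -> (forall n, 0 < w n) -> (forall n, 0 <= h n) ->
  (forall n N, \sum_(j < N) K n j * w j <= C1 * w n) ->
  (forall j N, \sum_(n < N) K n j * w n `^ (r - 1) <= C2 * w j `^ (r - 1)) ->
  \sum_(n < N) (\sum_(j < N') K n j * h j) `^ r <=
  C1 `^ (r - 1) * C2 * \sum_(j < N') h j `^ r.
Proof.
move=> r1 C10 C20 K0 w0 h0 row col.
have r0 : 0 < r by lra.
have wr n : 0 < w n `^ (r - 1) by rewrite powR_gt0.
have pt n : (\sum_(j < N') K n j * h j) `^ r <=
   C1 `^ (r - 1) * \sum_(j < N') K n j * w n `^ (r - 1) * (h j `^ r / w j `^ (r - 1)).
  pose sg := \sum_(j < N') K n j * w j.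
  have sg0 : 0 <= sg by rewrite sumr_ge0// => j _; rewrite mulr_ge0// ltW.
  have sn0 : 0 <= \sum_(j < N') K n j * w n `^ (r - 1) * (h j `^ r / w j `^ (r - 1)).
    by rewrite sumr_ge0// => j _; rewrite !mulr_ge0 ?powR_ge0// invr_ge0 powR_ge0.
  (* A row of zero mass vanishes because w > 0; the normalisation by [sg] concerns the other
     rows. *)
  have [sE|sgn0] := eqVneq sg 0.
    have Kz (j : 'I_N') : K n j = 0.
      move/eqP: sE; rewrite /sg psumr_eq0; last by move=> i _; rewrite mulr_ge0// ltW.
      move/allP => /(_ j); rewrite mem_index_enum => /(_ isT)/=.
      by rewrite mulf_eq0 (gt_eqF (w0 j)) orbF => /eqP.
    rewrite big1 ?powR0 ?gt_eqF//; first by rewrite mulr_ge0 ?powR_ge0.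
    by move=> j _; rewrite Kz mul0r.
  have sgp : 0 < sg by rewrite lt_def sgn0.
  pose S := \sum_(j < N') K n j * h j.
  have S0 : 0 <= S by rewrite sumr_ge0// => j _; rewrite mulr_ge0.
  (* [A] is the mean of h / w for the weights K n j w_j, so the linear term of the tangent at [A]
     averages to zero. *)
  pose A := S / sg.
  have A0 : 0 <= A by rewrite divr_ge0.
  have J : sg * A `^ r <= \sum_(j < N') K n j * (h j `^ r / w j `^ (r - 1)).
    have -> : sg * A `^ r =
      \sum_(j < N') K n j * w j * (A `^ r + r * A `^ (r - 1) * (h j / w j - A)).
      under eq_bigr => j _ do rewrite mulrDr.
      rewrite big_split/= -mulr_suml -/sg -[LHS]addr0; congr (_ + _).
      transitivity (r * A `^ (r - 1) * \sum_(j < N') (K n j * h j - K n j * w j * A)).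
        by rewrite sumrB -mulr_suml -/S -/sg /A mulrCA divff// mulr1 subrr mulr0.
      rewrite mulr_sumr; apply: eq_bigr => j _.
      by field; rewrite gt_eqF.
    apply: ler_sum => j _; rewrite -mulrA; apply: ler_wpM2l => //.
    have := @powR_tangent _ r (h j / w j) A r1 (divr_ge0 (h0 j) (ltW (w0 j))) A0.
    move=> /(ler_wpM2l (ltW (w0 j))) /le_trans; apply.
    rewrite powRM// ?invr_ge0 ?(ltW (w0 j))// mulrCA.
    have -> : (w j)^-1 `^ r = (w j)^-1 * (w j `^ (r - 1))^-1.
      rewrite -{2}(powR_inv1 (ltW (w0 j))) -powRN -powRD; last by rewrite (gt_eqF (w0 j)) implybT.
      by rewrite -powR_inv1 ?(ltW (w0 j))// -powRrM; congr (_ `^ _); ring.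
    by rewrite mulVKf// gt_eqF.
  have -> : S `^ r = sg `^ (r - 1) * (sg * A `^ r).
    rewrite mulrA -{2}(powRr1 sg0) -powRD; last by rewrite sgn0 implybT.
    by rewrite subrK -powRM// /A mulrCA divff// mulr1.
  apply: (@le_trans _ _ ((C1 * w n) `^ (r - 1) * \sum_(j < N') K n j * (h j `^ r / w j `^ (r - 1)))).
    apply: ler_pM => //; [exact: powR_ge0|by rewrite mulr_ge0 ?powR_ge0|].
    apply: ge0_ler_powR; rewrite ?nnegrE ?subr_ge0//; last exact: row.
    by rewrite mulr_ge0// ltW.
  rewrite powRM// ?(ltW (w0 n))// -mulrA mulr_sumr.
  apply: ler_wpM2l; first exact: powR_ge0.
  by apply: ler_sum => j _; rewrite mulrA (mulrC (w n `^ _)).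
apply: le_trans (_ : \sum_(n < N) C1 `^ (r - 1) * (\sum_(j < N') K n j * w n `^ (r - 1) * (h j `^ r / w j `^ (r - 1))) <= _).
  by apply: ler_sum => n _; exact: pt.
rewrite -mulr_sumr -mulrA; apply: ler_wpM2l; first exact: powR_ge0.
rewrite exchange_big/= mulr_sumr; apply: ler_sum => j _.
rewrite -mulr_suml mulrA ler_pdivrMr// mulrAC (mulrC _ (h j `^ r)) (mulrC _ (h j `^ r)).
by apply: ler_wpM2l; [exact: powR_ge0|exact: col].
Qed.

Lemma hardy_mean b r : 0 < b -> 1 < r -> exists2 C, 0 <= C &
  forall (h : nat -> R) N N', (forall n, 0 <= h n) ->
  \sum_(n < N) (\sum_(j < N') beta_kernel 1 b n j * h j) `^ r <=
  C * \sum_(j < N') h j `^ r.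
Proof.
(* For the weight (n + 1)^-s the row estimate asks 0 <= s < 1, and the column estimate for its power
   r - 1 asks 0 < s (r - 1) < 1; s = 1 / (r + 1) meets both when r > 1. *)
move=> b0 r1; pose s := (r + 1)^-1.
have r0 : 0 < r + 1 by lra.
have s0 : 0 < s by rewrite invr_gt0.
have s1 : s < 1 by rewrite invf_lt1//; lra.
have t0 : 0 < s * (r - 1) by rewrite mulr_gt0//; lra.
have t1 : s * (r - 1) < 1 by rewrite /s mulrC ltr_pdivrMr//; lra.
have d1 : 0 <= (b + 1) `^ s / (1 - s) by rewrite divr_ge0 ?powR_ge0//; lra.
have d2 : 0 <= (b + 1) / (s * (r - 1) * (1 - s * (r - 1))).
  by rewrite divr_ge0 ?mulr_ge0//; lra.
exists (((b + 1) `^ s / (1 - s)) `^ (r - 1) * ((b + 1) / (s * (r - 1) * (1 - s * (r - 1))))).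
  by rewrite mulr_ge0// powR_ge0.
move=> h N N' h0.
apply: (@schur_test (beta_kernel 1 b) (fun n => n.+1%:R `^ (- s))) => //.
- exact: ltW.
- by move=> n j; exact: beta_kernel_ge0.
- by move=> n M; apply: beta_kernel1_row_powR; rewrite // s1 ltW.
- move=> j M; rewrite -!powRrM mulNr; under eq_bigr => n _ do rewrite -powRrM mulNr.
  by apply: beta_kernel1_col_powR; rewrite // t0.
Qed.

Lemma hardy_adj b r : 0 < b -> 1 <= r -> exists2 C, 0 <= C &
  forall (h : nat -> R) N N', (forall n, 0 <= h n) ->
  \sum_(n < N) (\sum_(j < N') beta_kernel 1 b j n * h j) `^ r <=
  C * \sum_(j < N') h j `^ r.
Proof.
(* Transposition swaps the two estimates: the conditions become 0 < s < 1 and 0 <= s (r - 1) < 1,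
   and r = 1 is allowed. *)
move=> b0 r1; pose s := (r + 1)^-1.
have r0 : 0 < r + 1 by lra.
have s0 : 0 < s by rewrite invr_gt0.
have s1 : s < 1 by rewrite invf_lt1//; lra.
have t0 : 0 <= s * (r - 1) by rewrite mulr_ge0//; lra.
have t1 : s * (r - 1) < 1 by rewrite /s mulrC ltr_pdivrMr//; lra.
have d1 : 0 <= (b + 1) `^ (s * (r - 1)) / (1 - s * (r - 1)) by rewrite divr_ge0 ?powR_ge0//; lra.
have d2 : 0 <= (b + 1) / (s * (1 - s)).
  by rewrite divr_ge0 ?mulr_ge0//; lra.
exists (((b + 1) / (s * (1 - s))) `^ (r - 1) * ((b + 1) `^ (s * (r - 1)) / (1 - s * (r - 1)))).
  by rewrite mulr_ge0// powR_ge0.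
move=> h N N' h0.
apply: (@schur_test (fun n j => beta_kernel 1 b j n) (fun n => n.+1%:R `^ (- s))) => //.
- by move=> n j; exact: beta_kernel_ge0.
- by move=> n M; apply: beta_kernel1_col_powR; rewrite // s0.
- move=> j M; rewrite -!powRrM mulNr; under eq_bigr => n _ do rewrite -powRrM mulNr.
  by apply: beta_kernel1_row_powR; rewrite // t0.
Qed.

End Kernel.

(** * Complex Cesaro numbers and kernels against those of order Re beta *)

Lemma div_mul_div (F : fieldType) (x y u v : F) : x / (y * (u / v)) = x / y * (v / u).
Proof. by rewrite invfM invf_div !mulrA. Qed.

Section ComplexKernels.
Variable R : realType.
Implicit Types (z beta : R[i]) (n i j l N : nat).

Lemma real_complex_natr n : (n%:R : R)%:C = n%:R :> R[i].
Proof. by rewrite rmorph_nat. Qed.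

Lemma cesaro_num_complex (a : R) n : (cesaro_num a n)%:C = cesaro_num (a%:C : R[i]) n.
Proof.
rewrite /cesaro_num rmorphM/= rmorph_prod/= fmorphV/= rmorph_nat; congr (_ / _).
by apply: eq_bigr => i _; rewrite rmorphD/= rmorph_nat.
Qed.

Lemma Re_addn z n : complex.Re (z + n%:R) = complex.Re z + n%:R.
Proof. by rewrite raddfD/= -real_complex_natr. Qed.

Lemma Im_addn z n : complex.Im (z + n%:R) = complex.Im z.
Proof. by rewrite raddfD/= -real_complex_natr/= addr0. Qed.

Lemma Re_le_modulus_addn z n : complex.Re z + n%:R <= modulus (z + n%:R).
Proof. by rewrite -Re_addn (le_trans (ler_norm _))// Re_le_modulus. Qed.

Lemma Re_gt0_neq0 z n : 0 < complex.Re z -> z + n%:R != 0.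
Proof.
move=> z0; apply/eqP => /(congr1 (@complex.Re R)); rewrite Re_addn/= => /eqP.
by rewrite gt_eqF// ltr_wpDr.
Qed.

Lemma modulus_natr n : modulus (n%:R : R[i]) = n%:R.
Proof. by rewrite -real_complex_natr modulusR ger0_norm. Qed.

Lemma modulus_cesaro_numS z n : modulus (cesaro_num z n.+1) =
  modulus (cesaro_num z n) * (modulus (z + n%:R) / n.+1%:R).
Proof.
rewrite cesaro_numS; move: (cesaro_num z n) => k.
by rewrite !modulusM modulusV modulus_natr.
Qed.

Lemma modulus_cesaro_num_ge z n : 0 < complex.Re z ->
  cesaro_num (complex.Re z) n <= modulus (cesaro_num z n).
Proof.
move=> z0; elim: n => [|n IH]; first by rewrite !cesaro_num0 modulus1.
rewrite modulus_cesaro_numS cesaro_numS.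
apply: ler_pM => //; first by apply: cesaro_num_ge0; exact: ltW.
  by rewrite divr_ge0// addr_ge0// ltW.
by apply: ler_wpM2r => //; exact: Re_le_modulus_addn.
Qed.

(** With b = Re z and y = Im z, the ratio |z + i| / (b + i) is at most 1 + (y / (b + i))^2, and b +
    i >= min(b, 1) (i + 1) brings this to the form required by [growth_bound]. *)
Lemma modulus_cesaro_num_le z : 0 < complex.Re z -> exists2 C : R, 0 <= C &
  forall n, modulus (cesaro_num z n) <= C * cesaro_num (complex.Re z) n.
Proof.
move=> z0; set b := complex.Re z; set y := complex.Im z.
pose m := Order.min b 1.
have m0 : 0 < m by rewrite lt_min z0 ltr01.
pose C := y ^+ 2 / m ^+ 2.
have C0 : 0 <= C by rewrite divr_ge0// ?sqr_ge0.
exists (expR (2 * C)); first exact: expR_ge0.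
move=> n; have kp i : 0 < cesaro_num b i by exact: cesaro_num_gt0.
rewrite -ler_pdivrMr//.
have := @growth_bound _ (fun n => modulus (cesaro_num z n) / cesaro_num b n) C C0.
rewrite /= !cesaro_num0 modulus1 divr1 mul1r; apply.
  by move=> i; rewrite divr_ge0 ?modulus_ge0// ltW.
move=> i; rewrite modulus_cesaro_numS cesaro_numS.
have i0 : (0 : R) < i.+1%:R by rewrite ltr0n.
have bi : 0 < b + i%:R by rewrite ltr_wpDr.
have H : modulus (z + i%:R) <= (b + i%:R) * (1 + C / i.+1%:R ^+ 2).
  have c1 : 0 <= C / i.+1%:R ^+ 2 by rewrite divr_ge0// sqr_ge0.
  have bmi : m * i.+1%:R <= b + i%:R.
    rewrite -natr1 mulrDr mulr1 addrC; apply: lerD; first by rewrite ge_min lexx.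
    by rewrite ler_piMl// ge_min lexx orbT.
  have yb : y ^+ 2 <= (b + i%:R) ^+ 2 * (C / i.+1%:R ^+ 2).
    rewrite /C (_ : _ * _ = y ^+ 2 * ((b + i%:R) ^+ 2 / (m * i.+1%:R) ^+ 2)); last first.
      by field; rewrite (gt_eqF m0) addrC natr1 (gt_eqF i0).
    rewrite -[leLHS]mulr1.
    apply: ler_wpM2l; first exact: sqr_ge0.
    rewrite ler_pdivlMr ?mul1r ?exprn_gt0 ?mulr_gt0//.
    by rewrite lerXn2r ?nnegrE// ltW// mulr_gt0.
  have P0 : 0 <= (b + i%:R) * (1 + C / i.+1%:R ^+ 2) by rewrite mulr_ge0 ?addr_ge0// ltW.
  have -> : modulus (z + i%:R) = Num.sqrt ((b + i%:R) ^+ 2 + y ^+ 2).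
    have -> : modulus (z + i%:R) = Num.sqrt (complex.Re (z + i%:R) ^+ 2 + complex.Im (z + i%:R) ^+ 2).
      by case: (z + i%:R).
    by rewrite Re_addn Im_addn.
  rewrite -(ger0_norm P0) -sqrtr_sqr; apply: ler_wsqrtr.
  apply: le_trans (lerD (lexx _) yb) _.
  move: c1; move: (C / _) => c c1.
  rewrite exprMn -subr_ge0 (_ : _ - _ = (b + i%:R) ^+ 2 * (c + c ^+ 2)); last by ring.
  by rewrite mulr_ge0 ?sqr_ge0// addr_ge0// sqr_ge0.
have k0 := kp i.
have -> : modulus (cesaro_num z i) * (modulus (z + i%:R) / i.+1%:R) /
   (cesaro_num b i * ((b + i%:R) / i.+1%:R)) =
   modulus (cesaro_num z i) / cesaro_num b i * (modulus (z + i%:R) / (b + i%:R)).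
  by field; rewrite !gt_eqF// addrC natr1.
apply: ler_wpM2l; first by rewrite divr_ge0 ?modulus_ge0// ltW.
by rewrite ler_pdivrMr// mulrC.
Qed.

(** Induction along the diagonal n - l = m. At l = 0 the entry is z / (z + m), which produces the
    constant |z| / Re z; every further step multiplies by (p + 1) / (1 + z + p), of modulus at most
    the same factor for Re z. *)
Lemma modulus_beta_kernel1_le z n l : 0 < complex.Re z ->
  modulus (beta_kernel 1 z n l) <=
  modulus z / complex.Re z * beta_kernel 1 (complex.Re z) n l.
Proof.
move=> z0; set b := complex.Re z.
case: (leqP l n) => [ln|nl]; last by rewrite !beta_kernel_gt// modulus0 mulr0.
rewrite /beta_kernel ln !cesaro_num_one !mul1r.
have zS i : 1 + z + i%:R = z + i.+1%:R by rewrite -natr1; ring.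
have bS i : 1 + b + i%:R = b + i.+1%:R by rewrite -natr1; ring.
have zn0 i : 1 + z + i%:R != 0 by rewrite zS; exact: Re_gt0_neq0.
have kz i := cesaro_num_neq0 i zn0.
have kb i : 0 < cesaro_num (1 + b) i by apply: cesaro_num_gt0; rewrite ltr_wpDl.
have := subnKC ln; move: (n - l)%N => m <-.
elim: l {ln n} => [|l IH].
  rewrite add0n.
  have zm : z + m%:R != 0 by exact: Re_gt0_neq0.
  have bm : 0 < b + m%:R by rewrite ltr_wpDr.
  have -> : cesaro_num z m / cesaro_num (1 + z) m = z / (z + m%:R).
    by apply/eqP; rewrite eqr_div// (addrC 1 z) cesaro_num_add1 mulrC.
  have -> : cesaro_num b m / cesaro_num (1 + b) m = b / (b + m%:R).
    by apply/eqP; rewrite eqr_div ?(gt_eqF bm) ?(gt_eqF (kb m))// (addrC 1 b) cesaro_num_add1 mulrC.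
  rewrite modulusM modulusV mulrA divfK ?gt_eqF//.
  apply: ler_wpM2l; first exact: modulus_ge0.
  by rewrite lef_pV2 ?posrE//; [exact: Re_le_modulus_addn|exact: lt_le_trans (Re_le_modulus_addn _ _)].
rewrite addSn; set p := (l + m)%N; rewrite !cesaro_numS.
have pb : 0 < 1 + b + p%:R by rewrite ltr_wpDr// ltr_wpDl.
have -> : cesaro_num z m / (cesaro_num (1 + z) p * ((1 + z + p%:R) / p.+1%:R)) =
  (cesaro_num z m / cesaro_num (1 + z) p) * (p.+1%:R / (1 + z + p%:R)).
  exact: div_mul_div.
have -> : modulus z / b * (cesaro_num b m / (cesaro_num (1 + b) p * ((1 + b + p%:R) / p.+1%:R))) =
  modulus z / b * (cesaro_num b m / cesaro_num (1 + b) p) * (p.+1%:R / (1 + b + p%:R)).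
  by rewrite -[RHS]mulrA div_mul_div.
rewrite modulusM; apply: ler_pM => //; try exact: modulus_ge0.
rewrite modulusM modulusV modulus_natr; apply: ler_wpM2l => //.
have h : 1 + b + p%:R <= modulus (1 + z + p%:R).
  by rewrite zS bS; exact: Re_le_modulus_addn.
by rewrite lef_pV2 ?posrE// (lt_le_trans pb).
Qed.

End ComplexKernels.

(** * Fractional differences *)

Section FracDiff.
Variable R : realType.
Implicit Types (a g alpha B M : R) (f u : nat -> R[i]^o) (n i j l N : nat).

Lemma sum_fromP n u (l : R[i]^o) :
  (\sum_(n <= j < N) u j) @[N --> \oo] --> l <-> (\sum_(i < N) u (n + i)%N) @[N --> \oo] --> l.
Proof.
rewrite -(cvg_shiftn n (fun N => \sum_(n <= j < N) u j)).
have -> // : (fun N => \sum_(i < N) u (n + i)%N) = (fun N => \sum_(n <= j < N + n) u j).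
apply/funext => N; have := @big_addn _ 0 +%R 0%N (N + n)%N n xpredT u.
rewrite add0n addnK big_mkord => ->.
by apply: eq_bigr => i _; rewrite addnC.
Qed.

Lemma sum_from_cvgE n u : sum_from_cvg n u <-> csum_cvg (fun i => u (n + i)%N).
Proof.
split=> [/sum_fromP h|h]; apply/cvg_ex; first by exists (sum_from n u).
by exists (csum (fun i => u (n + i)%N)); apply/sum_fromP.
Qed.

Lemma sum_fromE n u : csum_cvg (fun i => u (n + i)%N) ->
  sum_from n u = csum (fun i => u (n + i)%N).
Proof. by move=> h; apply: cvg_lim; [exact: norm_hausdorff|apply/sum_fromP]. Qed.

Definition diff_coef a j : R[i]^o := (cesaro_num (- a) j)%:C.

(* The expansion of (1 - S)^a, S the shift; see frac_diffE. *)
Definition fdiff a f n : R[i]^o := csum (fun j => diff_coef a j * f (n + j)%N).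

Definition fdiff_cvg a f n : Prop := csum_cvg (fun j => diff_coef a j * f (n + j)%N).

Lemma diff_coef0 a : diff_coef a 0 = 1.
Proof. by rewrite /diff_coef cesaro_num0. Qed.

Lemma modulus_diff_coef a j : modulus (diff_coef a j) = `|cesaro_num (- a) j|.
Proof. exact: modulusR. Qed.

Lemma diff_coefS a j : diff_coef (a + 1) j.+1 = diff_coef a j.+1 - diff_coef a j.
Proof.
rewrite /diff_coef -rmorphB/=; congr (_%:C).
by rewrite -[in LHS]cesaro_num_diff opprD -addrA addNr addr0.
Qed.

Lemma csum_delta (c : R[i]^o) : (\sum_(j < N) (if (j : nat) == 0%N then c else 0)) @[N --> \oo] --> c.
Proof.
apply: cvg_near_cst; exists 1%N => // -[//|N] _ /=.
by rewrite big_ord_recl/= big1 ?addr0.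
Qed.

Lemma fdiff0_term f n j : diff_coef 0 j * f (n + j)%N = if j == 0%N then f n else 0.
Proof.
rewrite /diff_coef oppr0; case: j => [|j]; first by rewrite cesaro_num0 mul1r addn0.
by rewrite cesaro_num_zero mul0r.
Qed.

Lemma fdiff0 f n : fdiff_cvg 0 f n /\ fdiff 0 f n = f n.
Proof.
rewrite /fdiff_cvg /fdiff; under eq_fun do rewrite fdiff0_term.
by split; [apply/cvg_ex; exists (f n)|apply: csumP]; exact: csum_delta.
Qed.

(** The factorisation (1 - S)^(a + 1) = (1 - S)(1 - S)^a on partial sums. The shifted sum is one
    term shorter, which leaves no boundary term. *)
Lemma fdiff_psumS a f n N :
  \sum_(j < N.+1) diff_coef (a + 1) j * f (n + j)%N =
  \sum_(j < N.+1) diff_coef a j * f (n + j)%N - \sum_(j < N) diff_coef a j * f (n.+1 + j)%N.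
Proof.
elim: N => [|N IH]; first by rewrite !big_ord1 big_ord0 subr0 !diff_coef0.
rewrite big_ord_recr/= IH [in RHS]big_ord_recr/= [X in _ = _ - X]big_ord_recr/=.
by rewrite diff_coefS addSnnS; ring.
Qed.

Lemma fdiffS a f n : fdiff_cvg a f n -> fdiff_cvg a f n.+1 ->
  fdiff_cvg (a + 1) f n /\ fdiff (a + 1) f n = fdiff a f n - fdiff a f n.+1.
Proof.
move=> h h1.
have c : (\sum_(j < N) diff_coef (a + 1) j * f (n + j)%N) @[N --> \oo] -->
    (fdiff a f n - fdiff a f n.+1 : R[i]^o).
  rewrite -(cvg_shiftS (fun N => \sum_(j < N) diff_coef (a + 1) j * f (n + j)%N)).
  rewrite [X in X @ _ --> _](_ : _ = (fun N => \sum_(j < N.+1) diff_coef a j * f (n + j)%N -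
     \sum_(j < N) diff_coef a j * f (n.+1 + j)%N)); last first.
    by apply/funext => N; exact: fdiff_psumS.
  apply: (@ccvgB _ (fun N => \sum_(j < N.+1) diff_coef a j * f (n + j)%N)
    (fun N => \sum_(j < N) diff_coef a j * f (n.+1 + j)%N)); last exact: h1.
  exact: (@ccvg_shiftS _ (fun N => \sum_(j < N) diff_coef a j * f (n + j)%N) _ h).
by split; [apply: cvgP c|exact: csumP c].
Qed.

Lemma fdiff_iter a f m : (forall n, fdiff_cvg a f n) ->
  forall n, fdiff_cvg (a + m%:R) f n /\ iter m (@difference R) (fdiff a f) n = fdiff (a + m%:R) f n.
Proof.
move=> h; elim: m => [|m IH] n; first by rewrite addr0.
rewrite -natr1 addrA /=.
have [[c0 e0] [c1 e1]] := (IH n, IH n.+1).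
have [h1 h2] := fdiffS c0 c1.
by split=> //; rewrite /difference e0 e1.
Qed.

Lemma frac_sum_term_fdiff g f n j :
  frac_sum_term g f n (n + j)%N = diff_coef (- g) j * f (n + j)%N.
Proof. by rewrite /frac_sum_term /diff_coef opprK addKn. Qed.

Lemma frac_sum_cvgE g f n : frac_sum_cvg g f n <-> fdiff_cvg (- g) f n.
Proof.
rewrite /frac_sum_cvg sum_from_cvgE /fdiff_cvg.
by under eq_fun do rewrite frac_sum_term_fdiff.
Qed.

Lemma frac_sumE g f n : fdiff_cvg (- g) f n -> frac_sum g f n = fdiff (- g) f n.
Proof.
move=> h; rewrite /frac_sum sum_fromE.
  by apply: eq_csum => j; rewrite frac_sum_term_fdiff.
by rewrite -sum_from_cvgE; apply/frac_sum_cvgE.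
Qed.

Lemma eq_iter_difference m f u : f =1 u -> iter m (@difference R) f =1 iter m (@difference R) u.
Proof. by move=> h; elim: m => //= m IH n; rewrite /difference !IH. Qed.

(** For non-integer alpha, definedness is convergence of the series of order -(m - alpha). Each of
    the m differences raises the order by one and keeps convergence ([fdiffS]), ending at the single
    series of order alpha. *)
Lemma frac_diffE alpha f : 0 <= alpha -> frac_diff_defined alpha f ->
  frac_diff alpha f =1 fdiff alpha f.
Proof.
move=> a0; rewrite /frac_diff_defined /frac_diff; case: ifPn => [aN _|aN h] n.
  have e := truncnK aN.
  have h m : fdiff_cvg 0 f m by have [] := fdiff0 f m.
  have [_] := @fdiff_iter 0 f (Num.truncn alpha) h n.
  rewrite add0r e => <-; apply: eq_iter_difference => m.
  by have [_ ->] := fdiff0 f m.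
set g := (Num.truncn alpha).+1%:R - alpha in h *.
have hg m : fdiff_cvg (- g) f m by exact: (frac_sum_cvgE g f m).1 (h isT m).
have [_] := fdiff_iter (Num.truncn alpha).+1 hg n.
have -> : - g + (Num.truncn alpha).+1%:R = alpha by rewrite /g opprB subrK.
move=> <-; apply: eq_iter_difference => m; exact: (frac_sumE (hg m)).
Qed.

(** For 0 <= b <= 1 all coefficients after the first are nonpositive, so the sum of moduli up to K
    telescopes to 2 - k^(1-b)(K). Raising the order by one at most doubles the bound. *)
Lemma diff_coef_abs a : 0 <= a -> exists2 M, 0 <= M & abs_bound M (diff_coef a).
Proof.
move=> a0; have /andP[t0 t1] := truncn_itv a0.
pose b := a - (Num.truncn a)%:R.
have b0 : 0 <= b by rewrite subr_ge0.
have b1 : b <= 1 by rewrite lerBlDr addrC natr1 ltW.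
have -> : a = b + (Num.truncn a)%:R by rewrite /b subrK.
move: b b0 b1 => {a0 t0 t1} b b0 b1.
elim: (Num.truncn a) => [|m [M M0 IH]].
  exists 2 => // N; rewrite addr0.
  have neg j : cesaro_num (- b) j.+1 <= 0.
    elim: j => [|j IH]; first by rewrite cesaro_num1 oppr_le0.
    rewrite cesaro_numS mulr_le0_ge0// divr_ge0// addrC subr_ge0 -natr1.
    by rewrite (le_trans b1)// lerDr.
  have E K : \sum_(j < K.+1) modulus (diff_coef b j) = 2 - cesaro_num (1 - b) K.
    elim: K => [|K IHK]; first by rewrite big_ord1 diff_coef0 modulus1 cesaro_num0; ring.
    rewrite big_ord_recr/= IHK modulus_diff_coef (ler0_norm (neg K)).
    have := cesaro_num_diff (- b) K; rewrite (addrC (- b) 1) => <-; ring.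
  case: N => [|N]; first by rewrite big_ord0.
  by rewrite E gerBl cesaro_num_ge0// subr_ge0.
exists (2 * M) => [|N]; first by rewrite mulr_ge0.
rewrite -natr1 addrA; case: N => [|N]; first by rewrite big_ord0 mulr_ge0.
set c := b + m%:R in IH *.
rewrite big_ord_recl/= diff_coef0 modulus1.
apply: (@le_trans _ _ (1 + \sum_(j < N) (modulus (diff_coef c j.+1) + modulus (diff_coef c j)))).
  rewrite lerD2l; apply: ler_sum => j _; rewrite /bump/= add1n diff_coefS.
  by rewrite (le_trans (modulusD _ _))// modulusN.
rewrite big_split/= addrA mulrDl mul1r; apply: lerD; last exact: IH.
by have := IH N.+1; rewrite big_ord_recl/= diff_coef0 modulus1.
Qed.

Lemma fdiff_abs_bound a f n M B : 0 <= B -> abs_bound M (diff_coef a) ->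
  (forall n, modulus (f n) <= B) ->
  abs_bound (M * B) (fun j => diff_coef a j * f (n + j)%N).
Proof.
move=> B0 hM fB N; apply: (@le_trans _ _ (\sum_(j < N) modulus (diff_coef a j) * B)).
  by apply: ler_sum => j _; rewrite modulusM; apply: ler_wpM2l => //; exact: modulus_ge0.
by rewrite -mulr_suml; apply: ler_wpM2r.
Qed.

End FracDiff.

(** * Fractional differences of Cesaro means *)

Section Intertwining.
Variable R : realType.
Implicit Types (a alpha B M : R) (beta : R[i]) (f u v : nat -> R[i]^o) (n i j l N : nat).

Lemma rcvgMl0 (c : R) (v : nat -> R) : v @ \oo --> (0 : R) -> (c * v n) @[n --> \oo] --> (0 : R).
Proof.
move=> h; have : (c * v n) @[n --> \oo] --> c * 0 by apply: cvgM => //; exact: cvg_cst.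
by rewrite mulr0.
Qed.

Lemma natr_powRN_cvg0 (s : R) : 0 < s -> (n.+1%:R `^ (- s)) @[n --> \oo] --> (0 : R).
Proof.
move=> s0; have := @powR_cvg0 R s s0; move/cvg_at_rightP => /(_ (@harmonic R)) h.
have -> : (fun n => n.+1%:R `^ (- s)) = (fun n => (@harmonic R n) `^ s).
  by apply/funext => n; rewrite /harmonic/= -powR_inv1// -powRrM mulN1r.
by apply: h; split; [move=> n; rewrite /harmonic/= invr_gt0|exact: cvg_harmonic].
Qed.

Lemma abs_bound_cvg0 M u : abs_bound M u -> (modulus (u n)) @[n --> \oo] --> (0 : R).
Proof.
move=> /abs_bound_cvg/csum_cvg_to0/ccvg_modulus; rewrite modulus0; exact.
Qed.

Lemma diff_coef_cvg0 alpha : 0 < alpha -> (modulus (diff_coef (alpha - 1) n)) @[n --> \oo] --> (0 : R).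
Proof.
move=> a0; case: (lerP 1 alpha) => a1.
  have a10 : 0 <= alpha - 1 by rewrite subr_ge0.
  by have [M _ /abs_bound_cvg0] := diff_coef_abs a10.
have h s : 0 <= s <= 1 -> 0 < s -> (modulus (diff_coef (s - 1) n)) @[n --> \oo] --> (0 : R).
  move=> s01 s0; have /andP[_ s1] := s01.
  apply: (squeeze_cvgr _ (cvg_cst 0) (natr_powRN_cvg0 s0)); near=> n.
  rewrite modulus_ge0 modulus_diff_coef opprB ger0_norm; first exact: cesaro_num_le_powR.
  by apply: cesaro_num_ge0; rewrite subr_ge0.
by apply: h; rewrite // !ltW.
Unshelve. all: by end_near. Qed.

Lemma diff_coefS_mul alpha n :
  n.+1%:R * diff_coef alpha n.+1 = (n%:R - alpha%:C) * diff_coef alpha n.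
Proof.
rewrite /diff_coef -!real_complex_natr -rmorphM/= cesaro_numS_mul -rmorphB -rmorphM/=.
by rewrite (addrC (- alpha)).
Qed.

Lemma natr_diff_coef alpha n : n.+1%:R * diff_coef alpha n.+1 = - alpha%:C * diff_coef (alpha - 1) n.
Proof.
rewrite /diff_coef -!real_complex_natr -rmorphM/= -cesaro_num_add1S -rmorphN -rmorphM/=.
by rewrite opprB (addrC 1).
Qed.

(** Removes the boundary terms of the telescoping sums in [fdiff_delta] and [X0_rec]. *)
Lemma natr_diff_coef_cvg0 alpha : 0 < alpha ->
  (modulus (n%:R * diff_coef alpha n)) @[n --> \oo] --> (0 : R).
Proof.
move=> a0; rewrite -(cvg_shiftS (fun n => modulus (n%:R * diff_coef alpha n))).
under eq_fun do rewrite natr_diff_coef modulusM.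
exact: (@rcvgMl0 _ (fun n => modulus (diff_coef (alpha - 1) n)) (diff_coef_cvg0 a0)).
Qed.

Lemma fdiff_lin alpha (c : R[i]^o) f u n : fdiff_cvg alpha f n -> fdiff_cvg alpha u n ->
  fdiff alpha (fun j => c * f j + u j) n = c * fdiff alpha f n + fdiff alpha u n.
Proof.
move=> hf hu; apply: csumP.
have -> : (fun N => \sum_(j < N) diff_coef alpha j * (c * f (n + j)%N + u (n + j)%N)) =
  (fun N => \sum_(j < N) (c * (diff_coef alpha j * f (n + j)%N) + diff_coef alpha j * u (n + j)%N)).
  by apply/funext => N; apply: eq_bigr => j _; rewrite mulrDr mulrCA.
exact: (@csum_lin R c (fun j => diff_coef alpha j * f (n + j)%N) (fun j => diff_coef alpha j * u (n + j)%N) hf hu).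
Qed.

Lemma eq_fdiff alpha f u : f =1 u -> fdiff alpha f =1 fdiff alpha u.
Proof. by move=> h n; apply: eq_csum => j; rewrite h. Qed.

Definition bounded_by B f : Prop := forall n, modulus (f n) <= B.

Lemma bounded_by_ge0 B f : bounded_by B f -> 0 <= B.
Proof. by move=> h; apply: le_trans (h 0%N); exact: modulus_ge0. Qed.

Lemma fdiff_bounded_cvg alpha B f n : 0 <= alpha -> bounded_by B f -> fdiff_cvg alpha f n.
Proof.
move=> a0 fB; have [M _ hM] := diff_coef_abs a0.
exact: abs_bound_cvg (fdiff_abs_bound n (bounded_by_ge0 fB) hM fB).
Qed.

Lemma fdiff_bounded alpha : 0 <= alpha -> exists2 M, 0 <= M &
  forall f B, bounded_by B f -> bounded_by (M * B) (fdiff alpha f).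
Proof.
move=> a0; have [M M0 hM] := diff_coef_abs a0; exists M => // f B fB n.
exact: csum_le (fdiff_abs_bound n (bounded_by_ge0 fB) hM fB).
Qed.

(** Split n + j + 1 as (n + 1 + alpha) + (j - alpha). Since (j - alpha) k^(-alpha)(j) = (j + 1)
    k^(-alpha)(j + 1), the second part telescopes against j u(n + j - 1), with boundary term N
    k^(-alpha)(N) u(n + N - 1). *)
Lemma fdiff_delta alpha B u n : 0 < alpha -> bounded_by B u ->
  fdiff alpha (delta 1 u) n = delta (1 + alpha%:C) (fdiff alpha u) n.
Proof.
move=> a0 uB; have B0 := bounded_by_ge0 uB; apply: csumP.
have c m : fdiff_cvg alpha u m := @fdiff_bounded_cvg alpha B u m (ltW a0) uB.
have -> : (fun N => \sum_(j < N) diff_coef alpha j * delta 1 u (n + j)%N) =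
  (fun N => ((n%:R + (1 + alpha%:C)) * (\sum_(j < N) diff_coef alpha j * u (n + j)%N)
   - n%:R * (\sum_(j < N) diff_coef alpha j * u (n.-1 + j)%N))
   + N%:R * diff_coef alpha N * u (n + N).-1) :> (nat -> R[i]^o).
  apply/funext; elim=> [|N IH]; first by rewrite !big_ord0 !mulr0 !mul0r subr0 addr0.
  rewrite !big_ord_recr/= IH diff_coefS_mul addnS/= /delta natrD.
  case: n {c IH} => [|n]; last by rewrite !addSn/=; ring.
  by case: N => [|N]; rewrite !add0n/=; ring.
rewrite -[delta _ _ _]addr0.
apply: (@ccvgD _ (fun N => (n%:R + (1 + alpha%:C)) * (\sum_(j < N) diff_coef alpha j * u (n + j)%N)
   - n%:R * (\sum_(j < N) diff_coef alpha j * u (n.-1 + j)%N))).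
  rewrite /delta; apply: (@ccvgB _ (fun N => (n%:R + (1 + alpha%:C)) * (\sum_(j < N) diff_coef alpha j * u (n + j)%N))
    (fun N => n%:R * (\sum_(j < N) diff_coef alpha j * u (n.-1 + j)%N))).
    exact: (@ccvgMl _ _ (fun N => \sum_(j < N) diff_coef alpha j * u (n + j)%N) _ (c n)).
  exact: (@ccvgMl _ _ (fun N => \sum_(j < N) diff_coef alpha j * u (n.-1 + j)%N) _ (c n.-1)).
apply: (@ccvg_le _ _ _ (fun N => modulus (N%:R * diff_coef alpha N) * B)).
  by move=> N; rewrite subr0 modulusM; apply: ler_wpM2l; [exact: modulus_ge0|exact: uB].
under eq_fun do rewrite mulrC.
exact: (@rcvgMl0 _ (fun n => modulus (n%:R * diff_coef alpha n)) (natr_diff_coef_cvg0 a0)).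
Qed.

Lemma cesaro_opE beta f : cesaro_op beta f =1 beta_mean 1 beta f.
Proof.
move=> n; rewrite /cesaro_op /beta_mean big_mkord mulr_sumr; apply: eq_bigr => j _.
have jn : (j <= n)%N by rewrite -ltnS.
rewrite (beta_kernel1E' _ jn) (addrC 1 beta).
by move: (cesaro_num _ _) (cesaro_num _ _) => x y; rewrite mulrA (mulrC y^-1).
Qed.

End Intertwining.

Section CesaroIntertwining.
Variable R : realType.
Implicit Types (B M : R) (f u v : nat -> R[i]^o) (n i j l N : nat).
Variables (alpha : R) (beta : R[i]).
Hypotheses (alpha_gt0 : 0 < alpha) (Rebeta_gt0 : 0 < complex.Re beta).

Let a1 : R[i] := 1 + alpha%:C.
Let CB : R := modulus beta / complex.Re beta.

Let CB0 : 0 <= CB. Proof. by rewrite divr_ge0 ?modulus_ge0// ltW. Qed.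

Lemma one_addn_neq0 n : 1 + beta + n%:R != 0.
Proof.
have -> : 1 + beta + n%:R = beta + n.+1%:R by rewrite -natr1; ring.
exact: Re_gt0_neq0.
Qed.

Lemma alpha_addn_neq0 n : 1 + alpha%:C + beta + n%:R != 0.
Proof.
have -> : 1 + alpha%:C + beta + n%:R = (beta + alpha%:C) + n.+1%:R by rewrite -natr1; ring.
by apply: Re_gt0_neq0; rewrite raddfD/= addr_gt0.
Qed.

Lemma beta_mean_modulus_le f n : modulus (beta_mean 1 beta f n) <=
  CB * \sum_(j < n.+1) beta_kernel 1 (complex.Re beta) n j * modulus (f j).
Proof.
rewrite (le_trans (modulus_sum _ _ _))// mulr_sumr; apply: ler_sum => j _.
rewrite modulusM mulrA; apply: ler_wpM2r; first exact: modulus_ge0.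
exact: modulus_beta_kernel1_le.
Qed.

Lemma beta_mean_bounded B f : bounded_by B f -> bounded_by (CB * B) (beta_mean 1 beta f).
Proof.
move=> fB n; apply: (le_trans (beta_mean_modulus_le f n)); apply: ler_wpM2l => //.
apply: (@le_trans _ _ (\sum_(j < n.+1) beta_kernel 1 (complex.Re beta) n j * B)).
  by apply: ler_sum => j _; apply: ler_wpM2l => //; exact: beta_kernel_ge0.
by rewrite -mulr_suml beta_kernel_row_sum// mul1r.
Qed.

Definition unit_seq i : nat -> R[i]^o := fun n => (n == i)%:R.

Lemma unit_seq_bounded i : bounded_by 1 (unit_seq i).
Proof. by move=> n; rewrite /unit_seq; case: eqP => _; rewrite ?modulus1// modulus0. Qed.

Lemma delta_unit_seq i n : delta 1 (unit_seq i) n = i.+1%:R * unit_seq i n - i.+1%:R * unit_seq i.+1 n.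
Proof.
rewrite /delta /unit_seq; case: n => [|n].
  by rewrite /= !mul0r add0r mulr0 !subr0; case: i => [|i]; rewrite ?mulr1 ?mulr0 ?mul1r.
rewrite /= eqSS; case: (eqVneq n i) => [->|ni].
  by rewrite gtn_eqF// !mulr0.
by case: (eqVneq n.+1 i) => [<-|_]; rewrite ?mulr0 ?mulr1 -?natr1; ring.
Qed.

Lemma beta_mean_unit_seq i n : beta_mean 1 beta (unit_seq i) n = beta_kernel 1 beta n i.
Proof.
rewrite /beta_mean /unit_seq; case: (leqP i n) => [le_in|lt_ni]; last first.
  rewrite beta_kernel_gt// big1// => j _; rewrite ltn_eqF ?mulr0//.
  by apply: leq_ltn_trans lt_ni; rewrite -ltnS.
have i1 : (i < n.+1)%N by [].
rewrite (bigD1 (Ordinal i1))//= eqxx mulr1 big1 ?addr0// => j ji.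
rewrite (_ : (j == i :> nat) = false) ?mulr0//; apply/negbTE.
by apply: contra ji => /eqP ji; apply/eqP/val_inj.
Qed.

Let X i : nat -> R[i]^o := fdiff alpha (beta_mean 1 beta (unit_seq i)).
(** Chosen so that both recursions start from the same value at (0, 0). It equals beta B(beta, alpha
    + 1); the estimates use only its modulus. *)
Definition kappa : R[i] := X 0 0.
Let Y i : nat -> R[i]^o := fun n => kappa * beta_mean a1 beta (fdiff alpha (unit_seq i)) n.

Let Xb i : bounded_by (CB * 1) (beta_mean 1 beta (unit_seq i)).
Proof. exact/beta_mean_bounded/unit_seq_bounded. Qed.

Let rec_lin (F : nat -> nat -> R[i]^o) : (forall i, bounded_by CB (F i)) ->
  (forall i n, delta 1 (F i) n = i.+1%:R * F i n - i.+1%:R * F i.+1 n) ->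
  forall i n, i.+1%:R * (fdiff alpha (F i) n - fdiff alpha (F i.+1) n) =
     delta a1 (fdiff alpha (F i)) n.
Proof.
move=> Fb hF i n; rewrite -(fdiff_delta _ alpha_gt0 (Fb i)).
have cv k m : fdiff_cvg alpha (F k) m := @fdiff_bounded_cvg _ _ _ _ m (ltW alpha_gt0) (Fb k).
have cv0 k (c : R[i]^o) m : fdiff_cvg alpha (fun j => c * F k j) m.
  apply: (@fdiff_bounded_cvg _ _ (modulus c * CB)); first exact: ltW.
  by move=> j; rewrite modulusM; apply: ler_wpM2l; [exact: modulus_ge0|exact: Fb].
have E : delta 1 (F i) =1 (fun j => i.+1%:R * F i j + (- i.+1%:R) * F i.+1 j).
  by move=> j; rewrite hF mulNr.
have fz k (c : R[i]^o) m : fdiff alpha (fun j => c * F k j) m = c * fdiff alpha (F k) m.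
  have -> : (fun j => c * F k j) = (fun j => (c - 1) * F k j + F k j).
    by apply/funext => j; ring.
  by rewrite fdiff_lin//; ring.
by rewrite (eq_fdiff alpha E) fdiff_lin// fz; ring.
Qed.

Let X_rec i n : i.+1%:R * (X i n - X i.+1 n) = delta a1 (X i) n.
Proof.
apply: (rec_lin (F := fun i => beta_mean 1 beta (unit_seq i))) => {i n}.
  by move=> i; rewrite -[CB]mulr1; exact: Xb.
move=> i n; rewrite -beta_mean_delta; last exact: one_addn_neq0.
rewrite /beta_mean !mulr_sumr -sumrB; apply: eq_bigr => j _.
by rewrite delta_unit_seq; ring.
Qed.

Let Y_rec i n : i.+1%:R * (Y i n - Y i.+1 n) = delta a1 (Y i) n.
Proof.
have h : forall i n, i.+1%:R * (fdiff alpha (unit_seq i) n - fdiff alpha (unit_seq i.+1) n) =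
     delta a1 (fdiff alpha (unit_seq i)) n.
  move=> {}i {}n; rewrite -(fdiff_delta _ alpha_gt0 (unit_seq_bounded i)).
  have cv k m : fdiff_cvg alpha (unit_seq k) m := @fdiff_bounded_cvg _ _ _ _ m (ltW alpha_gt0) (unit_seq_bounded k).
  have fz k (c : R[i]^o) m : fdiff alpha (fun j => c * unit_seq k j) m = c * fdiff alpha (unit_seq k) m.
    have -> : (fun j => c * unit_seq k j) = (fun j => (c - 1) * unit_seq k j + unit_seq k j).
      by apply/funext => j; ring.
    by rewrite fdiff_lin//; ring.
  have E : delta 1 (unit_seq i) =1 (fun j => i.+1%:R * unit_seq i j + (- i.+1%:R) * unit_seq i.+1 j).
    by move=> j; rewrite delta_unit_seq mulNr.
  rewrite (eq_fdiff alpha E) fdiff_lin// ?fz; first by ring.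
  apply: (@fdiff_bounded_cvg _ _ (modulus (- i.+1%:R : R[i]^o) * 1)); first exact: ltW.
  by move=> j; rewrite modulusM; apply: ler_wpM2l; [exact: modulus_ge0|exact: unit_seq_bounded].
have -> : delta a1 (Y i) n = kappa * delta a1 (beta_mean a1 beta (fdiff alpha (unit_seq i))) n.
  by rewrite /delta /Y; ring.
rewrite -beta_mean_delta; last exact: alpha_addn_neq0.
rewrite /Y -mulrBr mulrCA; congr (_ * _).
rewrite /beta_mean -sumrB mulr_sumr; apply: eq_bigr => j _.
by rewrite -h; ring.
Qed.

Lemma beta_kernel1_col0 n : beta_kernel 1 beta n 0 = beta / (beta + n%:R).
Proof.
rewrite beta_kernel1E'// subn0.
have kn0 : cesaro_num (1 + beta) n != 0 by apply: cesaro_num_neq0; exact: one_addn_neq0.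
apply/eqP; rewrite eqr_div ?Re_gt0_neq0//.
by rewrite (addrC 1 beta) cesaro_num_add1 mulrC.
Qed.

(** Column 0 of the kernel is beta / (beta + n), so X 0 n is beta B(beta + n, alpha + 1), and this
    is the functional equation of B. Here it comes from partial sums that telescope to -beta N
    k^(-alpha)(N) / (beta + n + N). *)
Let X0_rec n : (beta + n%:R + a1) * X 0 n.+1 = (beta + n%:R) * X 0 n.
Proof.
have b0 m : beta + m%:R != 0 by exact: Re_gt0_neq0.
set c0 := beta_mean 1 beta (unit_seq 0).
have c0E m : c0 m = beta / (beta + m%:R) by rewrite /c0 beta_mean_unit_seq beta_kernel1_col0.
have cv m : fdiff_cvg alpha c0 m by exact: (@fdiff_bounded_cvg _ _ _ _ m (ltW alpha_gt0) (Xb 0)).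
apply/eqP; rewrite -subr_eq0; apply/eqP.
have L : ((beta + n%:R + a1) * (\sum_(j < N) diff_coef alpha j * c0 (n.+1 + j)%N) -
   (beta + n%:R) * (\sum_(j < N) diff_coef alpha j * c0 (n + j)%N)) @[N --> \oo] -->
  ((beta + n%:R + a1) * X 0 n.+1 - (beta + n%:R) * X 0 n : R[i]^o).
  apply: (@ccvgB _ (fun N => (beta + n%:R + a1) * (\sum_(j < N) diff_coef alpha j * c0 (n.+1 + j)%N))
    (fun N => (beta + n%:R) * (\sum_(j < N) diff_coef alpha j * c0 (n + j)%N))).
    exact: (@ccvgMl _ _ (fun N => \sum_(j < N) diff_coef alpha j * c0 (n.+1 + j)%N) _ (cv n.+1)).
  exact: (@ccvgMl _ _ (fun N => \sum_(j < N) diff_coef alpha j * c0 (n + j)%N) _ (cv n)).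
apply: (ccvg_unique L).
have -> : (fun N => ((beta + n%:R + a1) * (\sum_(j < N) diff_coef alpha j * c0 (n.+1 + j)%N) -
   (beta + n%:R) * (\sum_(j < N) diff_coef alpha j * c0 (n + j)%N))) =
   (fun N => - beta * ((N%:R * diff_coef alpha N) / (beta + (n + N)%:R))).
  apply/funext; elim=> [|N IH]; first by rewrite !big_ord0 !mulr0 subrr mul0r mul0r mulr0.
  rewrite !big_ord_recr/= !mulrDr opprD addrACA IH diff_coefS_mul !c0E addSn addnS.
  have := b0 (n + N)%N; have := b0 (n + N).+1%N; rewrite -natr1 natrD /a1.
  move: (diff_coef alpha N) (n%:R : R[i]) (N%:R : R[i]) alpha%:C => d x y a h1 h2.
  by field; rewrite h2 -!addrA in h1 *; rewrite h1.
apply: (@ccvg_le _ _ _ (fun N => modulus beta / complex.Re beta * modulus (N%:R * diff_coef alpha N))); last first.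
  exact: (@rcvgMl0 _ _ (fun N => modulus (N%:R * diff_coef alpha N)) (natr_diff_coef_cvg0 alpha_gt0)).
move=> N; rewrite subr0 (modulusM (- beta)) modulusN -[leRHS]mulrA; apply: ler_wpM2l; first exact: modulus_ge0.
rewrite [leLHS]modulusM mulrC modulusV; apply: ler_wpM2r; first exact: modulus_ge0.
have h := Re_le_modulus_addn beta (n + N).
have h2 : complex.Re beta <= complex.Re beta + (n + N)%:R by rewrite lerDl.
by rewrite lef_pV2 ?posrE// (le_trans h2 h, lt_le_trans Rebeta_gt0 (le_trans h2 h)).
Qed.

Let XY0 n : X 0 n = Y 0 n.
Proof.
(* W^alpha only looks forward, so it fixes the unit sequence at 0. *)
have g0 l : fdiff alpha (unit_seq 0) l = (l == 0%N)%:R.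
  rewrite /fdiff; case: l => [|l].
    rewrite -[RHS](_ : (if true then 1 else 0) = _)//.
    apply: csumP; have -> : (fun N => \sum_(j < N) diff_coef alpha j * unit_seq 0 (0 + j)%N) =
      (fun N => \sum_(j < N) (if (j : nat) == 0%N then 1 else 0)).
      apply/funext => N; apply: eq_bigr => j _; rewrite add0n /unit_seq.
      by case: eqP => [->|_]; rewrite ?mulr0// diff_coef0 mul1r.
    exact: csum_delta.
  apply: csumP; have -> : (fun N => \sum_(j < N) diff_coef alpha j * unit_seq 0 (l.+1 + j)%N) = (fun=> 0).
    by apply/funext => N; rewrite big1// => j _; rewrite addSn mulr0.
  exact: ccvg_cst.
have -> : Y 0 n = kappa * beta_kernel a1 beta n 0.
  rewrite /Y; congr (_ * _); rewrite -beta_kernel_col; last exact: alpha_addn_neq0.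
  by apply: eq_beta_mean => l _; rewrite g0.
elim: n => [|n IH].
  by rewrite /beta_kernel/= !cesaro_num0 mul1r divr1 mulr1.
have nz : beta + n%:R + a1 != 0.
  by rewrite addrC addrA; exact: alpha_addn_neq0.
apply: (mulfI nz); rewrite X0_rec IH /beta_kernel/= !subn0 !cesaro_num0 !mul1r.
have k0 : cesaro_num (a1 + beta) n != 0 by apply: cesaro_num_neq0; exact: alpha_addn_neq0.
have n0 : (n.+1%:R : R[i]) != 0 by rewrite pnatr_eq0.
rewrite !cesaro_numS.
move: (cesaro_num beta n) (cesaro_num (a1 + beta) n) k0 n0 => x y y0 n0.
have -> : a1 + beta + n%:R = beta + n%:R + a1 by ring.
move: (beta + n%:R) nz n0; move: (n.+1%:R : R[i]) kappa a1 => z k c b nz n0.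
by field; rewrite y0 n0 nz.
Qed.

Let XY i : X i =1 Y i.
Proof. by apply: delta_col_uniq (X_rec) (Y_rec) i => n; exact: XY0. Qed.

Lemma fdiff_beta_mean f n : f @ \oo --> (0 : R[i]^o) ->
  fdiff alpha (beta_mean 1 beta f) n = kappa * beta_mean a1 beta (fdiff alpha f) n.
Proof.
move=> f0.
have [M M0 hM] := fdiff_bounded (ltW alpha_gt0).
have bT (g : nat -> R[i]^o) B : bounded_by B g ->
   modulus (fdiff alpha (beta_mean 1 beta g) n) <= M * (CB * B).
  by move=> gB; apply: hM; exact: beta_mean_bounded.
pose K := \sum_(l < n.+1) modulus (beta_kernel a1 beta n l).
have K0 : 0 <= K by rewrite sumr_ge0// => l _; exact: modulus_ge0.
have bS (g : nat -> R[i]^o) B : bounded_by B g ->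
   modulus (kappa * beta_mean a1 beta (fdiff alpha g) n) <= modulus kappa * (K * (M * B)).
  move=> gB; rewrite modulusM; apply: ler_wpM2l; first exact: modulus_ge0.
  rewrite (le_trans (modulus_sum _ _ _))// mulr_suml; apply: ler_sum => l _.
  by rewrite modulusM; apply: ler_wpM2l; [exact: modulus_ge0|exact: hM].
have cvT (g : nat -> R[i]^o) B m : bounded_by B g -> fdiff_cvg alpha (beta_mean 1 beta g) m.
  by move=> gB; apply: (@fdiff_bounded_cvg _ _ _ _ _ (ltW alpha_gt0) (beta_mean_bounded gB)).
have cvg' (g : nat -> R[i]^o) B m : bounded_by B g -> fdiff_cvg alpha g m.
  by move=> gB; apply: (@fdiff_bounded_cvg _ _ _ _ _ (ltW alpha_gt0) gB).
have linT (c : R[i]^o) g g' B B' : bounded_by B g -> bounded_by B' g' ->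
   fdiff alpha (beta_mean 1 beta (fun j => c * g j + g' j)) n =
   c * fdiff alpha (beta_mean 1 beta g) n + fdiff alpha (beta_mean 1 beta g') n.
  move=> gB gB'; rewrite -fdiff_lin; [|exact: cvT gB|exact: cvT gB'].
  by apply: eq_fdiff => m; exact: beta_mean_lin.
have linS (c : R[i]^o) g g' B B' : bounded_by B g -> bounded_by B' g' ->
   kappa * beta_mean a1 beta (fdiff alpha (fun j => c * g j + g' j)) n =
   c * (kappa * beta_mean a1 beta (fdiff alpha g) n) + kappa * beta_mean a1 beta (fdiff alpha g') n.
  move=> gB gB'; rewrite mulrCA -mulrDr -beta_mean_lin; congr (_ * _).
  by apply: eq_beta_mean => m _; apply: fdiff_lin; [exact: cvg' gB|exact: cvg' gB'].
pose t N : nat -> R[i]^o := fun j => if (j < N)%N then f j else 0.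
have [B fB] : exists B, bounded_by B f.
  have /ccvg_modulus h := f0; rewrite modulus0 in h.
  have : bounded_fun (fun n => modulus (f n)) by apply: cvg_seq_bounded; apply: cvgP h.
  move=> [B0 [_ hB]]; exists (B0 + 1) => m.
  have := hB (B0 + 1); rewrite ltrDl ltr01 => /(_ isT m I) /=.
  by rewrite ger0_norm ?modulus_ge0.
have B0 := bounded_by_ge0 fB.
have tB N : bounded_by B (t N).
  by move=> m; rewrite /t; case: ifP => // _; rewrite modulus0.
have tE N : fdiff alpha (beta_mean 1 beta (t N)) n = kappa * beta_mean a1 beta (fdiff alpha (t N)) n.
  elim: N => [|N IH].
    have z : bounded_by 0 (t 0%N) by move=> m; rewrite /t ltn0 modulus0.
    have z1 := bT _ _ z; have z2 := bS _ _ z; rewrite !mulr0 in z1 z2.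
    rewrite [LHS]modulus_eq0 ?[RHS]modulus_eq0//; apply/eqP; rewrite eq_le modulus_ge0 ?z1 ?z2//.
  have -> : t N.+1 = (fun j => f N * unit_seq N j + t N j).
    apply/funext => j; rewrite /t /unit_seq ltnS; case: (ltngtP j N) => [_|_|->].
    - by rewrite mulr0 add0r.
    - by rewrite mulr0 addr0.
    - by rewrite mulr1 addr0.
  rewrite (linT _ _ _ _ _ (unit_seq_bounded N) (tB N)) (linS _ _ _ _ _ (unit_seq_bounded N) (tB N)) IH.
  by congr (_ * _ + _); exact: XY.
(* [Q] bounds the two sides together, at this n, against the sup norm. As f is in c_0, its remainder
   [r] after a long truncation is uniformly at most e / (Q + 1). *)
pose Q := M * CB + modulus kappa * (K * M).
have Q0 : 0 <= Q by apply: addr_ge0; apply: mulr_ge0 => //; [exact: modulus_ge0|exact: mulr_ge0].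
apply/eqP; rewrite -subr_eq0; apply/eqP/modulus_eq0/eqP; rewrite eq_le modulus_ge0 andbT.
apply/ler_addgt0Pl => e e0; rewrite addr0.
have e1 : 0 < e / (Q + 1) by rewrite divr_gt0// ltr_wpDl.
move/ccvgP/cvgrPdist_le : f0 => /(_ _ e1) [N _ hN].
pose r : nat -> R[i]^o := fun j => (-1) * t N j + f j.
have rB : bounded_by (e / (Q + 1)) r.
  move=> j; rewrite /r /t mulN1r; case: ifPn => jN.
    by rewrite addNr modulus0 ltW.
  rewrite oppr0 add0r; have := hN j; rewrite /= leqNgt jN => /(_ isT).
  by rewrite sub0r normrN subr0 ger0_norm ?modulus_ge0.
have := linT (-1) _ _ _ _ (tB N) fB; have := linS (-1) _ _ _ _ (tB N) fB.
rewrite -/r tE => h1 h2.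
have -> : fdiff alpha (beta_mean 1 beta f) n - kappa * beta_mean a1 beta (fdiff alpha f) n =
  fdiff alpha (beta_mean 1 beta r) n - kappa * beta_mean a1 beta (fdiff alpha r) n.
  by rewrite h1 h2; ring.
rewrite (le_trans (modulusD _ _))// modulusN.
apply: (@le_trans _ _ (Q * (e / (Q + 1)))).
  rewrite /Q mulrDl; apply: lerD.
    by rewrite -mulrA; exact: bT.
  by rewrite -!mulrA; exact: bS.
rewrite mulrCA ger_pMr// ler_pdivrMr ?mul1r; first by rewrite lerDl.
by rewrite ltr_wpDl.
Qed.

End CesaroIntertwining.

(** * Decay, definedness and weighted bounds for Cesaro means *)

Section CesaroTau.
Variable R : realType.
Implicit Types (B M s C : R) (f u v : nat -> R[i]^o) (n i j l N : nat).
Variable beta : R[i].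
Hypothesis Rebeta_gt0 : 0 < complex.Re beta.
Let b := complex.Re beta.
Let CB : R := modulus beta / complex.Re beta.
Let CB0 : 0 <= CB. Proof. by rewrite divr_ge0 ?modulus_ge0// ltW. Qed.

Lemma powRN_powR (n : nat) s : (n.+1%:R : R) `^ (- s) * n.+1%:R `^ s = 1.
Proof. by rewrite -powRD ?addNr ?powRr0// pnatr_eq0 implybT. Qed.

(* The values with j < N are absorbed by a faster decaying power. *)
Lemma beta_mean_little_o s f : 0 <= s < 1 ->
  (n.+1%:R `^ s * modulus (f n)) @[n --> \oo] --> (0 : R) ->
  (n.+1%:R `^ s * modulus (beta_mean 1 beta f n)) @[n --> \oo] --> (0 : R).
Proof.
move=> s01 fs; have /andP[s0 s1] := s01.
pose t := (s + 1) / 2.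
have t01 : 0 <= t < 1 by rewrite /t; apply/andP; split; lra.
have st : 0 < t - s by rewrite /t; lra.
pose Cs : R := (b + 1) `^ s / (1 - s); pose Ct : R := (b + 1) `^ t / (1 - t).
have Cs0 : 0 <= Cs by apply: divr_ge0; [exact: powR_ge0|lra].
have Ct0 : 0 <= Ct by case/andP: t01 => _ t1; apply: divr_ge0; [exact: powR_ge0|lra].
apply/cvgrPdist_le => e e0.
pose e1 := e / 2 / (CB * Cs + 1).
have c1 : 0 < CB * Cs + 1 by rewrite ltr_wpDl// mulr_ge0.
have e10 : 0 < e1 by apply: divr_gt0 => //; exact: divr_gt0.
move/cvgrPdist_le : fs => /(_ _ e10) [N _ hN].
pose K := \sum_(j < N) modulus (f j) * j.+1%:R `^ t.
have K0 : 0 <= K by rewrite sumr_ge0// => j _; rewrite mulr_ge0 ?modulus_ge0 ?powR_ge0.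
have fle j : modulus (f j) <= e1 * j.+1%:R `^ (- s) + K * j.+1%:R `^ (- t).
  case: (leqP N j) => [Nj|jN].
    apply: ler_wpDr; first by rewrite mulr_ge0 ?powR_ge0.
    have := hN j Nj; rewrite /= sub0r normrN ger0_norm; last by rewrite mulr_ge0 ?modulus_ge0 ?powR_ge0.
    by move=> h; rewrite powRN ler_pdivlMr ?powR_gt0// mulrC.
  apply: ler_wpDl; first by rewrite mulr_ge0 ?powR_ge0// ltW.
  rewrite powRN ler_pdivlMr ?powR_gt0// /K (bigD1 (Ordinal jN))//= lerDl.
  by rewrite sumr_ge0// => i _; rewrite mulr_ge0 ?modulus_ge0 ?powR_ge0.
have mle n : modulus (beta_mean 1 beta f n) <= CB * (e1 * (Cs * n.+1%:R `^ (- s)) + K * (Ct * n.+1%:R `^ (- t))).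
  apply: (le_trans (beta_mean_modulus_le Rebeta_gt0 f n)); apply: ler_wpM2l => //.
  apply: (@le_trans _ _ (\sum_(j < n.+1) beta_kernel 1 b n j * (e1 * j.+1%:R `^ (- s) + K * j.+1%:R `^ (- t)))).
    by apply: ler_sum => j _; apply: ler_wpM2l; [exact: beta_kernel_ge0|exact: fle].
  under eq_bigr => j _ do rewrite mulrDr mulrCA (mulrCA _ K).
  rewrite big_split/= -!mulr_sumr; apply: lerD; apply: ler_wpM2l => //.
  - exact: ltW.
  - exact: beta_kernel1_row_powR.
  - exact: beta_kernel1_row_powR.
have e2 : 0 < e / 2 / (CB * K * Ct + 1).
  by apply: divr_gt0; [exact: divr_gt0|rewrite ltr_wpDl// mulr_ge0// mulr_ge0].
have := @natr_powRN_cvg0 R _ st; move/cvgrPdist_le => /(_ _ e2).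
apply: filterS => n; rewrite !sub0r !normrN ger0_norm ?powR_ge0// => h.
rewrite ger0_norm; last by rewrite mulr_ge0 ?modulus_ge0 ?powR_ge0.
apply: le_trans (ler_wpM2l (powR_ge0 _ _) (mle n)) _.
have E1 := powRN_powR n s.
have E2 : (n.+1%:R : R) `^ (- t) * n.+1%:R `^ s = n.+1%:R `^ (- (t - s)).
  by rewrite -powRD ?pnatr_eq0 ?implybT// opprB addrC.
have -> : n.+1%:R `^ s * (CB * (e1 * (Cs * n.+1%:R `^ (- s)) + K * (Ct * n.+1%:R `^ (- t)))) =
  CB * Cs * e1 * (n.+1%:R `^ (- s) * n.+1%:R `^ s) + CB * K * Ct * (n.+1%:R `^ (- t) * n.+1%:R `^ s) by ring.
rewrite E1 E2 mulr1 [leRHS](splitr e); apply: lerD.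
  by rewrite /e1 mulrCA ger_pMr ?divr_gt0// ler_pdivrMr// mul1r lerDl.
have q0 : 0 <= CB * K * Ct by rewrite mulr_ge0// mulr_ge0.
apply: le_trans (ler_wpM2l q0 h) _.
rewrite mulrCA ger_pMr ?divr_gt0// ler_pdivrMr ?mul1r ?lerDl//.
by rewrite ltr_wpDl.
Qed.

Lemma beta_mean_cvg0 f : f @ \oo --> (0 : R[i]^o) -> beta_mean 1 beta f @ \oo --> (0 : R[i]^o).
Proof.
move=> /ccvgP h; apply/ccvgP.
have e (g : nat -> R[i]^o) : (fun n => modulus (g n - 0)) = (fun n => n.+1%:R `^ 0 * modulus (g n)).
  by apply/funext => n; rewrite powRr0 mul1r subr0.
rewrite e; apply: beta_mean_little_o; first by rewrite lexx ltr01.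
by rewrite -e.
Qed.

Lemma cvg0_bounded f : f @ \oo --> (0 : R[i]^o) -> exists B, bounded_by B f.
Proof.
move=> /ccvg_modulus h; rewrite modulus0 in h.
have : bounded_fun (fun n => modulus (f n)) by apply: cvg_seq_bounded; apply: cvgP h.
move=> [B0 [_ hB]]; exists (B0 + 1) => m.
have := hB (B0 + 1); rewrite ltrDl ltr01 => /(_ isT m I) /=.
by rewrite ger0_norm ?modulus_ge0.
Qed.

Section Definedness.
Variable d : R.
Hypotheses (d0 : 0 < d) (d1 : d < 1).
Local Notation k := (@cesaro_num R).

(** From d k^(d+1)(n) = (d + n) k^d(n) and the power bound for k^d. *)
Lemma cesaro_num1D_le n : k (d + 1) n <= d^-1 * n.+1%:R `^ d.
Proof.
have [d0' d1'] := (d0, d1).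
rewrite mulrC ler_pdivlMr// mulrC cesaro_num_add1.
have h : k (1 - (1 - d)) n <= n.+1%:R `^ (- (1 - d)) by apply: cesaro_num_le_powR; apply/andP; split; lra.
rewrite subKr in h.
have -> : (n.+1%:R : R) `^ d = n.+1%:R * n.+1%:R `^ (- (1 - d)).
  by rewrite -{2}(powRr1 (ler0n R n.+1)) -powRD ?pnatr_eq0 ?implybT//; congr (_ `^ _); ring.
apply: ler_pM => //; [by rewrite addr_ge0// ltW|by apply: cesaro_num_ge0; exact: ltW|].
by rewrite -natr1 addrC lerD2l ltW.
Qed.

Lemma cesaro_num1D_ge n : d * n.+1%:R `^ d <= k (d + 1) n.
Proof.
have [d0' d1'] := (d0, d1).
rewrite -(ler_pM2l d0) cesaro_num_add1.
have h : (1 - (1 - d)) * n.+1%:R `^ (- (1 - d)) <= k (1 - (1 - d)) n by apply: cesaro_num_ge_powR; apply/andP; split; lra.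
rewrite subKr in h.
have -> : (n.+1%:R : R) `^ d = n.+1%:R * n.+1%:R `^ (- (1 - d)).
  by rewrite -{2}(powRr1 (ler0n R n.+1)) -powRD ?pnatr_eq0 ?implybT//; congr (_ `^ _); ring.
rewrite (_ : d * (d * (n.+1%:R * _)) = (d * n.+1%:R) * (d * n.+1%:R `^ (- (1 - d)))); last by ring.
apply: ler_pM; [by rewrite mulr_ge0// ltW|by rewrite mulr_ge0 ?powR_ge0// ltW| |exact: h].
by rewrite -natr1 mulrDr mulr1 addrC lerD2l ler_piMl// ltW.
Qed.

(** [t] is the mean of f with weights k^d, so delta_d t, that is [delta 1 t] plus (d - 1) t, equals
    d f. The Cesaro mean commutes with [delta 1], hence with this operation and with the weighted
    mean that inverts it. *)
Lemma psum_beta_mean f N :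
  let s := fun i => \sum_(l < i.+1) diff_coef (- d) l * f l in
  let t := fun i => s i / (k (d + 1) i)%:C in
  \sum_(j < N.+1) diff_coef (- d) j * beta_mean 1 beta f j =
  (k (d + 1) N)%:C * beta_mean 1 beta t N.
Proof.
have [d0' d1'] := (d0, d1).
move=> s t.
have kp i : 0 < k (d + 1) i by apply: cesaro_num_gt0; lra.
have kc0 i : ((k (d + 1) i)%:C : R[i]) != 0 by rewrite eq_complex/= negb_and (gt_eqF (kp i)).
have kd0 i : (diff_coef (- d) i) != 0.
  by rewrite /diff_coef opprK eq_complex/= negb_and (gt_eqF (cesaro_num_gt0 i d0)).
have dc0 : (d%:C : R[i]) != 0 by rewrite eq_complex/= negb_and (gt_eqF d0).
have r1 i : d%:C * (k (d + 1) i)%:C = (i%:R + d%:C) * diff_coef (- d) i.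
  by rewrite /diff_coef opprK -real_complex_natr -rmorphD -!rmorphM/= cesaro_num_add1 addrC.
have r2 i : d%:C * (k (d + 1) i)%:C = i.+1%:R * diff_coef (- d) i.+1.
  by rewrite /diff_coef opprK -real_complex_natr -!rmorphM/= cesaro_num_add1S.
have r3 (T : nat -> R[i]^o) i : diff_coef (- d) i * (delta 1 T i + (d%:C - 1) * T i) =
   d%:C * ((k (d + 1) i)%:C * T i - (if i is i'.+1 then (k (d + 1) i')%:C * T i' else 0)).
  rewrite /delta; case: i => [|i].
    by rewrite subr0 mulrA r1; ring.
  by rewrite /= mulrBr !mulrA r1 r2; ring.
have fE i : d%:C * f i = delta 1 t i + (d%:C - 1) * t i.
  apply: (mulfI (kd0 i)); rewrite r3 /t mulrCA; congr (_ * _).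
  rewrite mulrCA divff// mulr1; case: i => [|i]; first by rewrite /s big_ord1 subr0.
  by rewrite mulrCA divff// mulr1 /s [in RHS]big_ord_recr/= addrAC subrr add0r.
have E j : d%:C * (diff_coef (- d) j * beta_mean 1 beta f j) =
   d%:C * ((k (d + 1) j)%:C * beta_mean 1 beta t j - (if j is j'.+1 then (k (d + 1) j')%:C * beta_mean 1 beta t j' else 0)).
  rewrite -r3 mulrCA; congr (_ * _).
  rewrite -beta_mean_delta; last exact: one_addn_neq0.
  rewrite /beta_mean !mulr_sumr -big_split/=; apply: eq_bigr => l _.
  by rewrite mulrCA fE; ring.
elim: N => [|N IH]; first by rewrite big_ord1; apply: (mulfI dc0); rewrite E subr0.
by rewrite big_ord_recr/= IH; apply: (mulfI dc0); rewrite mulrDr E; ring.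
Qed.

(** Subtracting the sum of the series at index 0 (the sequence [f']) makes the partial sums [s] tend
    to 0, so the weighted means [t] are o(n^-d). Their Cesaro means decay as fast by
    [beta_mean_little_o], which beats the factor k^(d+1) in [psum_beta_mean]. The subtracted unit
    sequence is covered by the absolute column bound. *)
Lemma fdiff_cvg_beta_mean0 f : fdiff_cvg (- d) f 0 -> fdiff_cvg (- d) (beta_mean 1 beta f) 0.
Proof.
have [d0' d1'] := (d0, d1).
move=> hf; set sf := fdiff (- d) f 0.
pose f' : nat -> R[i]^o := fun n => - sf * unit_seq R 0 n + f n.
pose s := fun i => \sum_(l < i.+1) diff_coef (- d) l * f' l.
pose t : nat -> R[i]^o := fun i => s i / (k (d + 1) i)%:C.
have kp i : 0 < k (d + 1) i by apply: cesaro_num_gt0; lra.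
have mk i : modulus (k (d + 1) i)%:C = k (d + 1) i by rewrite modulusR gtr0_norm.
have sE i : s i = \sum_(l < i.+1) diff_coef (- d) l * f l - sf.
  rewrite /s; under eq_bigr => l _ do rewrite /f' mulrDr.
  rewrite big_split/= addrC; congr (_ + _).
  rewrite big_ord_recl/= /unit_seq/= mulr1 diff_coef0 mul1r big1 ?addr0// => l _.
  by rewrite mulr0 mulr0.
have s0 : (modulus (s n)) @[n --> \oo] --> (0 : R).
  have h : (fun N => \sum_(l < N.+1) diff_coef (- d) l * f l) @ \oo --> sf.
    exact: (@ccvg_shiftS _ (fun N => \sum_(l < N) diff_coef (- d) l * f l) _ hf).
  by move/ccvgP : h; under eq_fun do rewrite -sE.
have t0 : (n.+1%:R `^ d * modulus (t n)) @[n --> \oo] --> (0 : R).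
  apply: (squeeze_cvgr _ (cvg_cst 0) (@rcvgMl0 _ d^-1 _ s0)); near=> n.
  rewrite mulr_ge0 ?modulus_ge0 ?powR_ge0//= /t modulusM modulusV mk.
  rewrite mulrC -mulrA mulrC; apply: ler_wpM2r; first exact: modulus_ge0.
  rewrite mulrC ler_pdivrMr// mulrC ler_pdivlMr// mulrC; exact: cesaro_num1D_ge.
have T0 := beta_mean_little_o (s := d) _ t0.
have c1 : (\sum_(j < N) diff_coef (- d) j * beta_mean 1 beta f' j) @[N --> \oo] --> (0 : R[i]^o).
  rewrite -(cvg_shiftS (fun N => \sum_(j < N) diff_coef (- d) j * beta_mean 1 beta f' j)).
  have h := T0 _; have {h}T0' := h (introT andP (conj (ltW d0) d1)).
  apply: (@ccvg_le _ _ _ _ _ (@rcvgMl0 _ d^-1 _ T0')) => N.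
  rewrite /= subr0; have := psum_beta_mean f' N; rewrite -/s -/t => ->.
  rewrite modulusM mk mulrA; apply: ler_wpM2r; first exact: modulus_ge0.
  exact: cesaro_num1D_le.
have c2 : fdiff_cvg (- d) (beta_mean 1 beta (unit_seq R 0)) 0.
  apply: (@abs_bound_cvg _ (CB * ((b + 1) / (1 - d)))) => N.
  have s01 : 0 < 1 - d < 1 by apply/andP; split; lra.
  have := @beta_kernel1_col_cesaro R b (1 - d) 0 N Rebeta_gt0 s01.
  rewrite cesaro_num0 mulr1 subKr => /(ler_wpM2l CB0); apply: le_trans.
  rewrite mulr_sumr; apply: ler_sum => j _; rewrite add0n modulusM modulus_diff_coef opprK.
  rewrite ger0_norm; last by apply: cesaro_num_ge0; exact: ltW.
  rewrite beta_mean_unit_seq mulrCA; apply: ler_wpM2l; first by apply: cesaro_num_ge0; exact: ltW.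
  exact: modulus_beta_kernel1_le.
have mE : beta_mean 1 beta f =1 (fun j => sf * beta_mean 1 beta (unit_seq R 0) j + beta_mean 1 beta f' j).
  move=> j; rewrite -beta_mean_lin; apply: eq_beta_mean => l _; rewrite /f'; ring.
apply/cvg_ex; exists (sf * fdiff (- d) (beta_mean 1 beta (unit_seq R 0)) 0 + 0).
have := @ccvgD _ _ _ _ _ (@ccvgMl _ sf _ _ c2) c1.
apply: cvg_trans; apply: near_eq_cvg; apply: nearW => N /=.
by rewrite mulr_sumr -big_split/=; apply: eq_bigr => j _; rewrite add0n mE; ring.
Unshelve. all: by end_near. Qed.

(** By [fdiff_psumS] the series of order -d at n and n + 1 differ by the series of order 1 - d,
    which converges for every bounded u. *)
Lemma fdiff_cvg_next B u n : bounded_by B u -> fdiff_cvg (- d) u n -> fdiff_cvg (- d) u n.+1.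
Proof.
have [d0' d1'] := (d0, d1).
move=> uB hu.
have a0 : 0 <= - d + 1 by lra.
have c1 : fdiff_cvg (- d + 1) u n := @fdiff_bounded_cvg _ _ _ _ n a0 uB.
apply/cvg_ex; exists (fdiff (- d) u n - fdiff (- d + 1) u n).
have := @ccvgB _ _ _ _ _ (@ccvg_shiftS _ (fun N => \sum_(j < N) diff_coef (- d) j * u (n + j)%N) _ hu)
  (@ccvg_shiftS _ (fun N => \sum_(j < N) diff_coef (- d + 1) j * u (n + j)%N) _ c1).
apply: cvg_trans; apply: near_eq_cvg; apply: nearW => N /=.
by rewrite fdiff_psumS subKr.
Qed.

Lemma fdiff_cvg_all B u n : bounded_by B u -> fdiff_cvg (- d) u 0 -> fdiff_cvg (- d) u n.
Proof. move=> uB u0; elim: n => [|n IH]; [exact: u0|exact: (fdiff_cvg_next uB IH)]. Qed.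

End Definedness.

Lemma frac_order_itv (alpha : R) : 0 <= alpha -> alpha \isn't a Num.nat ->
  0 < (Num.truncn alpha).+1%:R - alpha < 1.
Proof.
move=> a0 aN; have /andP[t0 t1] := truncn_itv a0.
rewrite subr_gt0 t1/= -natr1 ltrBlDr addrC ltrD2l lt_def t0 andbT.
by apply: contra aN => /eqP ->; rewrite natr_nat.
Qed.

Lemma frac_diff_defined_of0 (alpha : R) f B : 0 <= alpha -> bounded_by B f ->
  (forall d : R, 0 < d < 1 -> d = (Num.truncn alpha).+1%:R - alpha -> fdiff_cvg (- d) f 0) ->
  frac_diff_defined alpha f.
Proof.
move=> a0 fB h aN n; apply/frac_sum_cvgE.
have d01 := frac_order_itv a0 aN.
have /andP[d0 d1] := d01.
exact: (fdiff_cvg_all d0 d1 fB (h _ d01 erefl)).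
Qed.

Lemma frac_diff_defined_at0 (alpha : R) f (d : R) : frac_diff_defined alpha f ->
  0 < d < 1 -> d = (Num.truncn alpha).+1%:R - alpha -> fdiff_cvg (- d) f 0.
Proof.
move=> h /andP[d0 d1] dE.
(* An integer alpha would give d = 1. *)
have aN : alpha \isn't a Num.nat.
  by apply/negP => /truncnK e; move: d1; rewrite dE -natr1 e addrAC subrr add0r ltxx.
by rewrite dE; exact: (frac_sum_cvgE _ _ _).1 (h aN 0%N).
Qed.

Lemma frac_diff_defined_beta_mean (alpha : R) f B : 0 <= alpha -> bounded_by B f ->
  frac_diff_defined alpha f -> frac_diff_defined alpha (beta_mean 1 beta f).
Proof.
move=> a0 fB h; apply: (frac_diff_defined_of0 a0 (beta_mean_bounded Rebeta_gt0 fB)) => d d01 dE.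
by have /andP[d0 d1] := d01; apply: fdiff_cvg_beta_mean0 => //; exact: (frac_diff_defined_at0 h d01 dE).
Qed.

(** Conjugation cancels k^(alpha+1)(l) and leaves k^beta(n-l) k^(alpha+1)(n) / k^(alpha+beta+1)(n).
    By [cesaro_numM_le] the last quotient has modulus at most a constant over k^(b+1)(n), b = Re
    beta, which restores the kernel of C_b. *)
Lemma fdiff_beta_mean_le (alpha : R) : 0 < alpha -> exists2 C, 0 <= C &
  forall f n, f @ \oo --> (0 : R[i]^o) ->
  modulus (fdiff alpha (beta_mean 1 beta f) n) * cesaro_num (alpha + 1) n <=
  C * \sum_(j < n.+1) beta_kernel 1 b n j * (modulus (fdiff alpha f j) * cesaro_num (alpha + 1) j).
Proof.
move=> a0; have [C1 C10 hC1] := modulus_cesaro_num_le Rebeta_gt0.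
pose K := modulus (kappa alpha beta) * (C1 * expR (2 * (alpha * b))).
have K0 : 0 <= K by rewrite mulr_ge0 ?modulus_ge0// mulr_ge0 ?expR_ge0.
exists K => // f n f0.
have b0 : 0 < b := Rebeta_gt0.
rewrite fdiff_beta_mean// modulusM /K -!mulrA; apply: ler_wpM2l; first exact: modulus_ge0.
have w0 j : 0 < cesaro_num (alpha + 1) j by apply: cesaro_num_gt0; lra.
apply: (@le_trans _ _ ((\sum_(l < n.+1) modulus (beta_kernel (1 + alpha%:C) beta n l * fdiff alpha f l)) * cesaro_num (alpha + 1) n)).
  by apply: ler_wpM2r; [exact: ltW|exact: modulus_sum].
rewrite mulr_suml !mulr_sumr; apply: ler_sum => l _.
have ln : (l <= n)%N by rewrite -ltnS.
rewrite modulusM /beta_kernel ln cesaro_num_one mul1r.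
have -> : modulus (cesaro_num (1 + alpha%:C) l * cesaro_num beta (n - l) / cesaro_num (1 + alpha%:C + beta) n) =
   cesaro_num (alpha + 1) l * modulus (cesaro_num beta (n - l)) / modulus (cesaro_num (1 + alpha%:C + beta) n).
  have -> : cesaro_num (1 + alpha%:C) l = (cesaro_num (alpha + 1) l)%:C.
    by rewrite cesaro_num_complex rmorphD/= addrC.
  by rewrite [LHS]modulusM [X in X * _]modulusM modulusV modulusR gtr0_norm.
have Reab : complex.Re (1 + alpha%:C + beta) = alpha + b + 1.
  by rewrite !raddfD/= addrAC addrC addrA (addrC alpha) -/b; ring.
have kab : 0 < cesaro_num (alpha + b + 1) n by apply: cesaro_num_gt0; lra.
have g1 : cesaro_num (alpha + b + 1) n <= modulus (cesaro_num (1 + alpha%:C + beta) n).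
  by rewrite -Reab; apply: modulus_cesaro_num_ge; rewrite Reab; lra.
have kb1 : 0 < cesaro_num (1 + b) n by apply: cesaro_num_gt0; lra.
have H : modulus (cesaro_num beta (n - l)) / modulus (cesaro_num (1 + alpha%:C + beta) n) * cesaro_num (alpha + 1) n
   <= C1 * (expR (2 * (alpha * b)) * (cesaro_num b (n - l) / cesaro_num (1 + b) n)).
  apply: (@le_trans _ _ (C1 * cesaro_num b (n - l) / cesaro_num (alpha + b + 1) n * cesaro_num (alpha + 1) n)).
    apply: ler_wpM2r; first exact: ltW.
    apply: ler_pM; rewrite ?modulus_ge0 ?invr_ge0 ?modulus_ge0//.
    by rewrite lef_pV2 ?posrE// (lt_le_trans kab).
  have kbl : 0 <= C1 * cesaro_num b (n - l) by rewrite mulr_ge0// cesaro_num_ge0// ltW.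
  rewrite [leRHS](_ : _ = (C1 * cesaro_num b (n - l)) * (expR (2 * (alpha * b)) / cesaro_num (1 + b) n)); last by ring.
  rewrite -mulrA; apply: ler_wpM2l => //.
  rewrite mulrC ler_pdivrMr// mulrAC ler_pdivlMr// (addrC 1 b).
  exact: cesaro_numM_le (ltW a0) (ltW b0).
rewrite [leLHS](_ : _ = (modulus (cesaro_num beta (n - l)) / modulus (cesaro_num (1 + alpha%:C + beta) n) * cesaro_num (alpha + 1) n) *
   (modulus (fdiff alpha f l) * cesaro_num (alpha + 1) l)); last by ring.
rewrite [leRHS](_ : _ = (C1 * (expR (2 * (alpha * b)) * (cesaro_num b (n - l) / cesaro_num (1 + b) n))) *
   (modulus (fdiff alpha f l) * cesaro_num (alpha + 1) l)); last by ring.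
by apply: ler_wpM2r H; rewrite mulr_ge0 ?modulus_ge0// ltW.
Qed.

End CesaroTau.

(** * The adjoint operators *)

Section Inversion.
Variable R : realType.
Implicit Types (a B M : R) (f g u v : nat -> R[i]^o) (n i j l N : nat).
Local Notation k := (@cesaro_num R).

Definition delay (i : nat) u : nat -> R[i]^o := fun l => if (i <= l)%N then u (l - i)%N else 0.

Lemma sum_delay i u N : \sum_(l < i + N) delay i u l = \sum_(j < N) u j.
Proof.
rewrite big_split_ord/= big1 ?add0r => [|l _]; last by rewrite /delay leqNgt ltn_ord.
by apply: eq_bigr => l _; rewrite /delay leq_addr addKn.
Qed.

Lemma delayP i u (c : R[i]^o) : (\sum_(j < N) u j) @[N --> \oo] --> c <->
  (\sum_(l < N) delay i u l) @[N --> \oo] --> c.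
Proof.
rewrite -[X in _ <-> X](cvg_shiftn i (fun N => \sum_(l < N) delay i u l)).
have -> // : (fun N => \sum_(j < N) u j) = (fun N => \sum_(l < N + i) delay i u l).
by apply/funext => N; rewrite addnC sum_delay.
Qed.

Lemma csum_delay i u : csum_cvg u -> csum_cvg (delay i u) /\ csum (delay i u) = csum u.
Proof.
move=> h; have c : (\sum_(l < N) delay i u l) @[N --> \oo] --> csum u by exact: (delayP i u _).1 h.
by split; [apply: cvgP c|exact: csumP c].
Qed.

Lemma csum_delay_cvg i u : csum_cvg (delay i u) -> csum_cvg u.
Proof. by move=> h; apply/cvg_ex; exists (csum (delay i u)); exact: (delayP i u _).2 h. Qed.

(* Abel summation against the remainders of the convergent series. *)
Lemma csum_abel (c : nat -> R) u B B' : (forall j, `|c j| <= B) ->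
  (forall N, \sum_(j < N) `|c j - c j.+1| <= B') ->
  csum_cvg u -> csum_cvg (fun j => (c j)%:C * u j).
Proof.
move=> cB cB' hu.
pose r N : R[i]^o := \sum_(j < N) u j - csum u.
have r0 : (modulus (r n)) @[n --> \oo] --> (0 : R).
  by move/ccvgP : (hu : _ --> csum u).
have rc : r @ \oo --> (0 : R[i]^o).
  by apply/ccvgP; under eq_fun do rewrite subr0.
have [D rD] := cvg0_bounded rc; have D0 := bounded_by_ge0 rD.
have B0 : 0 <= B by apply: le_trans (cB 0%N).
pose w j : R[i]^o := (c j - c j.+1)%:C * r j.+1.
have wc : csum_cvg w.
  apply: (@abs_bound_cvg _ (B' * D)) => N.
  apply: le_trans (_ : (\sum_(j < N) `|c j - c j.+1|) * D <= _); last exact: ler_wpM2r.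
  rewrite mulr_suml; apply: ler_sum => j _; rewrite /w modulusM modulusR.
  by apply: ler_wpM2l => //; exact: rD.
have cr : (fun N => (c N)%:C * r N) @ \oo --> (0 : R[i]^o).
  apply: (@ccvg_le _ _ _ _ _ (@rcvgMl0 _ B _ r0)) => N.
  by rewrite subr0 modulusM modulusR; apply: ler_wpM2r => //; exact: modulus_ge0.
apply/cvg_ex; exists (0 + csum w - (c 0%N)%:C * r 0%N).
have := @ccvgB _ _ _ _ _ (@ccvgD _ _ _ _ _ cr wc) (@ccvg_cst _ ((c 0%N)%:C * r 0%N)).
apply: cvg_trans; apply: near_eq_cvg; apply: nearW => N /=.
elim: N => [|N IH]; first by rewrite !big_ord0 addr0 subrr.
rewrite [in RHS]big_ord_recr/= -IH big_ord_recr/= /w rmorphB/= /r big_ord_recr/=; ring.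
Qed.

Lemma cesaro_numN_le0 a j : 0 <= a <= 1 -> k (- a) j.+1 <= 0.
Proof.
move=> /andP[a0 a1]; elim: j => [|j IH]; first by rewrite cesaro_num1 oppr_le0.
rewrite cesaro_numS mulr_le0_ge0// divr_ge0// addrC subr_ge0 -natr1.
by rewrite (le_trans a1)// lerDr.
Qed.

Lemma diff_coef_tail a N K : 0 <= a <= 1 ->
  \sum_(i < K) modulus (diff_coef a (N.+1 + i)) <= k (1 - a) N.
Proof.
move=> a01; have /andP[a0 a1] := a01.
have -> : \sum_(i < K) modulus (diff_coef a (N.+1 + i)) = k (1 - a) N - k (1 - a) (N + K).
  elim: K => [|K IH]; first by rewrite big_ord0 addn0 subrr.
  rewrite big_ord_recr/= IH modulus_diff_coef addSn ler0_norm; last exact: cesaro_numN_le0.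
  have := cesaro_num_diff (- a) (N + K); rewrite (addrC (- a) 1) addnS => <-; ring.
by rewrite gerBl cesaro_num_ge0// subr_ge0.
Qed.

(** Both sides sum p j q i f(j + i) over the triangle j + i <= N. *)
Lemma triangle_sum (p q f : nat -> R[i]^o) N :
  \sum_(j < N.+1) p j * \sum_(i < (N - j).+1) q i * f (j + i)%N =
  \sum_(l < N.+1) (\sum_(j < l.+1) p j * q (l - j)%N) * f l.
Proof.
elim: N => [|N IH]; first by rewrite !big_ord1 mulrA.
rewrite [in RHS]big_ord_recr/= -IH big_ord_recr/= subnn big_ord1 addn0.
rewrite [X in _ + X * f N.+1]big_ord_recr/= subnn mulrDl !addrA; congr (_ + _); last by rewrite mulrA.
rewrite mulr_suml -big_split/=; apply: eq_bigr => j _.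
have jN : (j <= N)%N by rewrite -ltnS.
by rewrite subSn// big_ord_recr/= mulrDr -subSn// subnKC ?mulrA// leqW.
Qed.

(** Cutting every inner series at total index N turns the partial sum into exactly f n, because k^a
    and k^(-a) are inverse under convolution. If |f| <= e beyond N, the cut changes the j-th inner
    series by at most e k^(1-a)(N - j); weighted by k^a(j), these errors add up to e k^1(N) = e. *)
Lemma fdiff_inverse_frac a f n : 0 <= a < 1 -> f @ \oo --> (0 : R[i]^o) ->
  (\sum_(j < N) (k a j)%:C * fdiff a f (n + j)%N) @[N --> \oo] --> f n.
Proof.
move=> /andP[a0 a1] f0; have a01 : 0 <= a <= 1 by rewrite a0 ltW.
have [B fB] := cvg0_bounded f0.
have cv m : fdiff_cvg a f m := @fdiff_bounded_cvg _ _ _ _ m a0 fB.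
rewrite -(cvg_shiftS (fun N => \sum_(j < N) (k a j)%:C * fdiff a f (n + j)%N : R[i]^o)).
apply/ccvgP/cvgrPdist_le => e e0.
move/ccvgP/cvgrPdist_le : f0 => /(_ _ e0) [N0 _ hN0].
have f_small l : (N0 <= l)%N -> modulus (f l) <= e.
  by move=> /hN0/=; rewrite sub0r normrN subr0 ger0_norm ?modulus_ge0.
exists N0 => // N /= NN0; rewrite sub0r normrN ger0_norm ?modulus_ge0//.
pose S j : R[i]^o := \sum_(i < (N - j).+1) diff_coef a i * f (n + (j + i))%N.
have main : \sum_(j < N.+1) (k a j)%:C * S j = f n.
  have := triangle_sum (fun j => (k a j)%:C) (diff_coef a) (fun l => f (n + l)%N) N.
  rewrite /S => ->; rewrite big_ord_recl/= big_ord1/= diff_coef0 mulr1 cesaro_num0 mul1r addn0.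
  rewrite big1 ?addr0// => l _.
  rewrite (_ : \sum_(j < _) _ = 0) ?mul0r//.
  transitivity ((cesaro_num (a - a) (bump 0 l))%:C : R[i]^o); last by rewrite subrr /bump/= cesaro_num_zero.
  rewrite -cesaro_num_vandermonde rmorph_sum/=; apply: eq_bigr => j _.
  by rewrite /diff_coef -rmorphM.
rewrite -{1}main -sumrB.
have tail j : (j <= N)%N -> modulus (fdiff a f (n + j)%N - S j) <= e * k (1 - a) (N - j).
  move=> jN; have c : (modulus (\sum_(i < K) diff_coef a i * f (n + j + i)%N - S j)) @[K --> \oo] -->
      modulus (fdiff a f (n + j)%N - S j).
    by apply: ccvg_modulus; exact: (@ccvgB _ _ (fun=> S j) _ _ (cv (n + j)%N) (@ccvg_cst _ (S j))).
  rewrite -(cvg_lim (@Rhausdorff R) c); apply: limr_le; first exact: cvgP c.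
  near=> K.
  have KN : ((N - j).+1 <= K)%N by near: K; exists (N - j).+1.
  rewrite -(subnKC KN) big_split_ord/=.
  have -> : \sum_(i < (N - j).+1) diff_coef a i * f (n + j + i)%N = S j.
    by apply: eq_bigr => i _; rewrite addnA.
  rewrite [X in modulus X](_ : _ = \sum_(i < K - (N - j).+1) diff_coef a ((N - j).+1 + i)%N * f (n + j + ((N - j).+1 + i))%N); last first.
    by rewrite addrAC subrr add0r.
  apply: (le_trans (modulus_sum _ _ _)); apply: le_trans (ler_wpM2l (ltW e0) (diff_coef_tail (N - j) (K - (N - j).+1) a01)).
  rewrite mulr_sumr; apply: ler_sum => i _; rewrite modulusM mulrC.
  apply: ler_wpM2r; first exact: modulus_ge0.
  by apply: f_small; apply: (leq_trans NN0); lia.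
apply: (le_trans (modulus_sum _ _ _)).
apply: (@le_trans _ _ (\sum_(j < N.+1) k a j * (e * k (1 - a) (N - j)))).
  apply: ler_sum => j _; rewrite -mulrBr modulusM modulusR ger0_norm ?cesaro_num_ge0//.
  by apply: ler_wpM2l; [exact: cesaro_num_ge0|apply: tail; rewrite -ltnS].
under eq_bigr => j _ do rewrite mulrCA.
by rewrite -mulr_sumr cesaro_num_vandermonde addrC subrK cesaro_num_one mulr1.
Unshelve. all: by end_near. Qed.

Lemma ccvg_shiftn m u (c : R[i]^o) : u @ \oo --> c -> (u (m + n)%N) @[n --> \oo] --> c.
Proof.
move=> h; elim: m => [|m IH]; first exact: h.
have := @ccvg_shiftS _ (fun n => u (m + n)%N) _ IH.
by under eq_fun do rewrite addnS -addSn.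
Qed.

(** Induction on m through W^(c+1) f = W^c (W^1 f). As k^(c+1) is the partial sum of k^c, the series
    of order c + 1 is a sum over i of series of order c, which equal W^1 f(n + i) and telescope to f
    n. The bound B makes the interchange absolute. *)
Lemma fdiff_inverse (m : nat) a f B : 0 <= a < 1 -> f @ \oo --> (0 : R[i]^o) ->
  (forall n N, \sum_(j < N) k (a + m%:R) j * modulus (fdiff (a + m%:R) f (n + j)%N) <= B) ->
  forall n, csum (fun j => (k (a + m%:R) j)%:C * fdiff (a + m%:R) f (n + j)%N) = f n.
Proof.
move=> a01; have /andP[a0 a1] := a01; elim: m f => [|m IH] f f0.
  by rewrite addr0 => _ n; apply: csumP; exact: fdiff_inverse_frac.
rewrite -natr1 addrA; set c := a + m%:R in IH *; move=> hB n.
have c0 : 0 <= c by rewrite addr_ge0.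
have [D fD] := cvg0_bounded f0.
have cv p : fdiff_cvg c f p := @fdiff_bounded_cvg _ _ _ _ p c0 fD.
pose g := fdiff (c + 1) f.
pose Wf : nat -> R[i]^o := fun p => f p - f p.+1.
have W0 : Wf @ \oo --> (0 : R[i]^o).
  by rewrite -[X in _ --> X](subr0 (0 : R[i]^o)); exact: (ccvgB f0 (ccvg_shiftS f0)).
have gE p : fdiff c Wf p = g p.
  rewrite /g (fdiffS (cv p) (cv p.+1)).2.
  have -> : fdiff c f p.+1 = fdiff c (fun j => f j.+1) p.
    by apply: eq_csum => j; rewrite addSn.
  have cv1 : fdiff_cvg c (fun j => f j.+1) p.
    by apply: (@fdiff_bounded_cvg _ _ D _ _ c0) => j; exact: fD.
  have -> : Wf = (fun j => (-1) * f j.+1 + f j) by apply/funext => j; rewrite /Wf; ring.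
  by rewrite (@fdiff_lin _ c (-1) (fun j => f j.+1) f p cv1 (cv p)); ring.
have kle j : k c j <= k (c + 1) j.
  case: j => [|j]; first by rewrite !cesaro_num0.
  by rewrite -[k c j.+1]cesaro_num_diff gerBl cesaro_num_ge0// addr_ge0.
have WB p N : \sum_(j < N) k c j * modulus (fdiff c Wf (p + j)%N) <= B.
  apply: le_trans (hB p N); apply: ler_sum => j _; rewrite gE.
  by apply: ler_wpM2r => //; exact: modulus_ge0.
have WE := IH Wf W0 WB.
pose x i := delay i (fun j => (k c j)%:C * g (n + i + j)%N).
have xE i l : x i l = if (i <= l)%N then (k c (l - i))%:C * g (n + l)%N else 0.
  by rewrite /x /delay; case: ifP => // il; rewrite -addnA subnKC.
have tri i l : (l < i)%N -> x i l = 0 by move=> li; rewrite xE leqNgt li.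
have colE l : \sum_(i < l.+1) x i l = (k (c + 1) l)%:C * g (n + l)%N.
  rewrite -cesaro_num_sum rmorph_sum/= mulr_suml.
  rewrite [RHS](reindex_inj rev_ord_inj)/=; apply: eq_bigr => i _.
  by rewrite xE subSS -ltnS ltn_ord.
have xb N N' : \sum_(i < N) \sum_(l < N') modulus (x i l) <= B.
  apply: le_trans (hB n N'); rewrite exchange_big/=; apply: ler_sum => l _.
  apply: le_trans (@ge0_ler_sum_trunc _ (fun i => modulus (x i l)) l.+1 N _ _) _.
  - by move=> i; exact: modulus_ge0.
  - by move=> i li; rewrite tri// modulus0.
  rewrite -cesaro_num_sum mulr_suml [leRHS](reindex_inj rev_ord_inj)/=; apply: ler_sum => i _.
  by rewrite xE subSS -ltnS ltn_ord modulusM modulusR ger0_norm// cesaro_num_ge0.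
have [xc _ _ xs] := csum_exchange tri xb.
rewrite -[LHS](_ : csum (fun i => csum (x i)) = _); last first.
  by rewrite xs; apply: eq_csum => l; exact: colE.
have xi i : csum (x i) = Wf (n + i)%N.
  have := xc i => /csum_delay_cvg h; rewrite /x (csum_delay i h).2.
  by rewrite -WE; apply: eq_csum => j; rewrite gE.
rewrite (eq_csum xi); apply: csumP.
have -> : (fun N => \sum_(j < N) Wf (n + j)%N) = (fun N => f n - f (n + N)%N).
  apply/funext; elim=> [|N IHN]; first by rewrite big_ord0 addn0 subrr.
  by rewrite big_ord_recr/= IHN /Wf addnS addrA subrK.
rewrite -[X in _ --> X]subr0.
exact: (@ccvgB _ (fun=> f n) (fun N => f (n + N)%N) _ _ (@ccvg_cst _ (f n)) (ccvg_shiftn n f0)).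
Qed.

End Inversion.

(** * Adjoint means on l^r, their commutation and their fractional differences *)

Section Adjoint.
Variable R : realType.
Implicit Types (a B M C H r : R) (f g h u v : nat -> R[i]^o) (n i j l N : nat) (beta : R[i]).
Local Notation k := (@cesaro_num R).

(** The series starts at 0, the kernel being zero for j < n, so that double sums run over one index
    set for all n. *)
Definition adj_mean beta f n : R[i]^o := csum (fun j => beta_kernel 1 beta j n * f j).

Lemma cesaro_adj_psum beta f n N :
  \sum_(n <= j < N) cesaro_adj_term beta f n j = \sum_(j < N) beta_kernel 1 beta j n * f j.
Proof.
case: (leqP n N) => [nN|Nn]; last first.
  rewrite big_geq ?(ltnW Nn)// big1// => j _.
  by rewrite beta_kernel_gt ?mul0r// (ltn_trans _ Nn).
rewrite -(big_mkord xpredT (fun j => beta_kernel 1 beta j n * f j)) [RHS](@big_cat_nat _ _ _ n)//=.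
have z : \sum_(0 <= j < n) beta_kernel 1 beta j n * f j = 0.
  by rewrite big_nat_cond big1// => j /andP[/andP[_ jn] _]; rewrite beta_kernel_gt ?mul0r.
rewrite z add0r; apply: eq_big_nat => j /andP[nj _]; rewrite /cesaro_adj_term beta_kernel1E'// (addrC 1 beta).
by move: (cesaro_num _ _) (cesaro_num _ _) => x y; rewrite ?(mulrC x^-1) ?(mulrC y^-1).
Qed.

Lemma cesaro_adjE beta f : cesaro_adj beta f = adj_mean beta f.
Proof.
apply/funext => n; rewrite /cesaro_adj /sum_from /adj_mean /csum.
by congr (limn _); apply/funext => N; exact: cesaro_adj_psum.
Qed.

Lemma cesaro_adj_cvgE beta f n :
  cesaro_adj_cvg beta f n = csum_cvg (fun j => beta_kernel 1 beta j n * f j).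
Proof.
rewrite /cesaro_adj_cvg /sum_from_cvg /csum_cvg.
by congr (cvgn _); apply/funext => N; exact: cesaro_adj_psum.
Qed.

(** H bounds the r-th power of the l^r norm, not the norm itself. *)
Definition lr_bound r H (h : nat -> R) : Prop := forall N, \sum_(j < N) h j `^ r <= H.

(* Lower semicontinuity, by the tangent lines of x `^ r. *)
Lemma lr_bound_lim r H (S : nat -> nat -> R) (L : nat -> R) N : 1 <= r ->
  (forall n N', 0 <= S n N') -> (forall n, S n N' @[N' --> \oo] --> L n) ->
  (forall N', \sum_(n < N) S n N' `^ r <= H) -> \sum_(n < N) L n `^ r <= H.
Proof.
move=> r1 S0 SL hH.
have L0 n : 0 <= L n.
  by rewrite -(cvg_lim (@Rhausdorff R) (SL n)); apply: limr_ge; [exact: cvgP (SL n)|exact: nearW].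
have c : (\sum_(n < N) (L n `^ r + r * L n `^ (r - 1) * (S n N' - L n))) @[N' --> \oo] -->
    \sum_(n < N) (L n `^ r + r * L n `^ (r - 1) * (L n - L n)).
  apply: cvg_big => [|n _]; first exact: add_continuous.
  apply: cvgD; first exact: cvg_cst.
  by apply: cvgM; [exact: cvg_cst|apply: cvgB; [exact: SL|exact: cvg_cst]].
have -> : \sum_(n < N) L n `^ r = \sum_(n < N) (L n `^ r + r * L n `^ (r - 1) * (L n - L n)).
  by apply: eq_bigr => n _; rewrite subrr mulr0 addr0.
rewrite -(cvg_lim (@Rhausdorff R) c); apply: limr_le; first exact: cvgP c.
apply: nearW => N'; apply: le_trans (hH N'); apply: ler_sum => n _.
exact: powR_tangent.
Qed.

Section Fixed.
Variables (r : R).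
Hypothesis r1 : 1 <= r.

Lemma lr_powR_le H (h : nat -> R) n : (forall n, 0 <= h n) -> lr_bound r H h -> h n <= H `^ r^-1.
Proof.
move=> h0 hH; have r0 : 0 < r := lt_le_trans ltr01 r1.
have h1 : h n `^ r <= H.
  by apply: le_trans (hH n.+1); rewrite big_ord_recr/= lerDr sumr_ge0// => j _; exact: powR_ge0.
have -> : h n = (h n `^ r) `^ r^-1 by rewrite -powRrM divff ?gt_eqF// powRr1.
by apply: ge0_ler_powR; rewrite ?nnegrE ?invr_ge0 ?powR_ge0 ?(ltW r0)// (le_trans _ h1)// powR_ge0.
Qed.

Section One.
Variable beta : R[i].
Hypothesis Rebeta_gt0 : 0 < complex.Re beta.
Let b := complex.Re beta.
Let CB : R := modulus beta / complex.Re beta.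
Let CB0 : 0 <= CB. Proof. by rewrite divr_ge0 ?modulus_ge0// ltW. Qed.

(** A single term of an l^r sequence is at most its norm, so Hardy's inequality also gives a bound
    uniform in n and N, and with it absolute convergence. *)
Lemma adj_row_bound H h : lr_bound r H (fun j => modulus (h j)) ->
  exists2 M, 0 <= M & forall n N, \sum_(j < N) beta_kernel 1 b j n * modulus (h j) <= M.
Proof.
move=> hH; have r0 : 0 < r := lt_le_trans ltr01 r1.
have [C C0 hC] := hardy_adj Rebeta_gt0 r1.
exists ((C * H) `^ r^-1); first exact: powR_ge0.
move=> n N; pose S n := \sum_(j < N) beta_kernel 1 b j n * modulus (h j).
apply: (@lr_powR_le _ S).
  by move=> m; rewrite sumr_ge0// => j _; rewrite mulr_ge0 ?modulus_ge0 ?beta_kernel_ge0.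
move=> m; apply: le_trans (hC (fun j => modulus (h j)) m N _) _.
  by move=> j; exact: modulus_ge0.
by apply: ler_wpM2l => //; exact: hH.
Qed.

Lemma adj_abs_bound M h n : (forall N, \sum_(j < N) beta_kernel 1 b j n * modulus (h j) <= M) ->
  abs_bound (CB * M) (fun j => beta_kernel 1 beta j n * h j).
Proof.
move=> hM N; apply: le_trans (ler_wpM2l CB0 (hM N)).
rewrite mulr_sumr; apply: ler_sum => j _; rewrite modulusM mulrA.
by apply: ler_wpM2r; [exact: modulus_ge0|exact: modulus_beta_kernel1_le].
Qed.

Lemma adj_mean_cvg H h n : lr_bound r H (fun j => modulus (h j)) ->
  csum_cvg (fun j => beta_kernel 1 beta j n * h j).
Proof.
by move=> /adj_row_bound[M _ hM]; exact: abs_bound_cvg (adj_abs_bound (hM n)).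
Qed.

Lemma adj_mean_bounded H h : lr_bound r H (fun j => modulus (h j)) ->
  exists M, bounded_by M (adj_mean beta h).
Proof.
by move=> /adj_row_bound[M _ hM]; exists (CB * M) => n; exact: csum_le (adj_abs_bound (hM n)).
Qed.

Lemma adj_mean_lr : exists2 C, 0 <= C & forall H h, lr_bound r H (fun j => modulus (h j)) ->
  lr_bound r (C * H) (fun j => modulus (adj_mean beta h j)).
Proof.
have r0 : 0 < r := lt_le_trans ltr01 r1.
have [C C0 hC] := hardy_adj Rebeta_gt0 r1.
exists (CB `^ r * C); first by rewrite mulr_ge0 ?powR_ge0.
move=> H h hH N.
pose S n N' := modulus (\sum_(j < N') beta_kernel 1 beta j n * h j).
apply: (@lr_bound_lim r _ S (fun j => modulus (adj_mean beta h j)) N r1).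
- by move=> n N'; exact: modulus_ge0.
- by move=> n; apply: ccvg_modulus; exact: (@adj_mean_cvg _ _ n hH).
move=> N'; rewrite -mulrA.
apply: le_trans (_ : CB `^ r * (C * \sum_(j < N') modulus (h j) `^ r) <= _); last first.
  by do 2?[apply: ler_wpM2l; rewrite ?powR_ge0//]; exact: hH.
apply: le_trans (ler_wpM2l (powR_ge0 CB r) (hC (fun j => modulus (h j)) N N' _)); last first.
  by move=> j; exact: modulus_ge0.
rewrite mulr_sumr; apply: ler_sum => n _.
have s0 : 0 <= \sum_(j < N') beta_kernel 1 b j n * modulus (h j).
  by rewrite sumr_ge0// => j _; rewrite mulr_ge0 ?modulus_ge0 ?beta_kernel_ge0.
rewrite -powRM//; apply: ge0_ler_powR; rewrite ?nnegrE ?(ltW r0) ?modulus_ge0 ?(mulr_ge0 CB0 s0)//.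
rewrite /S; apply: le_trans (modulus_sum _ _ _) _; rewrite mulr_sumr; apply: ler_sum => j _.
rewrite modulusM mulrA; apply: ler_wpM2r; first exact: modulus_ge0.
exact: modulus_beta_kernel1_le.
Qed.

End One.

(** Hardy's inequality, applied once for each kernel, bounds the double sums of moduli, as the
    interchange requires. *)
Lemma adj_mean_comm_aux beta gamma H h n : 0 < complex.Re beta -> 0 < complex.Re gamma ->
  lr_bound r H (fun j => modulus (h j)) ->
  adj_mean beta (adj_mean gamma h) n =
  csum (fun i => beta_mean 1 gamma (fun j => beta_kernel 1 beta j n) i * h i).
Proof.
move=> b0 c0 hH; have r0 : 0 < r := lt_le_trans ltr01 r1.
set b := complex.Re beta; set c := complex.Re gamma.
have [C C0 hC] := hardy_adj c0 r1; have [C' C'0 hC'] := hardy_adj b0 r1.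
pose CB := modulus beta / b; pose CG := modulus gamma / c.
have CB0 : 0 <= CB by rewrite divr_ge0 ?modulus_ge0// ltW.
have CG0 : 0 <= CG by rewrite divr_ge0 ?modulus_ge0// ltW.
pose x j i := beta_kernel 1 beta j n * (beta_kernel 1 gamma i j * h i).
have tri j i : (i < j)%N -> x j i = 0.
  by move=> ij; rewrite /x (beta_kernel_gt _ _ ij) mul0r mulr0.
have xb N N' : \sum_(j < N) \sum_(i < N') modulus (x j i) <= CB * (CG * ((C' * (C * H)) `^ r^-1)).
  pose S j := \sum_(i < N') beta_kernel 1 c i j * modulus (h i).
  have S0 j : 0 <= S j.
    by rewrite sumr_ge0// => i _; rewrite mulr_ge0 ?modulus_ge0 ?beta_kernel_ge0.
  have SH : lr_bound r (C * H) S.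
    move=> K; apply: le_trans (hC (fun j => modulus (h j)) K N' _) _.
      by move=> j; exact: modulus_ge0.
    by apply: ler_wpM2l => //; exact: hH.
  pose T m := \sum_(j < N) beta_kernel 1 b j m * S j.
  have T1 : T n <= (C' * (C * H)) `^ r^-1.
    apply: lr_powR_le.
      by move=> m; rewrite sumr_ge0// => j _; rewrite mulr_ge0 ?beta_kernel_ge0.
    move=> m; apply: le_trans (hC' S m N S0) _.
    by apply: ler_wpM2l => //; exact: SH.
  apply: (@le_trans _ _ (CB * (CG * T n))); last by do 2?apply: ler_wpM2l => //.
  rewrite /T !mulr_sumr; apply: ler_sum => j _; rewrite /S !mulr_sumr; apply: ler_sum => i _.
  rewrite /x modulusM modulusM.
  rewrite [leRHS](_ : _ = (CB * beta_kernel 1 b j n) * ((CG * beta_kernel 1 c i j) * modulus (h i))); last by ring.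
  apply: ler_pM; rewrite ?modulus_ge0 ?mulr_ge0 ?modulus_ge0//; first exact: modulus_beta_kernel1_le.
  by apply: ler_wpM2r; [exact: modulus_ge0|exact: modulus_beta_kernel1_le].
have [xc _ _ xs] := csum_exchange tri xb.
transitivity (csum (fun j => csum (x j))).
  apply: eq_csum => j; apply/esym/csumP.
  have -> : (fun N => \sum_(i < N) x j i) =
     (fun N => beta_kernel 1 beta j n * (\sum_(i < N) beta_kernel 1 gamma i j * h i)).
    by apply/funext => N; rewrite mulr_sumr.
  apply: (@ccvgMl _ _ (fun N => \sum_(i < N) beta_kernel 1 gamma i j * h i)).
  exact: (@adj_mean_cvg _ c0 _ _ j hH).
rewrite xs; apply: eq_csum => i; rewrite /beta_mean mulr_suml; apply: eq_bigr => j _.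
by rewrite /x; ring.
Qed.

Lemma adj_mean_comm beta gamma H h n : 0 < complex.Re beta -> 0 < complex.Re gamma ->
  lr_bound r H (fun j => modulus (h j)) ->
  adj_mean beta (adj_mean gamma h) n = adj_mean gamma (adj_mean beta h) n.
Proof.
move=> b0 c0 hH; rewrite (adj_mean_comm_aux _ b0 c0 hH) (adj_mean_comm_aux _ c0 b0 hH).
apply: eq_csum => i.
by rewrite (@beta_mean_kernelC _ gamma beta n i (one_addn_neq0 c0) (one_addn_neq0 b0)).
Qed.

Lemma fdiff_delay a f n : fdiff_cvg a f n ->
  fdiff a f n = csum (delay n (fun j => diff_coef a j * f (n + j)%N)).
Proof. by move=> h; rewrite (csum_delay n h).2. Qed.

(** After the interchange, the coefficient of h i is the convolution of k^(-a) and k^a at i - n,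
    that is k^0(i - n), over k^(a+1)(i): only i = n survives. *)
Lemma fdiff_adj_mean a H h n : 0 < a -> lr_bound r H (fun j => modulus (h j)) ->
  fdiff a (adj_mean a%:C h) n = h n / (k (a + 1) n)%:C.
Proof.
move=> a0 hH; have Ra0 : 0 < complex.Re (a%:C : R[i]) by [].
have [M M0 hM] := adj_row_bound Ra0 hH.
have [D D0 hD] := diff_coef_abs (ltW a0).
have CA0 : 0 <= modulus (a%:C : R[i]) / a by rewrite divr_ge0 ?modulus_ge0// ltW.
pose q j : R[i]^o := if (n <= j)%N then diff_coef a (j - n) else 0.
pose x j i := q j * (beta_kernel 1 a%:C i j * h i).
have tri j i : (i < j)%N -> x j i = 0.
  by move=> ij; rewrite /x (beta_kernel_gt _ _ ij) mul0r mulr0.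
have qD N : \sum_(j < N) modulus (q j) <= D.
  apply: le_trans (_ : \sum_(j < n + N) modulus (q j) <= _).
    by rewrite addnC big_split_ord/= lerDl sumr_ge0// => j _; exact: modulus_ge0.
  rewrite big_split_ord/= big1 ?add0r => [|j _]; last by rewrite /q leqNgt ltn_ord modulus0.
  apply: le_trans (hD N); apply: ler_sum => j _.
  by rewrite /q leq_addr addKn.
have xb N N' : \sum_(j < N) \sum_(i < N') modulus (x j i) <= D * (modulus (a%:C : R[i]) / a * M).
  apply: (@le_trans _ _ (\sum_(j < N) modulus (q j) * (modulus (a%:C : R[i]) / a * M))); last first.
    by rewrite -mulr_suml; apply: ler_wpM2r; [rewrite mulr_ge0|exact: qD].
  apply: ler_sum => j _.
  apply: le_trans (_ : modulus (q j) * (\sum_(i < N') modulus (beta_kernel 1 a%:C i j * h i)) <= _).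
    by rewrite mulr_sumr; apply: ler_sum => i _; rewrite modulusM.
  apply: ler_wpM2l; first exact: modulus_ge0.
  exact: (adj_abs_bound Ra0 (hM j)).
have [xc _ _ xs] := csum_exchange tri xb.
have [B hB] := adj_mean_bounded Ra0 hH.
rewrite fdiff_delay; last exact: (fdiff_bounded_cvg (ltW a0) hB).
transitivity (csum (fun j => csum (x j))).
  apply: eq_csum => j; apply/esym; rewrite /delay; case: ifPn => nj; last first.
    apply: csumP; rewrite /x /q (negbTE nj).
    have -> : (fun N => \sum_(i < N) 0 * (beta_kernel 1 a%:C i j * h i)) = (fun=> 0).
      by apply/funext => N; rewrite big1// => i _; rewrite mul0r.
    exact: ccvg_cst.
  rewrite subnKC//; apply: csumP.
  have -> : (fun N => \sum_(i < N) x j i) =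
     (fun N => diff_coef a (j - n) * (\sum_(i < N) beta_kernel 1 a%:C i j * h i)).
    by apply/funext => N; rewrite mulr_sumr; apply: eq_bigr => i _; rewrite /x /q nj.
  apply: (@ccvgMl _ _ (fun N => \sum_(i < N) beta_kernel 1 a%:C i j * h i)).
  exact: (@adj_mean_cvg _ Ra0 _ _ j hH).
rewrite xs.
have col i : \sum_(j < i.+1) x j i = if i == n then h n / (k (a + 1) n)%:C else 0.
  have -> : \sum_(j < i.+1) x j i = (\sum_(j < i.+1) q j * beta_kernel 1 a%:C i j) * h i.
    by rewrite mulr_suml; apply: eq_bigr => j _; rewrite /x mulrA.
  case: (leqP n i) => [ni|lt_in]; last first.
    rewrite (ltn_eqF lt_in) big1 ?mul0r// => j _.
    by rewrite /q leqNgt (leq_trans (ltn_ord j))// mul0r.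
  have -> : \sum_(j < i.+1) q j * beta_kernel 1 a%:C i j =
    (\sum_(j < (i - n).+1) k (- a) j * k a (i - n - j))%:C / (k (a + 1) i)%:C.
    rewrite -[in LHS](subnKC ni) -addnS big_split_ord/= big1 ?add0r; last first.
      by move=> j _; rewrite /q leqNgt ltn_ord mul0r.
    rewrite rmorph_sum/= mulr_suml; apply: eq_bigr => j _.
    have ji : (n + j <= i)%N by have := ltn_ord j; lia.
    rewrite /q leq_addr addKn subnKC// beta_kernel1E'//.
    have -> : cesaro_num (1 + a%:C) i = (k (a + 1) i)%:C.
      by rewrite cesaro_num_complex rmorphD/= addrC.
    by rewrite /diff_coef -cesaro_num_complex mulrA subnDA -rmorphM.
  rewrite cesaro_num_vandermonde addNr; case: eqP => [->|/eqP ni'].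
    by rewrite subnn cesaro_num0 mul1r mulrC.
  have : (0 < i - n)%N by rewrite subn_gt0 ltn_neqAle eq_sym ni' ni.
  by case: (i - n)%N => // m _; rewrite cesaro_num_zero mul0r mul0r.
apply: csumP.
have -> : (fun N => \sum_(i < N) \sum_(j < i.+1) x j i) =
  (fun N => \sum_(i < N) delay n (fun j => if j == 0%N then h n / (k (a + 1) n)%:C else 0) i).
  apply/funext => N; apply: eq_bigr => i _; rewrite col /delay.
  case: (leqP n i) => [ni|lt_in]; last by rewrite ltn_eqF.
  by rewrite subn_eq0 eqn_leq ni andbT.
exact: (@delayP R n (fun j => if j == 0%N then h n / (k (a + 1) n)%:C else 0) (h n / (k (a + 1) n)%:C)).1 (@csum_delta R (h n / (k (a + 1) n)%:C)).
Qed.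

(** The weight k^(a+1)(j) cancels the denominator of the kernel, so the left side is W^(-a) W^a f.
    The l^r bound supplies the absolute bound that [fdiff_inverse] asks for. *)
Lemma adj_mean_fdiff a H f n : 0 < a -> f @ \oo --> (0 : R[i]^o) ->
  lr_bound r H (fun j => modulus ((k (a + 1) j)%:C * fdiff a f j)) ->
  adj_mean a%:C (fun j => (k (a + 1) j)%:C * fdiff a f j) n = f n.
Proof.
move=> a0 f0 hH; have Ra0 : 0 < complex.Re (a%:C : R[i]) by [].
have [M M0 hM] := adj_row_bound Ra0 hH.
have /andP[t0 t1] := truncn_itv (ltW a0).
pose c := a - (Num.truncn a)%:R.
have c01 : 0 <= c < 1 by rewrite /c subr_ge0 t0/= ltrBlDr addrC natr1.
have aE : c + (Num.truncn a)%:R = a by rewrite /c subrK.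
have kp j : 0 < k (a + 1) j by apply: cesaro_num_gt0; lra.
have kc0 j : ((k (a + 1) j)%:C : R[i]) != 0 by rewrite eq_complex/= negb_and (gt_eqF (kp j)).
have term p j : (p <= j)%N -> beta_kernel 1 a j p * (k (a + 1) j) = k a (j - p).
  move=> pj; rewrite beta_kernel1E// (addrC 1 a) divfK// gt_eqF//.
have hB p N : \sum_(j < N) k a j * modulus (fdiff a f (p + j)%N) <= M.
  apply: le_trans (hM p (p + N)%N); rewrite [leRHS]big_split_ord/= ler_wpDl//.
    by rewrite sumr_ge0// => j _; rewrite mulr_ge0 ?modulus_ge0 ?beta_kernel_ge0.
  apply: ler_sum => j _; rewrite modulusM modulusR gtr0_norm// mulrA.
  by rewrite term ?leq_addr// addKn.
have := @fdiff_inverse _ (Num.truncn a) c f M c01 f0; rewrite aE => /(_ hB n) <-.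
have cv : csum_cvg (fun j => (k a j)%:C * fdiff a f (n + j)%N).
  apply: (@abs_bound_cvg _ M) => N; apply: le_trans (hB n N); apply: ler_sum => j _.
  by rewrite modulusM modulusR ger0_norm// cesaro_num_ge0// ltW.
rewrite -(csum_delay n cv).2; apply: eq_csum => j; rewrite /delay.
case: ifPn => [nj|]; last by rewrite -ltnNge => jn; rewrite beta_kernel_gt ?mul0r.
rewrite subnKC// mulrA; congr (_ * _).
rewrite beta_kernel1E'// -cesaro_num_complex.
have -> : cesaro_num (1 + a%:C) j = (k (a + 1) j)%:C.
  by rewrite cesaro_num_complex rmorphD/= addrC.
by rewrite divfK.
Qed.

End Fixed.
End Adjoint.

(** * Definedness of fractional differences of adjoint means *)

Lemma ler_sum_abs_mono (R : realType) (c : nat -> R) (B : R) N :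
  (forall j, 0 <= c j <= B) -> (forall j, c j.+1 <= c j) \/ (forall j, c j <= c j.+1) ->
  \sum_(j < N) `|c j - c j.+1| <= B.
Proof.
move=> cB mono; have cn j := proj1 (andP (cB j)); have cb j := proj2 (andP (cB j)).
have [h|h] := mono.
  have -> : \sum_(j < N) `|c j - c j.+1| = c 0%N - c N.
    elim: N => [|N IH]; first by rewrite big_ord0 subrr.
    by rewrite big_ord_recr/= IH ger0_norm ?subr_ge0// addrA subrK.
  by rewrite lerBlDr (le_trans (cb 0%N))// lerDl.
have -> : \sum_(j < N) `|c j - c j.+1| = c N - c 0%N.
  elim: N => [|N IH]; first by rewrite big_ord0 subrr.
  rewrite big_ord_recr/= IH ler0_norm ?subr_le0//; ring.
by rewrite lerBlDr (le_trans (cb N))// lerDl.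
Qed.

(** Solved for its boundary term, [delta_sum] gives (i + 1)(X i - X (i + 1)) - s X i for the column
    sums X, hence at most (i + 1) X i, uniformly in N. *)
Lemma beta_kernel1_boundary (R : realType) (b s : R) i N : 0 < b -> 0 < s < 1 ->
  N%:R * cesaro_num (1 - s) N * beta_kernel 1 b N.-1 i <=
  i.+1%:R * ((b + 1) / s * cesaro_num (1 - s) i).
Proof.
move=> b0 s01; have /andP[s0 s1] := s01.
have v0 n : 0 <= cesaro_num (1 - s) n by apply: cesaro_num_ge0; lra.
have h := delta_sum (fun n => beta_kernel 1 b n i) s N.
pose X i := \sum_(n < N) cesaro_num (1 - s) n * beta_kernel 1 b n i.
have X0 l : 0 <= X l by rewrite sumr_ge0// => n _; rewrite mulr_ge0 ?beta_kernel_ge0.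
have E : \sum_(n < N) cesaro_num (1 - s) n * delta 1 (fun n => beta_kernel 1 b n i) n =
    i.+1%:R * (X i - X i.+1).
  rewrite /X -sumrB mulr_sumr; apply: eq_bigr => n _.
  rewrite -beta_kernel1_delta//; first by ring.
  by move=> m; apply: add_nat_neq0; lra.
rewrite E -/(X i) in h.
have -> : N%:R * cesaro_num (1 - s) N * beta_kernel 1 b N.-1 i = i.+1%:R * (X i - X i.+1) - s * X i.
  by rewrite h addrAC subrr add0r.
apply: (@le_trans _ _ (i.+1%:R * X i)).
  rewrite mulrBr -addrA gerDl -opprD oppr_le0 addr_ge0// mulr_ge0//; exact: ltW.
by apply: ler_wpM2l => //; exact: beta_kernel1_col_cesaro.
Qed.

Section AdjointDefined.
Variable R : realType.
Implicit Types (f t u v : nat -> R[i]^o) (n i j l N : nat).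
Local Notation k := (@cesaro_num R).

(* With v = 1 / k^(2 - d), asymptotic to k^d, the remainders T of the series of v f
   give f n = (n + 1 - d) t n - (n + 1) t (n + 1) for t = k^(1 - d) T / (1 - d), and
   adj_mean commutes with that operation. *)
Lemma fdiff_cvg_adj_mean0 (beta : R[i]) (d : R) f : 0 < complex.Re beta -> 0 < d < 1 ->
  (forall n, csum_cvg (fun j => beta_kernel 1 beta j n * f j)) ->
  fdiff_cvg (- d) f 0 -> fdiff_cvg (- d) (adj_mean beta f) 0.
Proof.
move=> b0 d01 Kf hf; have /andP[d0 d1] := d01.
set b := complex.Re beta.
pose CB := modulus beta / b.
have CB0 : 0 <= CB by rewrite divr_ge0 ?modulus_ge0// ltW.
have e0 : 0 < 1 - d by lra.
have e1 : 1 - d < 1 by lra.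
have kd j : 0 < k d j by apply: cesaro_num_gt0.
have ke j : 0 < k (1 - d) j by apply: cesaro_num_gt0.
have k2 j : 0 < k (1 - d + 1) j by apply: cesaro_num_gt0; lra.
(* [rho] is the quotient k^d / v. It is nonincreasing with values between d (1 - d) and 1, so Abel's
   test exchanges the weights k^d and v in both directions. *)
pose rho j := k d j * k (1 - d + 1) j.
have rho0 j : 0 < rho j by rewrite mulr_gt0.
have rhoS j : rho j.+1 <= rho j.
  rewrite /rho !cesaro_numS.
  have -> : k d j * ((d + j%:R) / j.+1%:R) * (k (1 - d + 1) j * ((1 - d + 1 + j%:R) / j.+1%:R)) =
     (k d j * k (1 - d + 1) j) * (((d + j%:R) * (1 - d + 1 + j%:R)) / j.+1%:R ^+ 2).
    by field; rewrite nat1r pnatr_eq0.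
  rewrite (ger_pMr _ (mulr_gt0 (kd j) (k2 j))) ler_pdivrMr ?exprn_gt0// mul1r -natr1.
  rewrite -subr_ge0 (_ : _ - _ = (1 - d) ^+ 2); last by ring.
  exact: sqr_ge0.
have rho1 j : rho j <= 1.
  elim: j => [|j IH]; first by rewrite /rho !cesaro_num0 mulr1.
  exact: le_trans (rhoS j) IH.
have rhoc j : d * (1 - d) <= rho j.
  have p := cesaro_num1D_ge e0 e1 j.
  have s01 : 0 <= 1 - d <= 1 by rewrite !ltW.
  have q := @cesaro_num_ge_powR _ (1 - d) j s01; rewrite subKr in q.
  have E : (j.+1%:R : R) `^ (- (1 - d)) * j.+1%:R `^ (1 - d) = 1 by exact: powRN_powR.
  apply: (@le_trans _ _ ((d * j.+1%:R `^ (- (1 - d))) * ((1 - d) * j.+1%:R `^ (1 - d)))).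
    by rewrite mulrACA E mulr1.
  by apply: ler_pM => //; rewrite mulr_ge0 ?powR_ge0 ?ltW.
have dd0 : 0 < d * (1 - d) by rewrite mulr_gt0.
pose V j : R[i]^o := ((rho j)^-1)%:C * (diff_coef (- d) j * f (0 + j)%N).
have VE j : V j = ((k (1 - d + 1) j)^-1)%:C * f j.
  rewrite /V add0n /diff_coef opprK mulrA -rmorphM/=; congr (_%:C * _).
  by rewrite /rho; field; rewrite (gt_eqF (kd j)) (gt_eqF (k2 j)).
have rhoV j : 0 <= (rho j)^-1 <= (d * (1 - d))^-1.
  by rewrite invr_ge0 (ltW (rho0 j))/= lef_pV2 ?posrE.
have Vc : csum_cvg V.
  apply: (@csum_abel _ (fun j => (rho j)^-1) _ (d * (1 - d))^-1 (d * (1 - d))^-1 _ _ hf).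
    by move=> j; have /andP[p q] := rhoV j; rewrite ger0_norm.
  move=> N; apply: (@ler_sum_abs_mono _ (fun j => (rho j)^-1)); first exact: rhoV.
  by right=> j; rewrite lef_pV2 ?posrE.
pose T n : R[i]^o := csum V - \sum_(j < n) V j.
have T0 : (modulus (T n)) @[n --> \oo] --> (0 : R).
  by have /ccvgP := (Vc : _ --> csum V); under eq_fun do rewrite modulusB.
have TS n : T n - T n.+1 = V n.
  by rewrite /T big_ord_recr/=; ring.
have [D TD] : exists D, bounded_by D T.
  apply: cvg0_bounded; apply/ccvgP; by under eq_fun do rewrite subr0.
have D0 := bounded_by_ge0 TD.
pose t n : R[i]^o := (k (1 - d) n / (1 - d))%:C * T n.
have w1 n : (n%:R + 1 - d%:C) * (k (1 - d) n / (1 - d))%:C = (k (1 - d + 1) n)%:C :> R[i].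
  rewrite -real_complex_natr -rmorphD -rmorphB -rmorphM/=; congr (_%:C).
  apply: (mulfI (lt0r_neq0 e0)); rewrite cesaro_num_add1; field.
  by rewrite gt_eqF.
have w2 n : n.+1%:R * (k (1 - d) n.+1 / (1 - d))%:C = (k (1 - d + 1) n)%:C :> R[i].
  rewrite -real_complex_natr -rmorphM/=; congr (_%:C).
  apply: (mulfI (lt0r_neq0 e0)); rewrite cesaro_num_add1S; move: (k _ _) => z; field.
  by rewrite gt_eqF.
have fE n : f n = (n%:R + 1 - d%:C) * t n - n.+1%:R * t n.+1.
  rewrite /t !mulrA w1 w2 -mulrBr TS VE mulrA -rmorphM/= divff ?mul1r// gt_eqF//.
(* Applied with e = [D] for the convergence of the series, and with small e and large n for the
   decay of [Y]. *)
have Kt n e : 0 <= e -> (forall j, (n <= j)%N -> modulus (T j) <= e) ->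
   forall N, \sum_(j < N) beta_kernel 1 b j n * modulus (t j) <= e / (1 - d) * ((b + 1) / d * k (1 - d) n).
  move=> ee0 he N.
  apply: (@le_trans _ _ (e / (1 - d) * \sum_(j < N) k (1 - d) j * beta_kernel 1 b j n)); last first.
    by apply: ler_wpM2l; [rewrite divr_ge0// ltW|exact: beta_kernel1_col_cesaro].
  rewrite mulr_sumr; apply: ler_sum => j _.
  case: (leqP n j) => [nj|jn]; last by rewrite beta_kernel_gt// mul0r !mulr0.
  rewrite [leRHS](_ : _ = beta_kernel 1 b j n * (k (1 - d) j / (1 - d) * e)); last by ring.
  apply: ler_wpM2l; first exact: beta_kernel_ge0.
  rewrite /t modulusM modulusR ger0_norm; last by rewrite divr_ge0// ltW.
  by apply: ler_wpM2l; [rewrite divr_ge0// ltW|exact: he].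
have Ktc n : csum_cvg (fun j => beta_kernel 1 beta j n * t j).
  apply: abs_bound_cvg; apply: (adj_abs_bound b0) => N.
  by apply: Kt D0 _ N => j _; exact: TD.
(* Summation by parts with [beta_kernel1_delta]. By [beta_kernel1_boundary], the boundary term is a
   bounded factor times [T N]. *)
have adjE n : adj_mean beta f n = (n%:R + 1 - d%:C) * adj_mean beta t n - n.+1%:R * adj_mean beta t n.+1.
  apply: csumP.
  have -> : (fun N => \sum_(j < N) beta_kernel 1 beta j n * f j) =
    (fun N => ((n%:R + 1 - d%:C) * (\sum_(j < N) beta_kernel 1 beta j n * t j) -
      n.+1%:R * (\sum_(j < N) beta_kernel 1 beta j n.+1 * t j)) -
      N%:R * beta_kernel 1 beta N.-1 n * t N).
    apply/funext; elim=> [|N IH]; first by rewrite !big_ord0 !mulr0 !mul0r !subr0.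
    rewrite !big_ord_recr/= IH fE.
    have := @beta_kernel1_delta _ beta N n (one_addn_neq0 b0).
    rewrite /delta => /eqP; rewrite -subr_eq0 => /eqP h.
    apply/eqP; rewrite -subr_eq0 -[X in _ == X]oppr0 -[X in _ == - X](mul0r (t N)) -h; apply/eqP.
    by rewrite -(natr1 N) -(natr1 n) /=; ring.
  rewrite -[X in _ --> X]subr0.
  apply: (@ccvgB _ (fun N => (n%:R + 1 - d%:C) * (\sum_(j < N) beta_kernel 1 beta j n * t j) -
      n.+1%:R * (\sum_(j < N) beta_kernel 1 beta j n.+1 * t j))).
    apply: (@ccvgB _ (fun N => (n%:R + 1 - d%:C) * (\sum_(j < N) beta_kernel 1 beta j n * t j))
       (fun N => n.+1%:R * (\sum_(j < N) beta_kernel 1 beta j n.+1 * t j))).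
      exact: (@ccvgMl _ _ (fun N => \sum_(j < N) beta_kernel 1 beta j n * t j) _ (Ktc n)).
    exact: (@ccvgMl _ _ (fun N => \sum_(j < N) beta_kernel 1 beta j n.+1 * t j) _ (Ktc n.+1)).
  pose Q := CB / (1 - d) * (n.+1%:R * ((b + 1) / d * k (1 - d) n)).
  apply: (@ccvg_le _ _ _ _ _ (@rcvgMl0 _ Q _ T0)) => N.
  rewrite subr0 modulusM modulusM modulus_natr /t modulusM modulusR ger0_norm; last by rewrite divr_ge0// ltW.
  rewrite mulrA; apply: ler_wpM2r; first exact: modulus_ge0.
  apply: (@le_trans _ _ (N%:R * (CB * beta_kernel 1 b N.-1 n) * (k (1 - d) N / (1 - d)))).
    apply: ler_wpM2r; first by rewrite divr_ge0// ltW.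
    by apply: ler_wpM2l => //; exact: modulus_beta_kernel1_le.
  rewrite [leLHS](_ : _ = CB / (1 - d) * (N%:R * k (1 - d) N * beta_kernel 1 b N.-1 n)); last by ring.
  apply: ler_wpM2l; first by rewrite divr_ge0// ltW.
  exact: beta_kernel1_boundary.
(* [Y] is obtained from the adjoint mean of [t] as [T] is from [t]; since [adjE] has the form of
   [fE], the series of v times the adjoint mean of f telescopes through [Y]. *)
pose Y n : R[i]^o := ((1 - d) / k (1 - d) n)%:C * adj_mean beta t n.
have inv_cancel (x y z : R) : 0 < x -> 0 < y -> 0 < z -> (y * z / x)^-1 * y = x / z.
  by move=> x0 y0 z0; rewrite invf_div invfM mulrA mulrAC divfK ?gt_eqF.
have inv_cancel2 (x z c e q : R) : 0 < x -> 0 < z -> x / z * (c * (e / x * (q * z))) = c * q * e.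
  by move=> x0 z0; field; rewrite (gt_eqF x0) (gt_eqF z0).
have a1 n : ((k (1 - d + 1) n)^-1)%:C * (n%:R + 1 - d%:C) = ((1 - d) / k (1 - d) n)%:C :> R[i].
  rewrite -real_complex_natr -rmorphD -rmorphB -rmorphM/=; congr (_%:C).
  have -> : k (1 - d + 1) n = (1 - d + n%:R) * k (1 - d) n / (1 - d).
    by rewrite -cesaro_num_add1 [RHS]mulrAC divff ?mul1r// gt_eqF.
  have n0 : 0 < 1 - d + n%:R by rewrite ltr_wpDr.
  rewrite (_ : n%:R + 1 - d = 1 - d + n%:R); last by ring.
  exact: inv_cancel e0 n0 (ke n).
have a2 n : ((k (1 - d + 1) n)^-1)%:C * n.+1%:R = ((1 - d) / k (1 - d) n.+1)%:C :> R[i].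
  rewrite -real_complex_natr -rmorphM/=; congr (_%:C).
  have -> : k (1 - d + 1) n = n.+1%:R * k (1 - d) n.+1 / (1 - d).
    by rewrite -cesaro_num_add1S [RHS]mulrAC divff ?mul1r// gt_eqF.
  exact: inv_cancel e0 _ (ke n.+1).
have dist (v x y p q : R[i]) : v * (x * p - y * q) = v * x * p - v * y * q by ring.
have vY n : ((k (1 - d + 1) n)^-1)%:C * adj_mean beta f n = Y n - Y n.+1.
  by rewrite /Y -a1 -a2 adjE; exact: dist.
(* The factor k^(1-d)(n) in [Kt] cancels the one in [Y], leaving a multiple of the supremum of |T|
   from n on. *)
have Y0 : Y @ \oo --> (0 : R[i]^o).
  apply/ccvgP/cvgrPdist_le => e ep.
  pose Q := CB * ((b + 1) / d).
  have Q0 : 0 <= Q by rewrite mulr_ge0// divr_ge0 ?addr_ge0// ltW.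
  have ee : 0 < e / (Q + 1) by rewrite divr_gt0// ltr_wpDl.
  move/cvgrPdist_le : T0 => /(_ _ ee) [N0 _ hN0].
  exists N0 => // n /= Nn; rewrite sub0r normrN subr0 ger0_norm ?modulus_ge0//.
  rewrite /Y modulusM modulusR (gtr0_norm (divr_gt0 e0 (ke n))).
  have Tn j : (n <= j)%N -> modulus (T j) <= e / (Q + 1).
    move=> nj; have := hN0 j (leq_trans Nn nj).
    by rewrite /= sub0r normrN ger0_norm ?modulus_ge0.
  have := csum_le (adj_abs_bound b0 (Kt n _ (ltW ee) Tn)) => h.
  have p : 0 <= (1 - d) / k (1 - d) n by rewrite divr_ge0// ltW.
  apply: le_trans (ler_wpM2l p h) _.
  rewrite -/b -/CB (inv_cancel2 _ _ _ _ _ e0 (ke n)) -/Q.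
  have Q1 : 0 < Q + 1 by rewrite ltr_wpDl.
  by rewrite mulrCA (ger_pMr _ ep) ler_pdivrMr// mul1r lerDl.
have vc : csum_cvg (fun j => ((k (1 - d + 1) j)^-1)%:C * adj_mean beta f j).
  apply/cvg_ex; exists (Y 0%N - 0).
  have := @ccvgB _ _ _ _ _ (@ccvg_cst _ (Y 0%N)) Y0.
  apply: cvg_trans; apply: near_eq_cvg; apply: nearW => N /=.
  elim: N => [|N IH]; first by rewrite big_ord0 subrr.
  by rewrite big_ord_recr/= -IH vY addrA subrK.
have := @csum_abel _ rho _ 1 1 _ _ vc.
rewrite /fdiff_cvg => H.
have {}H : csum_cvg (fun j => (rho j)%:C * (((k (1 - d + 1) j)^-1)%:C * adj_mean beta f j)).
  apply: H; first by move=> j; rewrite gtr0_norm.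
  move=> N; apply: (@ler_sum_abs_mono _ rho); last by left.
  by move=> j; rewrite rho1 (ltW (rho0 j)).
have E : (fun j => diff_coef (- d) j * adj_mean beta f (0 + j)%N) =
   (fun j => (rho j)%:C * (((k (1 - d + 1) j)^-1)%:C * adj_mean beta f j)).
  apply/funext => j; rewrite add0n /diff_coef opprK mulrA -rmorphM/=; congr (_%:C * _).
  by rewrite /rho mulfK// gt_eqF.
by rewrite E.
Qed.

End AdjointDefined.

(** * Boundedness *)

Section TauNorm.
Variable R : realType.
Implicit Types (alpha r s C H : R) (f g : nat -> R[i]^o) (n j N : nat) (p : \bar R).
Local Notation k := (@cesaro_num R).

Definition weighted alpha f n : R := modulus (frac_diff alpha f n) * k (alpha + 1) n.

Lemma weighted_ge0 alpha f n : 0 <= alpha -> 0 <= weighted alpha f n.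
Proof. by move=> a0; rewrite mulr_ge0 ?modulus_ge0// cesaro_num_ge0// addr_ge0. Qed.

Section FiniteExponent.
Variables (alpha r : R).
Hypotheses (a0 : 0 <= alpha) (r1 : 1 <= r).

Let r0 : 0 < r. Proof. exact: lt_le_trans ltr01 r1. Qed.

Let S f : \bar R := (\sum_(0 <= n <oo) (weighted alpha f n `^ r)%:E)%E.

Let tau_normS f : tau_norm alpha r%:E f = (S f `^ r^-1)%E.
Proof.
rewrite /tau_norm /S; congr (_ `^ _)%E; apply: eq_eseriesr => n _; congr (_%:E).
by rewrite /weighted powRM ?modulus_ge0// cesaro_num_ge0// addr_ge0.
Qed.

Let S_ge0 f : (0 <= S f)%E.
Proof. by apply: nneseries_ge0 => n _ _; rewrite lee_fin powR_ge0. Qed.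

Let psum f N : (\sum_(0 <= n < N) (weighted alpha f n `^ r)%:E)%E = (\sum_(n < N) weighted alpha f n `^ r)%:E.
Proof. by rewrite big_mkord sumEFin. Qed.

Lemma tau_norm_fin f : (tau_norm alpha r%:E f < +oo)%E ->
  exists s, [/\ 0 <= s, tau_norm alpha r%:E f = (s `^ r^-1)%:E & lr_bound r s (weighted alpha f)].
Proof.
rewrite tau_normS => h.
have Sfin : (S f < +oo)%E.
  rewrite ltey; apply/eqP => Sy; move: h; rewrite Sy poweRyr ?ltxx//.
  by rewrite invr_eq0 gt_eqF.
have Sf : S f = (fine (S f))%:E by rewrite fineK// ge0_fin_numE.
exists (fine (S f)); split; [exact: fine_ge0|by rewrite {1}Sf poweR_EFin|].
move=> N; rewrite -lee_fin -Sf -psum.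
by apply: nneseries_lim_ge => n _; rewrite lee_fin powR_ge0.
Qed.

Lemma tau_norm_fin_le f s : 0 <= s -> lr_bound r s (weighted alpha f) ->
  (tau_norm alpha r%:E f <= (s `^ r^-1)%:E)%E.
Proof.
move=> s0 hs; rewrite tau_normS -poweR_EFin; apply: gt0_ler_poweR.
- by rewrite invr_ge0 ltW.
- by rewrite in_itv/= S_ge0 leey.
- by rewrite in_itv/= lee_fin s0 leey.
apply: lime_le; first by apply: is_cvg_nneseries => n _ _; rewrite lee_fin powR_ge0.
by apply: nearW => N; rewrite psum lee_fin.
Qed.

Lemma tau_norm_fin_bounded C f g : 0 <= C -> (tau_norm alpha r%:E f < +oo)%E ->
  (forall H, lr_bound r H (weighted alpha f) -> lr_bound r (C * H) (weighted alpha g)) ->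
  (tau_norm alpha r%:E g <= (C `^ r^-1)%:E * tau_norm alpha r%:E f)%E.
Proof.
move=> C0 /tau_norm_fin[s [s0 -> hs]] h.
apply: le_trans (tau_norm_fin_le (mulr_ge0 C0 s0) (h _ hs)) _.
by rewrite -EFinM lee_fin powRM.
Qed.

End FiniteExponent.

Lemma tau_norm_y alpha f : (tau_norm alpha +oo f < +oo)%E -> 0 <= alpha ->
  exists s, [/\ 0 <= s, tau_norm alpha +oo f = s%:E & forall n, weighted alpha f n <= s].
Proof.
move=> h a0; have h0 : ((weighted alpha f 0)%:E <= tau_norm alpha +oo f)%E.
  by apply: ereal_sup_ubound; exists 0%N.
have s0 : (0 <= tau_norm alpha +oo f)%E.
  by apply: le_trans h0; rewrite lee_fin weighted_ge0.
have E : tau_norm alpha +oo f = (fine (tau_norm alpha +oo f))%:E by rewrite fineK// ge0_fin_numE.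
exists (fine (tau_norm alpha +oo f)); split => //; first exact: fine_ge0.
by move=> n; rewrite -lee_fin -E; apply: ereal_sup_ubound; exists n.
Qed.

Lemma tau_norm_y_bounded alpha C f g : 0 <= alpha -> 0 <= C -> (tau_norm alpha +oo f < +oo)%E ->
  (forall H, (forall n, weighted alpha f n <= H) -> forall n, weighted alpha g n <= C * H) ->
  (tau_norm alpha +oo g <= C%:E * tau_norm alpha +oo f)%E.
Proof.
move=> a0 C0 /tau_norm_y/(_ a0)[s [s0 -> hs]] h.
apply: ge_ereal_sup => _ [n _ <-]; rewrite -EFinM lee_fin; exact: h.
Qed.

Lemma frac_diff0 f : frac_diff 0 f = f.
Proof. by rewrite /frac_diff -[0 : R]/(0%:R : R) natr_nat natrK. Qed.

Lemma weighted0 f n : weighted 0 f n = modulus (f n).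
Proof. by rewrite /weighted frac_diff0 add0r cesaro_num_one mulr1. Qed.

Lemma frac_diff_defined0 f : frac_diff_defined 0 f.
Proof. by move=> /negP; rewrite -[0 : R]/(0%:R : R) natr_nat. Qed.

Lemma lr_bound_cvg0 r H f : 1 <= r -> lr_bound r H (fun j => modulus (f j)) ->
  f @ \oo --> (0 : R[i]^o).
Proof.
move=> r1 hH; have r0 : 0 < r := lt_le_trans ltr01 r1.
have h : (modulus ((modulus (f n) `^ r)%:C : R[i]^o)) @[n --> \oo] --> (0 : R).
  apply: (@abs_bound_cvg0 _ H) => N; apply: le_trans (hH N); apply: ler_sum => j _.
  by rewrite modulusR ger0_norm// powR_ge0.
apply/ccvgP/cvgrPdist_lt => e e0.
have er : 0 < e `^ r by rewrite powR_gt0.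
move/cvgrPdist_lt : h => /(_ _ er); apply: filterS => n.
rewrite !sub0r !normrN modulusR normr_id ger0_norm ?powR_ge0// subr0 ger0_norm ?modulus_ge0//.
rewrite !ltNge; apply: contra => h; apply: ge0_ler_powR; rewrite ?nnegrE //; [exact: ltW|exact: ltW|exact: modulus_ge0].
Qed.

Lemma adj_mean_weighted alpha r H f : 0 < alpha -> 1 <= r -> f @ \oo --> (0 : R[i]^o) ->
  frac_diff_defined alpha f -> lr_bound r H (weighted alpha f) ->
  exists2 h, adj_mean alpha%:C h = f & lr_bound r H (fun j => modulus (h j)).
Proof.
move=> a0 r1 f0 fd fH; pose h j : R[i]^o := (k (alpha + 1) j)%:C * fdiff alpha f j.
have hE j : modulus (h j) = weighted alpha f j.
  rewrite /h modulusM modulusR gtr0_norm; last by apply: cesaro_num_gt0; rewrite ltr_wpDl// ltW.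
  by rewrite mulrC /weighted (frac_diffE (ltW a0) fd).
have hH : lr_bound r H (fun j => modulus (h j)).
  by move=> N; under eq_bigr do rewrite hE; exact: fH.
by exists h => //; apply/funext => n; exact: (adj_mean_fdiff r1 n a0 f0 hH).
Qed.

(** Through f = C_alpha^* h the space embeds in l^r, so the integral formula for C_beta^* has to be
    proved only on l^r. *)
Lemma tau_lr alpha r f : 0 <= alpha -> 1 <= r -> tau alpha r%:E f ->
  exists H, lr_bound r H (fun j => modulus (f j)).
Proof.
move=> a0 r1 [f0 fd fn]; have [s [_ _ fs]] := tau_norm_fin a0 r1 fn.
move: a0; rewrite le_eqVlt => /predU1P[a0|a0].
  by exists s => N; move: (fs N); rewrite -a0; under eq_bigr do rewrite weighted0.
have [h <- hs] := adj_mean_weighted a0 r1 (f0 a0) fd fs.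
have Ra0 : 0 < complex.Re (alpha%:C : R[i]) by [].
by have [C _ hC] := adj_mean_lr r1 Ra0; exists (C * s); exact: hC.
Qed.

Section Bounded.
Variable beta : R[i].
Hypothesis Rebeta_gt0 : 0 < complex.Re beta.
Let b := complex.Re beta.

(** Order 0 is separate: W^0 is the identity, l^oo contains sequences that do not tend to 0, and the
    modulus bound on the kernel already is the estimate. *)
Lemma tau_cesaro_le alpha : 0 <= alpha -> exists2 C, 0 <= C & forall f,
  (0 < alpha -> f @ \oo --> (0 : R[i]^o)) -> frac_diff_defined alpha f ->
  [/\ 0 < alpha -> beta_mean 1 beta f @ \oo --> (0 : R[i]^o),
      frac_diff_defined alpha (beta_mean 1 beta f) &
   forall n, weighted alpha (beta_mean 1 beta f) n <=
     C * \sum_(j < n.+1) beta_kernel 1 b n j * weighted alpha f j].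
Proof.
rewrite le_eqVlt => /predU1P[<-|a0].
  exists (modulus beta / b); first by rewrite divr_ge0 ?modulus_ge0// ltW.
  move=> f _ _; split; [by rewrite ltxx|exact: frac_diff_defined0|] => n.
  rewrite weighted0; apply: (le_trans (beta_mean_modulus_le Rebeta_gt0 f n)).
  apply: ler_wpM2l; first by rewrite divr_ge0 ?modulus_ge0// ltW.
  by apply: ler_sum => j _; rewrite weighted0.
have [C C0 hC] := fdiff_beta_mean_le Rebeta_gt0 a0.
exists C; first exact: C0.
move=> f /(_ a0) f0 fd.
have [B fB] := cvg0_bounded f0.
have cd := frac_diff_defined_beta_mean Rebeta_gt0 (ltW a0) fB fd.
split=> [_||n]; [exact: beta_mean_cvg0|exact: cd|].
rewrite /weighted (frac_diffE (ltW a0) cd); apply: (le_trans (hC f n f0)).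
by apply: ler_wpM2l => //; apply: ler_sum => j _; rewrite (frac_diffE (ltW a0) fd).
Qed.

Lemma bounded_cesaro alpha p : 0 <= alpha -> (1 < p)%E ->
  bounded_on_tau alpha p (cesaro_op beta).
Proof.
move=> a0 p1; have -> : cesaro_op beta = beta_mean 1 beta.
  by apply/funext => f; apply/funext => n; exact: cesaro_opE.
have [C C0 hC] := tau_cesaro_le a0.
have w0 f j : 0 <= weighted alpha f j by exact: weighted_ge0.
have bound : exists2 M : R, 0 <= M & forall f, tau alpha p f ->
    (tau_norm alpha p (beta_mean 1 beta f) <= M%:E * tau_norm alpha p f)%E.
  case: p p1 => [r r1|_|//].
  - rewrite lte_fin in r1; have r0 : 0 < r by apply: lt_trans r1.
    have [K K0 hK] := hardy_mean Rebeta_gt0 r1.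
    exists ((C `^ r * K) `^ r^-1); first exact: powR_ge0.
    move=> f [f0 fd fn]; have [_ _ h] := hC f f0 fd.
    apply: (tau_norm_fin_bounded a0 (ltW r1)) => //; first by rewrite mulr_ge0 ?powR_ge0.
    move=> H hH N.
    apply: le_trans (_ : C `^ r * (K * \sum_(j < N) weighted alpha f j `^ r) <= _); last first.
      by rewrite -mulrA; apply: ler_wpM2l; [exact: powR_ge0|apply: ler_wpM2l => //; exact: hH].
    apply: le_trans (ler_wpM2l (powR_ge0 C r) (hK (weighted alpha f) N N (w0 f))).
    rewrite mulr_sumr; apply: ler_sum => n _.
    have s0 : 0 <= \sum_(j < N) beta_kernel 1 b n j * weighted alpha f j.
      by rewrite sumr_ge0// => j _; rewrite mulr_ge0 ?beta_kernel_ge0.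
    rewrite -powRM//; apply: ge0_ler_powR; rewrite ?nnegrE ?(ltW r0) ?(mulr_ge0 C0 s0)//.
    apply: (le_trans (h n)); apply: ler_wpM2l => //.
    rewrite (@big_ord_trunc _ (fun j => beta_kernel 1 b n j * weighted alpha f j) n.+1 N)// => j nj.
    by rewrite beta_kernel_gt ?mul0r.
  - exists C => // f [f0 fd fn]; have [_ _ h] := hC f f0 fd.
    apply: tau_norm_y_bounded => // H hH n; apply: (le_trans (h n)); apply: ler_wpM2l => //.
    apply: (@le_trans _ _ (\sum_(j < n.+1) beta_kernel 1 b n j * H)).
      by apply: ler_sum => j _; apply: ler_wpM2l; [exact: beta_kernel_ge0|exact: hH].
    by rewrite -mulr_suml beta_kernel_row_sum// mul1r.
have [M M0 hM] := bound; split; last by exists M.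
- move=> f fT; have [f0 fd fn] := fT; have [h1 h2 _] := hC f f0 fd; split; [exact: h1|exact: h2|].
  apply: (le_lt_trans (hM f fT)).
  have n0 : (0 <= tau_norm alpha p f)%E.
    case: (p) => [r||]; rewrite /tau_norm ?poweR_ge0//.
    apply: le_trans (_ : (weighted alpha f 0)%:E <= _)%E; first by rewrite lee_fin.
    by apply: ereal_sup_ubound; exists 0%N.
  by rewrite -(@fineK _ (tau_norm alpha p f)) ?ge0_fin_numE// -EFinM ltry.
- by move=> c f h _ _ n; exact: beta_mean_lin.
Qed.

Lemma tau_adj_le alpha r : 0 <= alpha -> 1 <= r -> exists2 C, 0 <= C & forall f H,
  (0 < alpha -> f @ \oo --> (0 : R[i]^o)) -> frac_diff_defined alpha f ->
  lr_bound r H (weighted alpha f) ->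
  [/\ forall n, csum_cvg (fun j => beta_kernel 1 beta j n * f j),
      0 < alpha -> adj_mean beta f @ \oo --> (0 : R[i]^o),
      frac_diff_defined alpha (adj_mean beta f) &
      lr_bound r (C * H) (weighted alpha (adj_mean beta f))].
Proof.
move=> a0 r1; have [C C0 hC] := adj_mean_lr r1 Rebeta_gt0.
exists C; first exact: C0.
move=> f H; move: a0; rewrite le_eqVlt => /predU1P[<-|a0] f0 fd.
  have e g : weighted 0 g = (fun j => modulus (g j)) by apply/funext => j; rewrite weighted0.
  rewrite !e => fH; split; [|by rewrite ltxx|exact: frac_diff_defined0|exact: hC].
  by move=> n; exact: (@adj_mean_cvg _ _ r1 _ Rebeta_gt0 _ _ n fH).
move=> fH; have {}f0 := f0 a0.
have kp j : 0 < k (alpha + 1) j by apply: cesaro_num_gt0; rewrite ltr_wpDl// ltW.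
have [h fE hH] := adj_mean_weighted a0 r1 f0 fd fH.
have Ra0 : 0 < complex.Re (alpha%:C : R[i]) by [].
have [CA _ hCA] := adj_mean_lr r1 Ra0.
have fL : lr_bound r (CA * H) (fun j => modulus (f j)) by rewrite -fE; exact: hCA.
have Kf n : csum_cvg (fun j => beta_kernel 1 beta j n * f j) := @adj_mean_cvg _ _ r1 _ Rebeta_gt0 _ _ n fL.
have [B gB] := adj_mean_bounded r1 Rebeta_gt0 fL.
have gd : frac_diff_defined alpha (adj_mean beta f).
  apply: (frac_diff_defined_of0 (ltW a0) gB) => d d01 dE.
  exact: (fdiff_cvg_adj_mean0 Rebeta_gt0 d01 Kf (frac_diff_defined_at0 fd d01 dE)).
have hL := hC _ _ hH.
have g0 := lr_bound_cvg0 r1 (hC _ _ fL).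
have e j : weighted alpha (adj_mean beta f) j = modulus (adj_mean beta h j).
  rewrite /weighted (frac_diffE (ltW a0) gd).
  have -> : adj_mean beta f = adj_mean alpha%:C (adj_mean beta h).
    by apply/funext => n; rewrite -{1}fE; exact: (adj_mean_comm r1 _ Rebeta_gt0 Ra0 hH).
  rewrite (fdiff_adj_mean r1 _ a0 hL) modulusM modulusV modulusR gtr0_norm//.
  by rewrite divfK// gt_eqF.
split; [exact: Kf|by move=> _; exact: g0|exact: gd|].
by move=> N; under eq_bigr do rewrite e; exact: hL.
Qed.

Lemma tau_adj_cvg alpha p f : 0 <= alpha -> (1 <= p)%E -> (p < +oo)%E -> tau alpha p f ->
  forall n, csum_cvg (fun j => beta_kernel 1 beta j n * f j).
Proof.
move=> a0; case: p => [r|//|//]; rewrite lee_fin => r1 _ [f0 fd fn].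
have [C C0 hC] := tau_adj_le a0 r1.
have [s [_ _ fs]] := tau_norm_fin a0 r1 fn.
by have [] := hC f s f0 fd fs.
Qed.

Lemma bounded_cesaro_adj alpha p : 0 <= alpha -> (1 <= p)%E -> (p < +oo)%E ->
  bounded_on_tau alpha p (cesaro_adj beta).
Proof.
move=> a0 p1 py; have -> : cesaro_adj beta = adj_mean beta.
  by apply/funext => f; exact: cesaro_adjE.
have cv := fun f => @tau_adj_cvg alpha p f a0 p1 py.
case: p p1 py cv => [r r1 _ cv|//|//]; rewrite lee_fin in r1.
have r0 : 0 < r := lt_le_trans ltr01 r1.
have [C C0 hC] := tau_adj_le a0 r1.
have bd f : tau alpha r%:E f -> (tau_norm alpha r%:E (adj_mean beta f) <= (C `^ r^-1)%:E * tau_norm alpha r%:E f)%E.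
  move=> [f0 fd fn]; apply: (tau_norm_fin_bounded a0 r1) => // H fH.
  by have [] := hC f H f0 fd fH.
split; last by exists (C `^ r^-1).
- move=> f fT; have [f0 fd fn] := fT; have [s [_ _ fs]] := tau_norm_fin a0 r1 fn.
  have [_ h1 h2 _] := hC f s f0 fd fs; split; [exact: h1|exact: h2|].
  apply: (le_lt_trans (bd f fT)).
  have n0 : (0 <= tau_norm alpha r%:E f)%E by rewrite /tau_norm poweR_ge0.
  by rewrite -(@fineK _ (tau_norm alpha r%:E f)) ?ge0_fin_numE// -EFinM ltry.
- move=> c f h fT hT n; apply: csumP.
  have -> : (fun N => \sum_(j < N) beta_kernel 1 beta j n * (c * f j + h j)) =
    (fun N => \sum_(j < N) (c * (beta_kernel 1 beta j n * f j) + beta_kernel 1 beta j n * h j)).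
    by apply/funext => N; apply: eq_bigr => j _; rewrite mulrDr mulrCA.
  exact: (@csum_lin _ c (fun j => beta_kernel 1 beta j n * f j) (fun j => beta_kernel 1 beta j n * h j) (cv f fT n) (cv h hT n)).
Qed.

End Bounded.
End TauNorm.

(** * Beta integrals *)

Section ImproperFTC.
Variable R : realType.
Local Notation mu := (@lebesgue_measure R).
Implicit Types (f F : R -> R) (A B b y t : R).

Lemma itv0y_bigcup : `]0, +oo[%classic = \bigcup_(n : nat) `[(n.+1%:R^-1 : R), +oo[%classic.
Proof.
apply/seteqP; split => x /=.
  rewrite in_itv/= andbT => x0.
  exists (Num.truncn x^-1) => //=; rewrite in_itv/= andbT.
  have xi : 0 < x^-1 by rewrite invr_gt0.
  have /andP[_ /ltW h] := truncn_itv (ltW xi).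
  by rewrite -[leRHS]invrK lef_pV2 ?posrE ?invr_gt0.
move=> [n _]; rewrite /= !in_itv/= !andbT => h.
by apply: lt_le_trans h; rewrite invr_gt0.
Qed.

(** The integrand may blow up at 0, where the antiderivative only has a limit. The half-line is
    exhausted by the intervals from 1 / (n + 1) on, and nonnegativity gives monotone convergence. *)
Lemma ge0_continuous_FTC0y f F A B :
  (forall x : R, 0 < x -> 0 <= f x) -> (forall x : R, 0 < x -> {for x, continuous f}) ->
  (forall x : R, 0 < x -> is_derive x (1 : R) F (f x)) ->
  (F (n.+1%:R^-1) @[n --> \oo] --> A) -> (F x @[x --> +oo] --> B) ->
  (\int[mu]_(x in `]0%R, +oo[) (f x)%:E = (B - A)%:E)%E.
Proof.
move=> f0 fc dF FA FB.
pose D (n : nat) : set R := `[n.+1%:R^-1, +oo[%classic.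
have Dp (n : nat) : (0 : R) < n.+1%:R^-1 by rewrite invr_gt0.
have mfx : measurable_fun (`]0, +oo[%classic : set R) f.
  apply: open_continuous_measurable_fun; first exact: interval_open.
  by move=> x; rewrite inE/= in_itv/= andbT; exact: fc.
have FTC n : (\int[mu]_(x in D n) (f x)%:E = B%:E - (F n.+1%:R^-1)%:E)%E.
  apply: ge0_continuous_FTC2y => //.
  - by move=> x nx; apply: f0; exact: lt_le_trans nx.
  - apply: continuous_in_subspaceT => x; rewrite inE/= in_itv/= andbT => nx.
    by apply: fc; exact: lt_le_trans nx.
  - by move=> x nx; have [] := dF x (lt_trans (Dp n) nx).
  - have [d _] := dF _ (Dp n).
    apply: cvg_at_right_filter.
    by apply: differentiable_continuous; apply/derivable1_diffP.
  - move=> x; rewrite in_itv/= andbT => nx; rewrite derive1E.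
    by have [_ ->] := dF x (lt_trans (Dp n) nx).
rewrite itv0y_bigcup.
have c1 : (\int[mu]_(x in D n) (f x)%:E)%E @[n --> \oo] --> (\int[mu]_(x in \bigcup_n D n) (f x)%:E)%E.
  apply: ge0_nondecreasing_set_cvg_integral.
  - apply/nondecreasing_seqP => n; apply/subsetPset => x; rewrite /D/= !in_itv/= !andbT.
    by apply: le_trans; rewrite lef_pV2 ?posrE// ler_nat.
  - by move=> n; exact: measurable_itv.
  - move=> n; apply/measurable_EFinP; apply: measurable_funS mfx; first exact: measurable_itv.
    by move=> x; rewrite /D/= !in_itv/= !andbT; exact: lt_le_trans.
  - by move=> n x; rewrite /D/= in_itv/= andbT => nx; rewrite lee_fin f0// (lt_le_trans _ nx).
have c2 : (\int[mu]_(x in D n) (f x)%:E)%E @[n --> \oo] --> (B - A)%:E.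
  under eq_fun do rewrite FTC -EFinB.
  by apply: cvg_EFin; [exact: nearW|apply: cvgB => //; exact: cvg_cst].
exact: (cvg_unique _ c1 c2).
Qed.

Definition lnu t : R := ln (1 - expR (- t)).
(* The real and imaginary parts of exp ((b + iy) l); at l = lnu t, of (1 - e^-t)^(b + iy). *)
Definition ecos b y (l : R) : R := expR (b * l) * cos (y * l).
Definition esin b y (l : R) : R := expR (b * l) * sin (y * l).

Lemma u_gt0 t : 0 < t -> 0 < 1 - expR (- t).
Proof. by move=> t0; rewrite subr_gt0 expR_lt1 oppr_lt0. Qed.

Lemma u_ge0 t : 0 <= t -> 0 <= 1 - expR (- t).
Proof. by rewrite le_eqVlt => /predU1P[<-|/u_gt0/ltW//]; rewrite oppr0 expR0 subrr. Qed.

Lemma is_derive_continuous (f : R -> R) x df : is_derive x (1 : R) f df -> {for x, continuous f}.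
Proof. by move=> [d _]; apply: differentiable_continuous; apply/derivable1_diffP. Qed.

Lemma is_derive_lnu t : 0 < t -> is_derive t (1 : R) lnu (expR (- t) / (1 - expR (- t))).
Proof.
move=> t0; have u0 := u_gt0 t0.
have d1 : is_derive t (1 : R) (expR \o -%R) (expR (- t) * -1).
  exact: is_derive1_comp (is_derive_expR (- t)) (is_deriveNid t 1).
have d2 : is_derive t (1 : R) (cst 1 - (expR \o -%R)) (0 - expR (- t) * -1).
  exact: is_deriveB (is_derive_cst _ _ _) d1.
have d3 : is_derive ((cst 1 - (expR \o -%R)) t) (1 : R) (@ln R) (1 - expR (- t))^-1.
  exact: is_derive1_ln u0.
have := is_derive1_comp d3 d2.
by move=> h; apply: is_derive_eq h _; rewrite sub0r mulrN1 opprK mulrC.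
Qed.

Lemma is_derive_scale (c l : R) : is_derive l (1 : R) ( *%R c) c.
Proof.
have := is_deriveZ c (is_derive_id l (1 : R)).
by move=> h; apply: is_derive_eq h _; rewrite /GRing.scale/= mulr1.
Qed.

Lemma is_derive_ecos b y l : is_derive l (1 : R) (ecos b y) (b * ecos b y l - y * esin b y l).
Proof.
have d1 := is_derive1_comp (is_derive_expR (b * l)) (is_derive_scale b l).
have d2 := is_derive1_comp (is_derive_cos (y * l)) (is_derive_scale y l).
have := is_deriveM d1 d2.
by move=> h; apply: is_derive_eq h _; rewrite /GRing.scale/= /ecos /esin; ring.
Qed.

Lemma is_derive_esin b y l : is_derive l (1 : R) (esin b y) (b * esin b y l + y * ecos b y l).
Proof.
have d1 := is_derive1_comp (is_derive_expR (b * l)) (is_derive_scale b l).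
have d2 := is_derive1_comp (is_derive_sin (y * l)) (is_derive_scale y l).
have := is_deriveM d1 d2.
by move=> h; apply: is_derive_eq h _; rewrite /GRing.scale/= /ecos /esin; ring.
Qed.

Lemma expR_lnuB1 b t : 0 < t -> expR (b * lnu t) / (1 - expR (- t)) = expR ((b - 1) * lnu t).
Proof.
by move=> t0; rewrite mulrBl mul1r expRD [expR (- lnu t)]expRN /lnu lnK// posrE u_gt0.
Qed.

Lemma is_derive_ecos_lnu b y t : 0 < t -> is_derive t (1 : R) (ecos b y \o lnu)
  (expR (- t) * (b * ecos (b - 1) y (lnu t) - y * esin (b - 1) y (lnu t))).
Proof.
move=> t0; have := is_derive1_comp (is_derive_ecos b y (lnu t)) (is_derive_lnu t0).
by move=> h; apply: is_derive_eq h _; rewrite /ecos /esin -expR_lnuB1//; ring.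
Qed.

Lemma is_derive_esin_lnu b y t : 0 < t -> is_derive t (1 : R) (esin b y \o lnu)
  (expR (- t) * (b * esin (b - 1) y (lnu t) + y * ecos (b - 1) y (lnu t))).
Proof.
move=> t0; have := is_derive1_comp (is_derive_esin b y (lnu t)) (is_derive_lnu t0).
by move=> h; apply: is_derive_eq h _; rewrite /ecos /esin -expR_lnuB1//; ring.
Qed.

Lemma continuous_ecos_lnu b y t : 0 < t -> {for t, continuous (fun t => expR (- t) * ecos b y (lnu t))}.
Proof.
move=> t0; apply: (@continuousM _ _ (expR \o -%R) (ecos b y \o lnu)).
  apply: continuous_comp; [exact: opp_continuous|exact: continuous_expR].
apply: continuous_comp; [exact: is_derive_continuous (is_derive_lnu t0)|].
exact: is_derive_continuous (is_derive_ecos _ _ _).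
Qed.

Lemma continuous_esin_lnu b y t : 0 < t -> {for t, continuous (fun t => expR (- t) * esin b y (lnu t))}.
Proof.
move=> t0; apply: (@continuousM _ _ (expR \o -%R) (esin b y \o lnu)).
  apply: continuous_comp; [exact: opp_continuous|exact: continuous_expR].
apply: continuous_comp; [exact: is_derive_continuous (is_derive_lnu t0)|].
exact: is_derive_continuous (is_derive_esin _ _ _).
Qed.

Lemma lnu_cvgy : lnu t @[t --> +oo] --> (0 : R).
Proof.
rewrite -(ln1 R); apply: continuous_cvg; first exact: continuous_ln.
rewrite -[X in _ --> X]subr0; apply: cvgB; [exact: cvg_cst|exact: cvgr_expR].
Qed.

Lemma ecos_lnu_cvgy b y : (ecos b y \o lnu) t @[t --> +oo] --> (1 : R).
Proof.
have -> : (1 : R) = ecos b y 0 by rewrite /ecos !mulr0 expR0 cos0 mulr1.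
apply: continuous_cvg lnu_cvgy; exact: is_derive_continuous (is_derive_ecos _ _ _).
Qed.

Lemma esin_lnu_cvgy b y : (esin b y \o lnu) t @[t --> +oo] --> (0 : R).
Proof.
have -> : (0 : R) = esin b y 0 by rewrite /esin !mulr0 expR0 sin0 mulr0.
apply: continuous_cvg lnu_cvgy; exact: is_derive_continuous (is_derive_esin _ _ _).
Qed.

Lemma expR_lnu_cvg0 b : 0 < b -> expR (b * lnu (n.+1%:R^-1)) @[n --> \oo] --> (0 : R).
Proof.
move=> b0; apply: (squeeze_cvgr _ (cvg_cst 0) (natr_powRN_cvg0 b0)); apply: nearW => n.
have n0 : (0 : R) < n.+1%:R^-1 by rewrite invr_gt0.
rewrite expR_ge0/=; set t := n.+1%:R^-1 in n0 *.
have -> : (n.+1%:R : R) `^ (- b) = t `^ b.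
  by rewrite /t -powR_inv1// -powRrM mulN1r.
have u0 := u_gt0 n0.
have -> : expR (b * lnu t) = (1 - expR (- t)) `^ b by rewrite /powR gt_eqF.
apply: ge0_ler_powR; rewrite ?nnegrE ?(ltW b0) ?(ltW u0) ?(ltW n0)//.
by rewrite lerBlDr -lerBlDl; have := expR_ge1Dx (- t); rewrite addrC.
Qed.

Lemma ecos_lnu_cvg0 b y : 0 < b -> ecos b y (lnu (n.+1%:R^-1)) @[n --> \oo] --> (0 : R).
Proof.
move=> b0; apply: norm_cvg0; apply: (squeeze_cvgr _ (cvg_cst 0) (expR_lnu_cvg0 b0)).
apply: nearW => n; rewrite normr_ge0/= /ecos normrM ger0_norm ?expR_ge0//.
by rewrite ler_piMr ?expR_ge0// ler_norml cos_geN1 cos_le1.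
Qed.

Lemma esin_lnu_cvg0 b y : 0 < b -> esin b y (lnu (n.+1%:R^-1)) @[n --> \oo] --> (0 : R).
Proof.
move=> b0; apply: norm_cvg0; apply: (squeeze_cvgr _ (cvg_cst 0) (expR_lnu_cvg0 b0)).
apply: nearW => n; rewrite normr_ge0/= /esin normrM ger0_norm ?expR_ge0//.
by rewrite ler_piMr ?expR_ge0// ler_norml sin_geN1 sin_le1.
Qed.

End ImproperFTC.

Lemma Rintegral_lin d (T : measurableType d) (R : realType) (mu : {measure set T -> \bar R})
    (D : set T) (a c : R) (f g : T -> R) : measurable D ->
  mu.-integrable D (EFin \o f) -> mu.-integrable D (EFin \o g) ->
  mu.-integrable D (EFin \o (fun t => a * f t + c * g t)) /\
  \int[mu]_(t in D) (a * f t + c * g t) =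
    a * \int[mu]_(t in D) f t + c * \int[mu]_(t in D) g t.
Proof.
move=> mD fi gi.
have Zi (x : R) h : mu.-integrable D (EFin \o h) -> mu.-integrable D (EFin \o (fun t => x * h t)).
  by move=> hi; apply: (eq_integrable mD _ _ _ (integrableZl mD x hi)) => t _; rewrite /= EFinM.
have afi := Zi a _ fi; have cgi := Zi c _ gi.
split; first by apply: (eq_integrable mD _ _ _ (integrableD mD afi cgi)) => t _; rewrite /= EFinD.
by rewrite RintegralD// !RintegralZl.
Qed.

Section BetaIntegral.
Variable R : realType.
Local Notation mu := (@lebesgue_measure R).
Local Notation D := (`]0, +oo[%classic : set R).
Implicit Types (b y t a c : R) (m j n N : nat).

Lemma in_itv0y t : D t = (0 < t) :> Prop.
Proof. by rewrite /= in_itv/= andbT. Qed.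

Let mu_lin (a c : R) (f g : R -> R) :=
  @Rintegral_lin _ _ R mu D a c f g (@measurable_itv R `]0, +oo[).

Lemma cintegral_lin (z w : R[i]) (g h : R -> R[i]) : cintegrable g -> cintegrable h ->
  cintegrable (fun t => z * g t + w * h t) /\
  cintegral (fun t => z * g t + w * h t) = z * cintegral g + w * cintegral h.
Proof.
move=> [gr gi] [hr hi]; case: z w => [a b] [c d].
have [r1 e1] := mu_lin a (- b) gr gi; have [r2 e2] := mu_lin c (- d) hr hi.
have [r3 e3] := mu_lin 1 1 r1 r2.
have [i1 e4] := mu_lin b a gr gi; have [i2 e5] := mu_lin d c hr hi.
have [i3 e6] := mu_lin 1 1 i1 i2.
have -> : (fun t : R => (a +i* b) * g t + (c +i* d) * h t) = (fun t =>
    (1 * (a * complex.Re (g t) + - b * complex.Im (g t)) + 1 * (c * complex.Re (h t) + - d * complex.Im (h t))) +i*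
    (1 * (b * complex.Re (g t) + a * complex.Im (g t)) + 1 * (d * complex.Re (h t) + c * complex.Im (h t)))).
  apply/funext => t; case: (g t) (h t) => [x y] [x' y'].
  by apply/eqP; rewrite eq_complex/=; apply/andP; split; apply/eqP; ring.
split; first by split; [exact: r3|exact: i3].
rewrite /cintegral/= e3 e6 e1 e2 e4 e5.
by apply/eqP; rewrite eq_complex/=; apply/andP; split; apply/eqP; ring.
Qed.

Lemma eq_cintegral (g h : R -> R[i]) : (forall t : R, 0 < t -> g t = h t) ->
  cintegrable g -> cintegrable h /\ cintegral g = cintegral h.
Proof.
move=> gh [gr gi]; have e t : t \in D -> g t = h t by rewrite inE in_itv0y; exact: gh.
split; first split.
- by apply: (eq_integrable _ _ _ _ gr) => [|t tD]; [exact: measurable_itv|rewrite e].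
- by apply: (eq_integrable _ _ _ _ gi) => [|t tD]; [exact: measurable_itv|rewrite e].
by rewrite /cintegral; congr (_ +i* _); apply: eq_Rintegral => t tD; rewrite e.
Qed.

Lemma cintegral0 : cintegrable (fun=> 0 : R[i]) /\ cintegral (fun=> 0 : R[i]) = 0.
Proof.
have mD := @measurable_itv R `]0, +oo[.
split; first by split; exact: integrable0.
by rewrite /cintegral /Rintegral integral0.
Qed.

Lemma cintegral_sum N (w : nat -> R[i]) (g : nat -> R -> R[i]) :
  (forall j, cintegrable (g j)) ->
  cintegrable (fun t => \sum_(j < N) w j * g j t) /\
  cintegral (fun t => \sum_(j < N) w j * g j t) = \sum_(j < N) w j * cintegral (g j).
Proof.
move=> gi; elim: N => [|N [IH1 IH2]].
  have [h1 h2] := cintegral0.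
  have E : (fun t : R => \sum_(j < 0) w j * g j t) = (fun=> 0).
    by apply/funext => t; rewrite big_ord0.
  by rewrite E h2 big_ord0.
have [h1 h2] := cintegral_lin 1 (w N) IH1 (gi N).
have E : (fun t : R => \sum_(j < N.+1) w j * g j t) =
    (fun t => 1 * \sum_(j < N) w j * g j t + w N * g N t).
  by apply/funext => t; rewrite big_ord_recr/= mul1r.
by rewrite E h2 IH2 big_ord_recr/= mul1r.
Qed.

Section Base.
Variables (b y : R).
Hypothesis b0 : 0 < b.

Let w t := expR (- t) * ecos (b - 1) 0 (lnu t).
Let p t := expR (- t) * ecos (b - 1) y (lnu t).
Let q t := expR (- t) * esin (b - 1) y (lnu t).

Let wE t : w t = expR (- t) * expR ((b - 1) * lnu t).
Proof. by rewrite /w /ecos mul0r cos0 mulr1. Qed.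

Let w0 t : 0 <= w t. Proof. by rewrite wE mulr_ge0// expR_ge0. Qed.

Let pw t : `|p t| <= w t.
Proof.
rewrite wE /p /ecos mulrA normrM ger0_norm ?mulr_ge0 ?expR_ge0//.
by rewrite ler_piMr ?mulr_ge0 ?expR_ge0// ler_norml cos_geN1 cos_le1.
Qed.

Let qw t : `|q t| <= w t.
Proof.
rewrite wE /q /esin mulrA normrM ger0_norm ?mulr_ge0 ?expR_ge0//.
by rewrite ler_piMr ?mulr_ge0 ?expR_ge0// ler_norml sin_geN1 sin_le1.
Qed.

Let wc t : 0 < t -> {for t, continuous w}. Proof. exact: continuous_ecos_lnu. Qed.
Let pc t : 0 < t -> {for t, continuous p}. Proof. exact: continuous_ecos_lnu. Qed.
Let qc t : 0 < t -> {for t, continuous q}. Proof. exact: continuous_esin_lnu. Qed.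

Let W t := b^-1 * ecos b 0 (lnu t).

Let dW t : 0 < t -> is_derive t (1 : R) W (w t).
Proof.
move=> t0; have d := is_deriveZ b^-1 (is_derive_ecos_lnu b 0 t0).
apply: is_derive_eq d _; rewrite /w mul0r subr0 /GRing.scale/=.
by rewrite mulrCA mulKf// gt_eqF.
Qed.

Let W0 : W (n.+1%:R^-1) @[n --> \oo] --> (0 : R).
Proof. by rewrite -(mulr0 b^-1); apply: cvgM; [exact: cvg_cst|exact: ecos_lnu_cvg0]. Qed.

Let Wy : W t @[t --> +oo] --> (b^-1 : R).
Proof. by rewrite -[X in _ --> X]mulr1; apply: cvgM; [exact: cvg_cst|exact: ecos_lnu_cvgy]. Qed.

Let wint : (\int[mu]_(t in D) (w t)%:E = (b^-1)%:E)%E.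
Proof.
rewrite -[in RHS](subr0 b^-1); apply: (@ge0_continuous_FTC0y _ w W 0 b^-1).
- by move=> t _; exact: w0.
- exact: wc.
- exact: dW.
- exact: W0.
- exact: Wy.
Qed.

Let mfun (f : R -> R) : (forall t : R, 0 < t -> {for t, continuous f}) -> measurable_fun D (EFin \o f).
Proof.
move=> fc; apply/measurable_EFinP; apply: open_continuous_measurable_fun; first exact: interval_open.
by move=> x; rewrite inE/= in_itv/= andbT; exact: fc.
Qed.

Let wi : mu.-integrable D (EFin \o w).
Proof.
apply/integrableP; split; first exact: mfun.
apply: (@le_lt_trans _ _ (b^-1)%:E); last exact: ltry.
rewrite -wint le_eqVlt; apply/orP; left; apply/eqP; apply: eq_integral => t _.
by rewrite /= ger0_norm.
Qed.

Let dom (f : R -> R) : (forall t : R, 0 < t -> {for t, continuous f}) -> (forall t, `|f t| <= w t) ->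
  mu.-integrable D (EFin \o f).
Proof.
move=> fc fw; apply: (le_integrable _ _ _ wi); [exact: measurable_itv|exact: mfun|].
by move=> t _ /=; rewrite lee_fin [leRHS]ger0_norm.
Qed.

Let p_int : mu.-integrable D (EFin \o p). Proof. exact: dom. Qed.
Let q_int : mu.-integrable D (EFin \o q). Proof. exact: dom. Qed.

(* A signed integrand is made nonnegative by adding a multiple of w. *)
Let signed_FTC (c d A B : R) (F : R -> R) :
  (forall t : R, 0 < t -> is_derive t (1 : R) F (c * p t + d * q t)) ->
  (F (n.+1%:R^-1) @[n --> \oo] --> A) -> (F x @[x --> +oo] --> B) ->
  c * \int[mu]_(t in D) p t + d * \int[mu]_(t in D) q t = B - A.
Proof.
move=> dF FA FB; have bn0 : b != 0 by rewrite gt_eqF.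
pose K := `|c| + `|d|.
have [fi fE] := mu_lin c d p_int q_int.
have [gi gE] := mu_lin 1 K fi wi.
have wR : \int[mu]_(t in D) w t = b^-1 by rewrite /Rintegral wint.
have : \int[mu]_(t in D) (1 * (c * p t + d * q t) + K * w t) = (B + K * b^-1) - (A + K * 0).
  rewrite /Rintegral.
  have -> // : (\int[mu]_(t in D) (1 * (c * p t + d * q t) + K * w t)%:E = (B + K * b^-1 - (A + K * 0))%:E)%E.
  apply: (@ge0_continuous_FTC0y _ _ (fun t => F t + K * W t) (A + K * 0) (B + K * b^-1)).
  - move=> t t0; rewrite mul1r -lerBlDr sub0r.
    have : `|c * p t + d * q t| <= K * w t.
      rewrite (le_trans (ler_normD _ _))// /K mulrDl.
      by apply: lerD; rewrite normrM; apply: ler_wpM2l; rewrite ?normr_ge0 ?pw ?qw.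
    by rewrite ler_norml => /andP[].
  - move=> t t0; apply: (@continuousD _ _ _ (fun t => 1 * (c * p t + d * q t)) (fun t => K * w t)).
      apply: (@continuousM _ _ (cst 1) (fun t => c * p t + d * q t)); first exact: cvg_cst.
      apply: (@continuousD _ _ _ (fun t => c * p t) (fun t => d * q t)).
        by apply: (@continuousM _ _ (cst c) p); [exact: cvg_cst|exact: pc].
      by apply: (@continuousM _ _ (cst d) q); [exact: cvg_cst|exact: qc].
    by apply: (@continuousM _ _ (cst K) w); [exact: cvg_cst|exact: wc].
  - move=> t t0; have d2 := is_deriveD (dF t t0) (is_deriveZ K (dW t0)).
    by apply: is_derive_eq d2 _; rewrite /GRing.scale/= mul1r.
  - by apply: cvgD; [exact: FA|apply: cvgM; [exact: cvg_cst|exact: W0]].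
  - by apply: cvgD; [exact: FB|apply: cvgM; [exact: cvg_cst|exact: Wy]].
rewrite gE wR fE mul1r mulr0 addr0 => /eqP; rewrite -subr_eq0 => /eqP h.
by apply/eqP; rewrite -subr_eq0 -[X in _ == X]h; apply/eqP; ring.
Qed.

(** With z = b + iy, the two equations are the real and imaginary parts of z times the integral of
    e^-t (1 - e^-t)^(z - 1) being 1: the antiderivative (1 - e^-t)^z runs from 0 to 1. *)
Lemma beta_base : [/\ mu.-integrable D (EFin \o p), mu.-integrable D (EFin \o q),
  b * \int[mu]_(t in D) p t - y * \int[mu]_(t in D) q t = 1 &
  y * \int[mu]_(t in D) p t + b * \int[mu]_(t in D) q t = 0].
Proof.
split; [exact: p_int|exact: q_int| |].
- rewrite -mulNr -[RHS]subr0; apply: (@signed_FTC b (- y) 0 1 (ecos b y \o @lnu R)).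
  + by move=> t t0; apply: is_derive_eq (is_derive_ecos_lnu b y t0) _; rewrite /p /q; ring.
  + exact: ecos_lnu_cvg0.
  + exact: ecos_lnu_cvgy.
- rewrite -[RHS]subr0; apply: (@signed_FTC y b 0 0 (esin b y \o @lnu R)).
  + by move=> t t0; apply: is_derive_eq (is_derive_esin_lnu b y t0) _; rewrite /p /q; ring.
  + exact: esin_lnu_cvg0.
  + exact: esin_lnu_cvgy.
Qed.

End Base.

(** Under x = e^-t its integral over the half-line is B(z + m, j + 1). *)
Definition beta_integrand (z : R[i]) m j t : R[i] :=
  cpower (1 - expR (- t)) (z - 1) *
    ((1 - expR (- t)) ^+ m * expR (- (t * j.+1%:R)))%:C.

Lemma beta_integrand00 z : 0 < complex.Re z -> cintegrable (beta_integrand z 0 0) /\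
  z * cintegral (beta_integrand z 0 0) = 1.
Proof.
case: z => b y /= b0; have [pi qi e1 e2] := beta_base y b0.
have -> : beta_integrand (b +i* y) 0 0 = (fun t => (expR (- t) * ecos (b - 1) y (lnu t)) +i*
    (expR (- t) * esin (b - 1) y (lnu t))).
  apply/funext => t; rewrite /beta_integrand /cpower expr0 mul1r mulr1.
  by apply/eqP; rewrite eq_complex/= subr0 /ecos /esin /lnu; apply/andP; split; apply/eqP; ring.
split; first by split.
rewrite /cintegral/=.
by apply/eqP; rewrite eq_complex/= e1 addrC e2 !eqxx.
Qed.

Lemma cpower_addn (x : R) z m : 0 < x -> cpower x z * (x ^+ m)%:C = cpower x (z + m%:R).
Proof.
move=> x0; rewrite /cpower Re_addn Im_addn mulrDl expRD expRM_natl lnK ?posrE//.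
by rewrite rmorphM/= mulrAC.
Qed.

Lemma beta_integrand_j0 z m t : 0 < t ->
  beta_integrand z m 0 t = beta_integrand (z + m%:R) 0 0 t.
Proof.
move=> t0; rewrite /beta_integrand rmorphM mulrA/= cpower_addn ?u_gt0// expr0 mul1r.
by congr (cpower _ _ * _); rewrite addrAC.
Qed.

Lemma beta_integrandS z m j t :
  beta_integrand z m j.+1 t = 1 * beta_integrand z m j t + (- 1) * beta_integrand z m.+1 j t.
Proof.
rewrite /beta_integrand mul1r mulN1r -mulrBr -rmorphB/=; congr (_ * _%:C).
have -> : expR (- (t * j.+2%:R)) = expR (- (t * j.+1%:R)) * expR (- t).
  by rewrite -expRD -[j.+2%:R]natr1; congr expR; ring.
by rewrite exprS; ring.
Qed.

(** [H m j] is z B(z + m, j + 1) in rational form, and the identity is B(x, y + 1) = B(x, y) - B(x +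
    1, y), the recursion of the integrals in [beta_integrandS]. *)
Lemma beta_kernel_pascal (F : numFieldType) (z : F) m j : (forall i, 1 + z + i%:R != 0) ->
  let H m j := beta_kernel 1 z (m + j) j / 'C(m + j, j)%:R in
  H m j.+1 = H m j - H m.+1 j.
Proof.
move=> hz /=; rewrite !beta_kernel1E' ?leq_addl// !addnK addnS addSn.
have C0 : ('C(m + j, j)%:R : F) != 0 by rewrite pnatr_eq0 -lt0n bin_gt0 leq_addl.
have k0 := cesaro_num_neq0 (m + j) hz.
have N0 : ((m + j).+1%:R : F) != 0 by rewrite pnatr_eq0.
have m0 : (m.+1%:R : F) != 0 by rewrite pnatr_eq0.
have j0 : (j.+1%:R : F) != 0 by rewrite pnatr_eq0.
have e1 : ('C((m + j).+1, j.+1)%:R : F) = (m + j).+1%:R * 'C(m + j, j)%:R / j.+1%:R.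
  by apply: (mulIf j0); rewrite divfK// -!natrM mulnC -mul_bin_diag.
have e2 : ('C((m + j).+1, j)%:R : F) = (m + j).+1%:R * 'C(m + j, j)%:R / m.+1%:R.
  apply: (mulIf m0); rewrite divfK// -!natrM; congr (_%:R).
  by have /= -> := mul_bin_down (m + j).+1 j; rewrite subSn ?leq_addl// addnK mulnC.
rewrite e1 e2 !cesaro_numS; have hN := hz (m + j)%N.
move: C0 k0 N0 m0 j0 hN; move: (cesaro_num z m) (cesaro_num _ _) ('C(_, _)%:R) => x d C.
rewrite -!natr1 natrD => C0 k0 N0 m0 j0 hN; field.
by do ?(apply/andP; split).
Qed.

Lemma cintegral_beta z m j : 0 < complex.Re z -> cintegrable (beta_integrand z m j) /\
  z * cintegral (beta_integrand z m j) = beta_kernel 1 z (m + j) j / 'C(m + j, j)%:R.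
Proof.
move=> z0; elim: j m => [|j IH] m.
  rewrite addn0 bin0 divr1 beta_kernel1_col0//.
  have zm : 0 < complex.Re (z + m%:R) by rewrite Re_addn ltr_wpDr.
  have [h1 h2] := beta_integrand00 zm.
  have [g1 g2] := eq_cintegral (fun t tp => esym (beta_integrand_j0 z m tp)) h1.
  split=> //; rewrite -g2; congr (z * _).
  by apply: (mulfI (Re_gt0_neq0 m z0)); rewrite h2 divff// Re_gt0_neq0.
have [h1 e1] := IH m; have [h2 e2] := IH m.+1.
have [h3 e3] := cintegral_lin 1 (- 1) h1 h2.
have E : beta_integrand z m j.+1 = (fun t => 1 * beta_integrand z m j t + (- 1) * beta_integrand z m.+1 j t).
  by apply/funext => t; rewrite beta_integrandS.
rewrite E; split; first exact: h3.
rewrite e3 mul1r mulN1r mulrBr e1 e2 (beta_kernel_pascal m j (one_addn_neq0 z0)).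
by [].
Qed.

End BetaIntegral.

(** * Integral representations *)

Section SeriesIntegral.
Context d (T : measurableType d) (R : realType).
Variables (mu : {measure set T -> \bar R}) (D : set T) (mD : measurable D).

Lemma EFin_Rintegral (f : T -> R) : mu.-integrable D (EFin \o f) ->
  (\int[mu]_(x in D) (f x)%:E = (\int[mu]_(x in D) f x)%:E)%E.
Proof. by move=> fi; rewrite /Rintegral fineK//; exact: (integrable_fin_num mD fi). Qed.

(** The dominating function is the series of the h i in the extended reals; its integral is at most
    M by monotone convergence. *)
Lemma Rintegral_series (f h : nat -> T -> R) (F : T -> R) (M : R) :
  (forall i, mu.-integrable D (EFin \o f i)) -> (forall i, mu.-integrable D (EFin \o h i)) ->
  (forall i x, D x -> `|f i x| <= h i x) ->
  (forall N, \sum_(i < N) \int[mu]_(x in D) h i x <= M) ->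
  (forall x, D x -> (\sum_(i < N) f i x) @[N --> \oo] --> F x) ->
  mu.-integrable D (EFin \o F) /\
  (\sum_(i < N) \int[mu]_(x in D) f i x) @[N --> \oo] --> \int[mu]_(x in D) F x.
Proof.
move=> fi hi fh hM fF.
have h0 i x : D x -> 0 <= h i x by move=> Dx; exact: le_trans (normr_ge0 _) (fh i x Dx).
pose f_ N x : \bar R := (\sum_(i < N) f i x)%:E.
have f_E N x : f_ N x = (\sum_(i <- index_enum 'I_N) (f i x)%:E)%E by rewrite /f_ sumEFin.
have f_i N : mu.-integrable D (f_ N).
  have -> : f_ N = (fun x => \sum_(i <- index_enum 'I_N) (f i x)%:E)%E by apply/funext => x; exact: f_E.
  by apply: (integrable_sum mD) => i _; exact: fi.
have f_int N : (\int[mu]_(x in D) f_ N x = (\sum_(i < N) \int[mu]_(x in D) f i x)%:E)%E.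
  under eq_integral do rewrite f_E.
  rewrite (@integral_sum _ _ _ mu D mD _ (fun (i : 'I_N) x => (f i x)%:E))//; last by move=> i; exact: fi.
  rewrite -sumEFin; apply: eq_bigr => i _.
  by rewrite EFin_Rintegral.
have fFE x : D x -> f_ ^~ x @ \oo --> (F x)%:E.
  by move=> Dx; apply: cvg_EFin; [exact: nearW|exact: fF].
pose g x : \bar R := (\sum_(0 <= i <oo) (h i x)%:E)%E.
have mh i : measurable_fun D (EFin \o h i) by exact: (measurable_int mu).
have mg : measurable_fun D g.
  have h0' i x : D x -> xpredT i -> (0 <= (h i x)%:E)%E by move=> Dx _; rewrite lee_fin h0.
  exact: (@ge0_emeasurable_sum _ _ _ D (fun i x => (h i x)%:E) xpredT h0' (fun i _ => mh i)).
have g0 x : D x -> (0 <= g x)%E by move=> Dx; apply: nneseries_ge0 => i _ _; rewrite lee_fin h0.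
have gi : mu.-integrable D g.
  apply/integrableP; split => //.
  apply: (@le_lt_trans _ _ M%:E); last exact: ltry.
  apply: (@le_trans _ _ (\int[mu]_(x in D) g x)%E).
    rewrite le_eqVlt; apply/orP; left; apply/eqP; apply: eq_integral => x; rewrite inE => Dx.
    by rewrite gee0_abs// g0.
  rewrite (integral_nneseries mu mD mh); last by move=> i x Dx; rewrite lee_fin h0.
  apply: lime_le.
    by apply: is_cvg_nneseries => i _ _; apply: integral_ge0 => x Dx; rewrite lee_fin h0.
  apply: nearW => N; rewrite big_mkord; apply: le_trans (_ : (\sum_(i < N) \int[mu]_(x in D) h i x)%:E <= _)%E.
    rewrite -sumEFin le_eqVlt; apply/orP; left; apply/eqP; apply: eq_bigr => i _.
    by rewrite EFin_Rintegral.
  by rewrite lee_fin.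
have [Fi _ Fc] : [/\ mu.-integrable D (EFin \o F),
    (\int[mu]_(x in D) `|f_ n x - (F x)%:E|)%E @[n --> \oo] --> 0%E &
    (\int[mu]_(x in D) f_ n x)%E @[n --> \oo] --> (\int[mu]_(x in D) (F x)%:E)%E].
  apply: (@dominated_convergence _ _ _ mu D mD f_ (EFin \o F) g) => //.
  - by move=> n; exact: (measurable_int mu).
  - apply: (@emeasurable_fun_cvg _ _ _ D f_); last exact: fFE.
    by move=> n; exact: (measurable_int mu).
  - by apply: aeW => x Dx; exact: fFE.
  - apply: aeW => x n Dx.
    apply: (@le_trans _ _ (\sum_(0 <= i < n) (h i x)%:E)%E).
      rewrite big_mkord sumEFin lee_fin (le_trans (ler_norm_sum _ _ _))//.
      by apply: ler_sum => i _; exact: fh.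
    by apply: nneseries_lim_ge => i _ _; rewrite lee_fin h0.
split; first exact: Fi.
have -> : (fun N => \sum_(i < N) \int[mu]_(x in D) f i x) = (fun N => fine (\int[mu]_(x in D) f_ N x)%E).
  by apply/funext => N; rewrite f_int.
by apply: fine_cvg; rewrite -(EFin_Rintegral Fi); exact: Fc.
Qed.

End SeriesIntegral.

Section ComplexSeriesIntegral.
Variable R : realType.
Local Notation mu := (@lebesgue_measure R).
Local Notation D := (`]0, +oo[%classic : set R).

Lemma cintegral_series (g : nat -> R -> R[i]) (h : nat -> R -> R) (F : R -> R[i]^o) (M : R) :
  (forall i, cintegrable (g i)) -> (forall i, mu.-integrable D (EFin \o h i)) ->
  (forall i (t : R), 0 < t -> modulus (g i t) <= h i t) ->
  (forall N, \sum_(i < N) \int[mu]_(t in D) h i t <= M) ->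
  (forall t : R, 0 < t -> (\sum_(i < N) g i t : R[i]^o) @[N --> \oo] --> F t) ->
  cintegrable F /\
  (\sum_(i < N) cintegral (g i) : R[i]^o) @[N --> \oo] --> (cintegral F : R[i]^o).
Proof.
move=> gi hi gh hM gF.
have sRe N (u : nat -> R[i]) : complex.Re (\sum_(i < N) u i) = \sum_(i < N) complex.Re (u i).
  by rewrite raddf_sum.
have sIm N (u : nat -> R[i]) : complex.Im (\sum_(i < N) u i) = \sum_(i < N) complex.Im (u i).
  by rewrite raddf_sum.
have Dp t : D t -> 0 < t by rewrite in_itv0y.
have S := fun f F' fi fh fF => @Rintegral_series _ _ R mu D (@measurable_itv R `]0, +oo[) f h F' M fi hi fh hM fF.
have cRe t : D t -> (\sum_(i < N) complex.Re (g i t)) @[N --> \oo] --> complex.Re (F t).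
  by move=> Dt; have [c _] := (ccvgP_ReIm _ _).1 (gF t (Dp t Dt)); under eq_fun do rewrite -(sRe _ (fun i => g i t)).
have cIm t : D t -> (\sum_(i < N) complex.Im (g i t)) @[N --> \oo] --> complex.Im (F t).
  by move=> Dt; have [_ c] := (ccvgP_ReIm _ _).1 (gF t (Dp t Dt)); under eq_fun do rewrite -(sIm _ (fun i => g i t)).
have [r1 r2] := S _ _ (fun i => (gi i).1)
  (fun i t Dt => le_trans (Re_le_modulus _) (gh i t (Dp t Dt))) cRe.
have [i1 i2] := S _ _ (fun i => (gi i).2)
  (fun i t Dt => le_trans (Im_le_modulus _) (gh i t (Dp t Dt))) cIm.
split; first by split; [exact: r1|exact: i1].
apply/ccvgP_ReIm; split.
  by apply: cvg_trans r2; apply: near_eq_cvg; apply: nearW => N /=; rewrite (sRe N (fun i => cintegral (g i))).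
by apply: cvg_trans i2; apply: near_eq_cvg; apply: nearW => N /=; rewrite (sIm N (fun i => cintegral (g i))).
Qed.

End ComplexSeriesIntegral.

Section IntegralRepresentations.
Variable R : realType.
Local Notation mu := (@lebesgue_measure R).
Local Notation D := (`]0, +oo[%classic : set R).
Implicit Types (b t : R) (f : nat -> R[i]^o) (i j m n N : nat) (p : \bar R).

Lemma modulus_cpower (x : R) (z : R[i]) : modulus (cpower x z) = expR (complex.Re z * ln x).
Proof.
rewrite /cpower modulusM modulusR ger0_norm ?expR_ge0// -[RHS]mulr1; congr (_ * _).
by rewrite /modulus/= cos2Dsin2 sqrtr1.
Qed.

(** This makes the dominating series explicitly integrable, by [Rintegral_beta] at order Re z. *)
Lemma modulus_beta_integrand (z : R[i]) m j t : 0 <= t ->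
  modulus (beta_integrand z m j t) = complex.Re (beta_integrand (complex.Re z)%:C m j t).
Proof.
move=> t0; rewrite /beta_integrand modulusM modulus_cpower modulusR ger0_norm; last first.
  by rewrite mulr_ge0 ?expR_ge0// exprn_ge0// u_ge0.
by case: z => b y; rewrite /cpower/= !subr0 !mul0r cos0 sin0 mulr1 !mulr0 !subr0.
Qed.

Lemma beta_kernel_complex (a b : R) n l :
  beta_kernel (a%:C : R[i]) b%:C n l = (beta_kernel a b n l)%:C.
Proof.
rewrite /beta_kernel; case: ifP => // _.
have -> : (a%:C : R[i]) + b%:C = (a + b)%:C by rewrite rmorphD.
by rewrite -!cesaro_num_complex; move: (cesaro_num _ _) (cesaro_num _ _) (cesaro_num _ _) => x y z; rewrite rmorphM rmorphM fmorphV.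
Qed.

Lemma Rintegral_beta b m j : 0 < b ->
  b * \int[mu]_(t in D) complex.Re (beta_integrand b%:C m j t) =
  beta_kernel 1 b (m + j) j / 'C(m + j, j)%:R.
Proof.
move=> b0; have [_ /(congr1 (@complex.Re R))] := @cintegral_beta R b%:C m j b0.
rewrite /cintegral/= mul0r subr0 => ->.
have -> : (1 : R[i]) = (1 : R)%:C by [].
by rewrite beta_kernel_complex -(rmorph_nat (real_complex R)) -fmorphV -rmorphM.
Qed.

(** The exponentials e^(-t (1 - 1/p)) and e^(-t/p) multiply to e^-t, the source of j + 1 in
    [beta_integrand]. *)
Lemma cesaro_integrandE (beta : R[i]) p f n t : cesaro_integrand beta p f n t =
  \sum_(j < n.+1) (f j * 'C(n, j)%:R) * beta_integrand beta (n - j) j t.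
Proof.
rewrite /cesaro_integrand /semigroup_T big_mkord mulrA -[X in X * _]mulrA -rmorphM/= -expRD.
have -> : - (t * (1 - inv_exponent p)) - t * inv_exponent p = - t by ring.
rewrite mulr_sumr; apply: eq_bigr => j _; rewrite /beta_integrand.
have -> : - (t * j.+1%:R) = - t - t * j%:R by rewrite -natr1; ring.
rewrite expRD !rmorphM/= rmorph_nat.
by move: (cpower _ _) (f j) => c x; ring.
Qed.

Lemma cesaro_integral (beta : R[i]) p f n : 0 < complex.Re beta ->
  cintegrable (cesaro_integrand beta p f n) /\
  cesaro_op beta f n = beta * cintegral (cesaro_integrand beta p f n).
Proof.
move=> b0; have -> : cesaro_integrand beta p f n = (fun t =>
    \sum_(j < n.+1) (f j * 'C(n, j)%:R) * beta_integrand beta (n - j) j t).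
  by apply/funext => t; exact: cesaro_integrandE.
have [h1 h2] := @cintegral_sum R n.+1 (fun j => f j * 'C(n, j)%:R)
  (fun j => beta_integrand beta (n - j) j) (fun j => (cintegral_beta (n - j) j b0).1).
split; first exact: h1.
rewrite h2 cesaro_opE /beta_mean mulr_sumr; apply: eq_bigr => j _.
rewrite mulrCA (cintegral_beta (n - j) j b0).2 subnK; last by rewrite -ltnS.
have C0 : ('C(n, j)%:R : R[i]) != 0 by rewrite pnatr_eq0 -lt0n bin_gt0 -ltnS.
by move: (beta_kernel _ _ _ _) (f j) => x y; field.
Qed.

(** Induction on n: by Pascal's rule, multiplying the partial sum by 1 - u lowers n, up to a
    boundary term that is subtracted. *)
Lemma binomial_series_le (u : R) n N : 0 <= u < 1 ->
  \sum_(i < N) 'C(n + i, n)%:R * u ^+ i <= (1 - u)^-1 ^+ n.+1.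
Proof.
move=> /andP[u0 u1]; have v0 : 0 < 1 - u by rewrite subr_gt0.
elim: n N => [|n IH] N.
  rewrite expr1 -[leRHS]mul1r ler_pdivlMr//.
  under eq_bigr do rewrite bin0 mul1r.
  have -> : (\sum_(i < N) u ^+ i) * (1 - u) = 1 - u ^+ N.
    by rewrite -[RHS]opprB subrX1 mulrC -mulNr opprB.
  by rewrite gerBl exprn_ge0.
have E : (1 - u) * (\sum_(i < N) 'C(n.+1 + i, n.+1)%:R * u ^+ i) =
    \sum_(i < N) 'C(n + i, n)%:R * u ^+ i - 'C(n + N, n.+1)%:R * u ^+ N.
  elim: N => [|N IHN].
    by rewrite !big_ord0 addn0 bin_small// mul0r mulr0 subr0.
  rewrite !big_ord_recr/= mulrDr IHN addSn addnS binS natrD exprS; ring.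
rewrite exprS mulrC ler_pdivlMr// mulrC E (le_trans _ (IH N))//.
by rewrite gerBl mulr_ge0// exprn_ge0.
Qed.

End IntegralRepresentations.

Section AdjointIntegral.
Variable R : realType.
Local Notation mu := (@lebesgue_measure R).
Local Notation D := (`]0, +oo[%classic : set R).
Implicit Types (t : R) (f : nat -> R[i]^o) (i j n N : nat) (p : \bar R).

Lemma semigroup_S_csum_cvg B f n t : bounded_by B f -> 0 <= t ->
  csum_cvg (fun i => semigroup_S_term t f n (n + i)).
Proof.
move=> fB t0; have B0 : 0 <= B := le_trans (modulus_ge0 _) (fB 0%N).
have u01 : 0 <= 1 - expR (- t) < 1 by rewrite u_ge0//= gtrBl expR_gt0.
apply: (@abs_bound_cvg _ ((1 - (1 - expR (- t)))^-1 ^+ n.+1 * B)) => N.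
apply: le_trans (ler_wpM2r B0 (binomial_series_le n N u01)); rewrite mulr_suml.
apply: ler_sum => i _; rewrite /semigroup_S_term addKn modulusM modulusR ger0_norm.
  by apply: ler_wpM2l; [rewrite mulr_ge0 ?exprn_ge0 ?u_ge0|exact: fB].
by rewrite mulr_ge0 ?exprn_ge0 ?u_ge0.
Qed.

Lemma cesaro_adj_integrand_cvg (beta : R[i]) p B f n t : bounded_by B f -> 0 <= t ->
  (\sum_(i < N) (f (n + i)%N * 'C(n + i, n)%:R) * beta_integrand beta i n t : R[i]^o)
    @[N --> \oo] --> (cesaro_adj_integrand beta p f n t : R[i]^o).
Proof.
move=> fB t0; have cv := @semigroup_S_csum_cvg B f n t fB t0.
rewrite /cesaro_adj_integrand /semigroup_S (sum_fromE cv) mulrA -[X in X * _]mulrA -rmorphM/= -expRD.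
have -> : - (t * inv_exponent p) - t * (1 - inv_exponent p + n%:R) = - (t * n.+1%:R).
  by rewrite -natr1; ring.
have := @ccvgMl _ (cpower (1 - expR (- t)) (beta - 1) * (expR (- (t * n.+1%:R)))%:C)
  (fun N => \sum_(i < N) semigroup_S_term t f n (n + i)) _ (csum_is_cvg cv).
apply: cvg_trans; apply: near_eq_cvg; apply: nearW => N /=.
rewrite mulr_sumr; apply: eq_bigr => i _; rewrite /semigroup_S_term /beta_integrand addKn.
rewrite !rmorphM/= rmorph_nat.
by move: (cpower _ _) (f _) => c x; ring.
Qed.

Variables (beta : R[i]) (r H : R) (f : nat -> R[i]^o).
Hypotheses (Rebeta_gt0 : 0 < complex.Re beta) (r1 : 1 <= r).
Hypothesis fH : lr_bound r H (fun j => modulus (f j)).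
Local Notation b := (complex.Re beta).

Lemma lr_bounded : bounded_by (H `^ r^-1) f.
Proof. by move=> n; apply: (lr_powR_le r1 n _ fH) => m; exact: modulus_ge0. Qed.

Lemma cesaro_adj_integral p n :
  cintegrable (cesaro_adj_integrand beta p f n) /\
  cesaro_adj beta f n = beta * cintegral (cesaro_adj_integrand beta p f n).
Proof.
have [M _ hM] := adj_row_bound r1 Rebeta_gt0 fH.
pose w i : R[i] := f (n + i)%N * 'C(n + i, n)%:R.
have C0 i : ('C(n + i, n)%:R : R) != 0 by rewrite pnatr_eq0 -lt0n bin_gt0 leq_addr.
have bi i := cintegral_beta i n Rebeta_gt0.
have ri i : mu.-integrable D (EFin \o (fun t => complex.Re (beta_integrand b%:C i n t))).
  by have [[]] := @cintegral_beta R b%:C i n Rebeta_gt0.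
have wi i : cintegrable (fun t => w i * beta_integrand beta i n t) /\
    cintegral (fun t => w i * beta_integrand beta i n t) = w i * cintegral (beta_integrand beta i n).
  have [h1 h2] := cintegral_lin (w i) 0 (bi i).1 (bi i).1.
  have E : (fun t => w i * beta_integrand beta i n t) =
    (fun t => w i * beta_integrand beta i n t + 0 * beta_integrand beta i n t).
    by apply/funext => t; rewrite mul0r addr0.
  by rewrite E h2 mul0r addr0.
have si i : mu.-integrable D (EFin \o (fun t => modulus (w i) * complex.Re (beta_integrand b%:C i n t))) /\
    \int[mu]_(t in D) (modulus (w i) * complex.Re (beta_integrand b%:C i n t)) =
    beta_kernel 1 b (n + i) n * modulus (f (n + i)%N) / b.
  have [h1 h2] := @Rintegral_lin _ _ R mu D (modulus (w i)) 0 _ _ (@measurable_itv R `]0, +oo[) (ri i) (ri i).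
  have E : (fun t => modulus (w i) * complex.Re (beta_integrand b%:C i n t)) = (fun t =>
      modulus (w i) * complex.Re (beta_integrand b%:C i n t) + 0 * complex.Re (beta_integrand b%:C i n t)).
    by apply/funext => t; rewrite mul0r addr0.
  rewrite E; split; first exact: h1.
  rewrite h2 mul0r addr0 /w modulusM modulus_natr.
  have := Rintegral_beta i n Rebeta_gt0; rewrite (addnC i n).
  move: (beta_kernel _ _ _ _) (\int[mu]_(t in D) _) (C0 i) => y z c0 e.
  have b0 : b != 0 by rewrite gt_eqF.
  have -> : z = y / 'C(n + i, n)%:R / b by rewrite -e mulrC mulKf.
  by field; rewrite ?c0 ?b0.
have gh i t : 0 < t -> modulus (w i * beta_integrand beta i n t) <=
    modulus (w i) * complex.Re (beta_integrand b%:C i n t).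
  by move=> /ltW t0; rewrite modulusM modulus_beta_integrand.
(* Integrated term by term, the dominating series is the sum of the kernel of order Re beta against
   |f|, divided by Re beta; Hardy's inequality bounds it through [adj_row_bound]. *)
have hb N : \sum_(i < N) \int[mu]_(t in D) (modulus (w i) * complex.Re (beta_integrand b%:C i n t)) <= M / b.
  under eq_bigr do rewrite (si _).2.
  rewrite -mulr_suml ler_pM2r ?invr_gt0//; apply: le_trans (hM n (n + N)%N).
  rewrite [leRHS]big_split_ord/= ler_wpDl// sumr_ge0// => j _.
  by rewrite mulr_ge0 ?modulus_ge0 ?beta_kernel_ge0.
have [Fi Fc] := @cintegral_series R (fun i t => w i * beta_integrand beta i n t)
  (fun i t => modulus (w i) * complex.Re (beta_integrand b%:C i n t))
  (cesaro_adj_integrand beta p f n) (M / b) (fun i => (wi i).1) (fun i => (si i).1) gh hb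
  (fun t tp => @cesaro_adj_integrand_cvg beta p _ f n t lr_bounded (ltW tp)).
split; first exact: Fi.
have cv : cesaro_adj_cvg beta f n by rewrite cesaro_adj_cvgE; exact: (@adj_mean_cvg _ _ r1 _ Rebeta_gt0 _ _ n fH).
apply: (ccvg_unique ((sum_fromP n _ _).1 cv)).
have := @ccvgMl _ beta (fun N => \sum_(i < N) cintegral (fun t => w i * beta_integrand beta i n t)) _ Fc.
apply: cvg_trans; apply: near_eq_cvg; apply: nearW => N /=.
rewrite mulr_sumr; apply: eq_bigr => i _; rewrite (wi i).2 mulrCA (bi i).2 /w.
rewrite /cesaro_adj_term addKn (addnC i n) beta_kernel1E' ?leq_addr// addKn (addrC 1 beta).
have c0 : ('C(n + i, n)%:R : R[i]) != 0 by rewrite pnatr_eq0 -lt0n bin_gt0 leq_addr.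
by move: (cesaro_num (beta + 1) _)^-1 (cesaro_num _ _) (f _) => x y z; field.
Qed.

End AdjointIntegral.

Theorem theorem7p2 (R : realType) (alpha : R) (beta : R[i])
    (alpha_ge0 : 0 <= alpha) (Rebeta_gt0 : 0 < complex.Re beta) :
  [/\ (forall p : \bar R, (1 < p)%E ->
        bounded_on_tau alpha p (cesaro_op beta)),
      (forall p : \bar R, (1 <= p)%E -> (p < +oo)%E ->
        (forall f : nat -> R[i]^o, tau alpha p f ->
          forall n : nat, cesaro_adj_cvg beta f n) /\
        bounded_on_tau alpha p (cesaro_adj beta)),
      (forall p : \bar R, (1 < p)%E ->
        forall f : nat -> R[i]^o, tau alpha p f -> forall n : nat,
          cintegrable (cesaro_integrand beta p f n) /\
          cesaro_op beta f n = beta * cintegral (cesaro_integrand beta p f n))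
    & (forall p : \bar R, (1 <= p)%E -> (p < +oo)%E ->
        forall f : nat -> R[i]^o, tau alpha p f -> forall n : nat,
          [/\ (forall t : R, 0 <= t -> semigroup_S_cvg t f n),
              cintegrable (cesaro_adj_integrand beta p f n)
            & cesaro_adj beta f n =
                beta * cintegral (cesaro_adj_integrand beta p f n)])].
Proof.
split.
- by move=> p p1; exact: bounded_cesaro.
- move=> p p1 py; split=> [f fT n|]; last exact: bounded_cesaro_adj.
  by rewrite cesaro_adj_cvgE; exact: (tau_adj_cvg Rebeta_gt0 alpha_ge0 p1 py fT).
- by move=> p _ f _ n; exact: cesaro_integral.
- case=> [r r1 _ f fT n|//|//]; rewrite lee_fin in r1.
  have [H fH] := tau_lr alpha_ge0 r1 fT.
  have [h1 h2] := cesaro_adj_integral Rebeta_gt0 r1 fH r%:E n.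
  split; [|exact: h1|exact: h2] => t t0; apply/sum_from_cvgE.
  exact: (@semigroup_S_csum_cvg R _ f n t (lr_bounded r1 fH) t0).
Qed.
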